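(* Let $n\ge1$. For a finite dimensional algebra $\Gamma$, the following conditions are equivalent. (a) There exist a finite dimensional algebra $\Lambda$ with $\operatorname{gl.dim}\Lambda\le n$ and an absolute $n$-cluster tilting object $M$ of $\Lambda$ such that $\Gamma\simeq\operatorname{End}_\Lambda(M)$. (b) $\operatorname{gl.dim}\Gamma\le n+1\le\operatorname{dom.dim}\Gamma$ and $\operatorname{Ext}^i_\Gamma(D\Gamma,\Gamma)=0$ for any $0<i\le n$.
   Context: Conventions: algebras are finite dimensional over a field $k$; modules are finitely generated right modules; $D=\operatorname{Hom}_k(-,k)$; subcategories are full and closed under isomorphism, direct sums and direct summands; $\operatorname{add}M$ is the subcategory of direct summands of finite direct sums of copies of $M$. The composition $fg$ of morphisms means first $g$, then $f$. The condition $\operatorname{dom.dim}\Gamma\ge n+1$ means that in the minimal injective resolution $0\to\Gamma\to I_0\to I_1\to\cdots$ of the $\Gamma$-module $\Gamma$, the modules $I_0,\dots,I_n$ are projective. An absolute $n$-cluster tilting object of $\Lambda$ is $M\in\operatorname{mod}\Lambda$ such that $\mathcal C=\operatorname{add}M$ is functorially finite in $\operatorname{mod}\Lambda$ and $\mathcal C=\{X\in\operatorname{mod}\Lambda\mid\operatorname{Ext}^i_\Lambda(X,\mathcal C)=0\ (0<i<n)\}=\{X\in\operatorname{mod}\Lambda\mid\operatorname{Ext}^i_\Lambda(\mathcal C,X)=0\ (0<i<n)\}$. *)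

(* Defs.v *)
From HB Require Import structures.
From mathcomp Require Import all_boot all_order all_algebra all_field.

Set Implicit Arguments.
Unset Strict Implicit.
Unset Printing Implicit Defensive.

Import GRing.Theory.
Local Open Scope ring_scope.

(* Over a finite dimensional k-algebra A the finitely generated right modules
   are the right modules that are finite dimensional over k. Bilinearity of the
   action and [ract1] make c%:A act as the scalar c. *)
Record rmod (k : fieldType) (A : falgType k) := RMod {
  rcar :> vectType k;
  ract : rcar -> A -> rcar;
  ract_linl : forall a, linear (ract^~ a);
  ract_linr : forall x, linear (ract x);
  ract1 : forall x, ract x 1 = x;
  ractM : forall x a b, ract x (a * b) = ract (ract x a) b
}.

Section Modules.
Variables (k : fieldType) (A : falgType k).
Implicit Types X Y Z M P I : rmod A.

Definition rhom X Y (f : 'Hom(X, Y)) : Prop :=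
  forall x a, f (ract x a) = ract (f x) a.

Definition inj_lfun (V W : vectType k) (f : 'Hom(V, W)) : Prop :=
  lker f = 0%VS.

Definition surj_lfun (V W : vectType k) (f : 'Hom(V, W)) : Prop :=
  limg f = fullv.

Definition riso X Y : Prop :=
  exists f : 'Hom(X, Y), [/\ rhom f, inj_lfun f & surj_lfun f].

Definition rsubmod X (U : {vspace X}) : Prop :=
  forall x a, x \in U -> ract x a \in U.

Section DirectSum.
Variables X Y : rmod A.

Definition dsum_act (u : X * Y) (a : A) : X * Y := (ract u.1 a, ract u.2 a).

Fact dsum_linl a : linear (dsum_act^~ a).
Proof. by move=> c u v; rewrite /dsum_act /= !ract_linl. Qed.

Fact dsum_linr u : linear (dsum_act u).
Proof. by move=> c a b; rewrite /dsum_act /= !ract_linr. Qed.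

Fact dsum_act1 u : dsum_act u 1 = u.
Proof. by case: u => x y; rewrite /dsum_act /= !ract1. Qed.

Fact dsum_actM u a b : dsum_act u (a * b) = dsum_act (dsum_act u a) b.
Proof. by rewrite /dsum_act /= !ractM. Qed.

Definition dsum : rmod A :=
  @RMod k A (X * Y)%type dsum_act dsum_linl dsum_linr dsum_act1 dsum_actM.

End DirectSum.

Section Copies.
Variables (X : rmod A) (n : nat).

Definition copies_act (u : {ffun 'I_n -> X}) (a : A) : {ffun 'I_n -> X} :=
  [ffun i => ract (u i) a].

Fact copies_linl a : linear (copies_act^~ a).
Proof. by move=> c u v; apply/ffunP=> i; rewrite !ffunE ract_linl. Qed.

Fact copies_linr u : linear (copies_act u).
Proof. by move=> c a b; apply/ffunP=> i; rewrite !ffunE ract_linr. Qed.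

Fact copies_act1 u : copies_act u 1 = u.
Proof. by apply/ffunP=> i; rewrite !ffunE ract1. Qed.

Fact copies_actM u a b : copies_act u (a * b) = copies_act (copies_act u a) b.
Proof. by apply/ffunP=> i; rewrite !ffunE ractM. Qed.

Definition copies : rmod A :=
  @RMod k A {ffun 'I_n -> X} copies_act
    copies_linl copies_linr copies_act1 copies_actM.

End Copies.

Definition in_add M X : Prop :=
  exists n Y, riso (dsum X Y) (copies M n).

Section Regular.

Fact regular_linl (a : A) : linear (fun x : A => x * a).
Proof. by move=> c x y; rewrite mulrDl scalerAl. Qed.

Fact regular_linr (x : A) : linear (fun a : A => x * a).
Proof. by move=> c a b; rewrite mulrDr scalerAr. Qed.

Definition regular_rmod : rmod A :=
  @RMod k A A (fun x a => x * a)
    regular_linl regular_linr (@mulr1 A) (@mulrA A).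

End Regular.

(* D A = Hom_k(A, k), the dual of the left regular module:
   (phi . a) x = phi (a * x). *)
Section DualRegular.

Definition dual_act (phi : 'Hom(A, k^o)) (a : A) : 'Hom(A, k^o) :=
  (phi \o amull a)%VF.

Fact dual_actE phi a x : dual_act phi a x = phi (a * x).
Proof. by rewrite /dual_act !lfunE /= lfunE. Qed.

Fact dual_linl a : linear (dual_act^~ a).
Proof.
move=> c f g; apply/lfunP=> x.
by rewrite add_lfunE scale_lfunE !dual_actE add_lfunE scale_lfunE.
Qed.

Fact dual_linr phi : linear (dual_act phi).
Proof.
move=> c a b; apply/lfunP=> x.
by rewrite add_lfunE scale_lfunE !dual_actE mulrDl -scalerAl linearP.
Qed.

Fact dual_act1 phi : dual_act phi 1 = phi.
Proof. by apply/lfunP=> x; rewrite dual_actE mul1r. Qed.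

Fact dual_actM phi a b : dual_act phi (a * b) = dual_act (dual_act phi a) b.
Proof. by apply/lfunP=> x; rewrite !dual_actE mulrA. Qed.

Definition dual_regular : rmod A :=
  @RMod k A 'Hom(A, k^o) dual_act dual_linl dual_linr dual_act1 dual_actM.

End DualRegular.

Definition projective P : Prop :=
  forall X Y (g : 'Hom(X, Y)) (f : 'Hom(P, Y)),
    rhom g -> surj_lfun g -> rhom f ->
    exists2 h : 'Hom(P, X), rhom h & (g \o h)%VF = f.

Definition injective_rmod I : Prop :=
  forall X Y (g : 'Hom(X, Y)) (f : 'Hom(X, I)),
    rhom g -> inj_lfun g -> rhom f ->
    exists2 h : 'Hom(Y, I), rhom h & (h \o g)%VF = f.

(* ... -> P_2 -> P_1 -> P_0 -> X -> 0 *)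
Record proj_res X := ProjRes {
  pobj : nat -> rmod A;
  pdiff : forall i, 'Hom(pobj i.+1, pobj i);
  paug : 'Hom(pobj 0, X);
  pobj_proj : forall i, projective (pobj i);
  pdiff_hom : forall i, rhom (pdiff i);
  paug_hom : rhom paug;
  paug_surj : surj_lfun paug;
  pexact0 : limg (pdiff 0) = lker paug;
  pexactS : forall i, limg (pdiff i.+1) = lker (pdiff i)
}.

(* 0 -> X -> I_0 -> I_1 -> I_2 -> ... *)
Record inj_res X := InjRes {
  iobj : nat -> rmod A;
  idiff : forall i, 'Hom(iobj i, iobj i.+1);
  iaug : 'Hom(X, iobj 0);
  iobj_inj : forall i, injective_rmod (iobj i);
  idiff_hom : forall i, rhom (idiff i);
  iaug_hom : rhom iaug;
  iaug_inj : inj_lfun iaug;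
  iexact0 : limg iaug = lker (idiff 0);
  iexactS : forall i, limg (idiff i) = lker (idiff i.+1)
}.

(* I_i is an injective hull of the i-th cosyzygy ker(I_i -> I_{i+1}): every
   nonzero submodule of I_i meets it. *)
Definition minimal_inj_res X (R : inj_res X) : Prop :=
  forall i (U : {vspace iobj R i}),
    rsubmod U -> U <> 0%VS -> (U :&: lker (idiff R i))%VS <> 0%VS.

(* Ext^i(X, Y) is the i-th cohomology of the complex
   0 -> Hom(P_0, Y) -> Hom(P_1, Y) -> ... for a projective resolution P of X. *)
Definition ext_cocycle X Y (R : proj_res X) i (f : 'Hom(pobj R i, Y)) : Prop :=
  rhom f /\ (f \o pdiff R i)%VF = 0.

Definition ext_coboundary X Y (R : proj_res X) i :
    'Hom(pobj R i, Y) -> Prop :=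
  match i with
  | 0 => fun f => f = 0
  | j.+1 => fun f =>
      exists2 g : 'Hom(pobj R j, Y), rhom g & f = (g \o pdiff R j)%VF
  end.

(* Ext^i(X, Y) = 0; the cohomology does not depend on the resolution. *)
Definition ext_zero i X Y : Prop :=
  exists R : proj_res X, forall f : 'Hom(pobj R i, Y),
    ext_cocycle f -> ext_coboundary f.

Definition pdim_le X (d : nat) : Prop :=
  exists R : proj_res X, forall i, (d < i)%N -> dim (pobj R i) = 0%N.

Definition contravariantly_finite (C : rmod A -> Prop) : Prop :=
  forall X, exists Y (f : 'Hom(Y, X)), [/\ C Y, rhom f &
    forall Z (g : 'Hom(Z, X)), C Z -> rhom g ->
      exists2 h : 'Hom(Z, Y), rhom h & g = (f \o h)%VF].

Definition covariantly_finite (C : rmod A -> Prop) : Prop :=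
  forall X, exists Y (f : 'Hom(X, Y)), [/\ C Y, rhom f &
    forall Z (g : 'Hom(X, Z)), C Z -> rhom g ->
      exists2 h : 'Hom(Y, Z), rhom h & g = (h \o f)%VF].

Definition functorially_finite (C : rmod A -> Prop) : Prop :=
  contravariantly_finite C /\ covariantly_finite C.

Definition cluster_tilting (n : nat) M : Prop :=
  [/\ functorially_finite (in_add M),
      forall X, in_add M X <->
        (forall Y, in_add M Y -> forall i, (0 < i < n)%N -> ext_zero i X Y)
    & forall X, in_add M X <->
        (forall Y, in_add M Y -> forall i, (0 < i < n)%N -> ext_zero i Y X)].

End Modules.

Definition gldim_le (k : fieldType) (A : falgType k) (d : nat) : Prop :=
  forall X : rmod A, pdim_le X d.

(* dom.dim A >= m: the first m terms I_0, ..., I_{m-1} of the minimal injective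
   resolution of A are projective. *)
Definition domdim_ge (k : fieldType) (A : falgType k) (m : nat) : Prop :=
  exists2 R : inj_res (regular_rmod A), minimal_inj_res R &
    forall i, (i < m)%N -> projective (iobj R i).

(* phi is an isomorphism of k-algebras from G onto End_A(M), multiplied by
   composition (f g is f after g). The product of the library's ring 'End(M) is
   the opposite one, so composition is spelled out. *)
Definition iso_to_End (k : fieldType) (G A : falgType k) (M : rmod A) : Prop :=
  exists phi : G -> 'End(M),
    [/\ linear phi,
        phi 1 = \1%VF,
        forall a b, phi (a * b) = (phi a \o phi b)%VF,
        injective phi
      & forall f : 'End(M), rhom f <-> exists a, phi a = f].

(* Main.v *)
(** From Gamma to Lambda. Let t be the submodule of D Gamma killed by all
    morphisms to projective-injective modules. The quotient B = D Gamma / t embeds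
    in a projective-injective module, hence pd B <= n; moreover
    Ext^i(B, Gamma) = 0 for 0 < i <= n, because in a coresolution of Gamma by
    projective-injective modules every lift of a morphism from D Gamma kills t.
    So B is projective, D Gamma = t + B, and the projection onto B is
    phi |-> phi(- e) for an idempotent e with e Gamma (1 - e) = 0. Put
    Lambda = e Gamma e = e Gamma and M = Gamma e. As x |-> e x is a ring morphism
    from Gamma to Lambda, every Lambda-module is a Gamma-module; no nonzero
    element of it is killed by Gamma e, so it embeds in a projective-injective
    module and gl.dim Lambda <= n. Since Gamma e is a two-sided ideal, a
    Lambda-morphism from Gamma e to J e, J injective, has the form m |-> x m with
    x in J; this compares coresolutions of a Gamma-module Z with those of the
    Lambda-module Z e. Hence M is rigid, End(M) = Gamma, and X is in add M when
    Ext^i(M, X) = 0 for 0 < i < n. The dual condition follows by resolving X with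
    right add M-approximations.

    From Lambda to Gamma. Let F = Hom(M, -). Approximations by add M bound
    gl.dim Gamma, and F turns an injective coresolution of M into a coresolution of
    Gamma by modules F(I), which are projective and injective. Applying the Nakayama
    functor nu = D Hom(-, Lambda) to a projective resolution of M, gl.dim Lambda <= n
    makes the kernel of nu P_0 -> nu M injective; the resulting splitting gives
    M = P + M' with P projective and Hom(M', Lambda) = 0. Accordingly
    D Gamma = F(nu P) + T with Hom(T, F(I)) = 0 for I injective, so
    Ext^i(D Gamma, Gamma) = Ext^i(T, Gamma) = 0 for 0 < i <= n. *)

Require Import Defs.
From HB Require Import structures.
From mathcomp Require Import all_boot all_order all_algebra all_field zify.
From Stdlib Require Import Classical ClassicalEpsilon.

Set Implicit Arguments.
Unset Strict Implicit.
Unset Printing Implicit Defensive.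

Import GRing.Theory.
Local Open Scope ring_scope.

(** * Modules and their morphisms *)

Section LinearAlgebra.
Variable k : fieldType.
Implicit Types V W U : vectType k.

Lemma lfun_of_subproof V W (f : V -> W) : linear f ->
  {g : 'Hom(V, W) | forall x, g x = f x}.
Proof.
move=> fL; pose g := HB.pack_for {linear V -> W} f (GRing.isLinear.Build k V W _ f fL).
by exists (linfun g) => x; rewrite lfunE.
Qed.

Definition lfun_of V W (f : V -> W) (fL : linear f) : 'Hom(V, W) :=
  sval (lfun_of_subproof fL).

Lemma lfun_ofE V W (f : V -> W) (fL : linear f) x : lfun_of fL x = f x.
Proof. exact: (svalP (lfun_of_subproof fL)). Qed.

Lemma inj_lfunP V W (f : 'Hom(V, W)) :
  inj_lfun f <-> (forall x, f x = 0 -> x = 0).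
Proof.
split=> [f0 x fx0 | f0]; last first.
  apply/eqP; rewrite -subv0; apply/subvP=> x.
  by rewrite memv_ker memv0 => /eqP/f0->.
by have := memv_ker f x; rewrite f0 memv0 fx0 eqxx => /eqP.
Qed.

Lemma inj_lfunK V W (f : 'Hom(V, W)) : (forall x, f x = 0 -> x = 0) ->
  forall x, (f^-1)%VF (f x) = x.
Proof. by move=> /inj_lfunP f0 x; rewrite lker0_lfunK //; apply/eqP. Qed.

Lemma surj_lfunP V W (f : 'Hom(V, W)) :
  surj_lfun f <-> (forall y, exists x, f x = y).
Proof.
split=> [fs y | fs].
  have : y \in limg f by rewrite fs memvf.
  by case/memv_imgP=> x _ ->; exists x.
apply/eqP; rewrite eqEsubv subvf /=; apply/subvP=> y _.
by have [x <-] := fs y; apply: memv_img; rewrite memvf.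
Qed.

Lemma limgP V W (f : 'Hom(V, W)) y : y \in limg f <-> exists x, f x = y.
Proof.
split=> [/memv_imgP[x _ ->] | [x <-]]; first by exists x.
by rewrite memv_img ?memvf.
Qed.

(** A subspace inside [P] is enlarged by a line through a missing element until none is missing; the
    codimension bounds the number of steps. *)
Lemma vspace_of_pred V (P : V -> Prop) : P 0 ->
    (forall (c : k) x y, P x -> P y -> P (c *: x + y)) ->
  {U : {vspace V} | forall x, x \in U <-> P x}.
Proof.
move=> P0 PL; apply: constructive_indefinite_description.
suff [U [UP mU]] : exists U : {vspace V}, (forall x, x \in U -> P x) /\
    forall x, P x -> x \in U by exists U => x; split; [apply: UP | apply: mU].
suff H n (U : {vspace V}) : (dim V - \dim U < n)%N -> (forall x, x \in U -> P x) ->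
   exists U : {vspace V}, (forall x, x \in U -> P x) /\ forall x, P x -> x \in U.
  apply: (H _ 0%VS (ltnSn _)) => x; by rewrite memv0 => /eqP->.
elim: n U => // n IHn U dU UP.
have [mU | /not_all_ex_not[x nUx]] := classic (forall x, P x -> x \in U).
  by exists U.
have [Px /negP Ux] := imply_to_and _ _ nUx.
have lt_dim : (\dim U < \dim (U + <[x]>))%N.
  rewrite ltn_neqAle dimvS ?addvSl // andbT; apply: contraNneq Ux => /esym dE.
  have /eqP-> : (U == U + <[x]>)%VS by rewrite eqEdim addvSl dE /=.
  by rewrite memvE addvSr.
apply: (IHn (U + <[x]>)%VS).
  have := dimvS (subvf (U + <[x]>)%VS); rewrite dimvf => ub.
  rewrite -ltnS (leq_trans _ dU) // ltnS ltn_sub2l //.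
  exact: leq_trans lt_dim ub.
move=> y /memv_addP[u Uu [v /vlineP[c ->] ->]].
by rewrite addrC; apply: PL => //; apply: UP.
Qed.

Definition vset V (P : V -> Prop) P0 PL : {vspace V} :=
  sval (@vspace_of_pred V P P0 PL).

Lemma vsetP V (P : V -> Prop) P0 PL x : x \in @vset V P P0 PL <-> P x.
Proof. exact: (svalP (@vspace_of_pred V P P0 PL)). Qed.

Lemma coord_linear V (i : 'I_(\dim {:V})) :
  linear (coord (vbasis {:V}) i : V -> k^o).
Proof. by move=> c x y; rewrite linearP. Qed.

Definition coordf V (i : 'I_(\dim {:V})) : 'Hom(V, k^o) :=
  lfun_of (@coord_linear V i).

Lemma coordf_sum V (x : V) : x = \sum_(i < \dim {:V}) coordf i x *: (vbasis {:V})`_i.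
Proof.
rewrite {1}(coord_vbasis (memvf x)); apply: eq_bigr => i _.
by rewrite lfun_ofE.
Qed.

Lemma functional_sep V (x : V) : (forall f : 'Hom(V, k^o), f x = 0) -> x = 0.
Proof.
by move=> x0; rewrite (coordf_sum x) big1 // => i _; rewrite x0 scale0r.
Qed.

(** Reflexivity: the vector has as coordinates the values of [F] on the coordinate functionals. *)
Lemma functional_rep V (F : 'Hom('Hom(V, k^o), k^o)) :
  exists x : V, forall f : 'Hom(V, k^o), F f = f x.
Proof.
exists (\sum_(i < \dim {:V}) F (coordf i) *: (vbasis {:V})`_i) => f.
have fE : f = \sum_(i < \dim {:V}) f (vbasis {:V})`_i *: (coordf i : 'Hom(V, k^o)).
  apply/lfunP=> x; rewrite {1}(coordf_sum x) !linear_sum sum_lfunE.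
  apply: eq_bigr => i _; rewrite linearZ scale_lfunE.
  by rewrite /GRing.scale /= mulrC.
rewrite {1}fE !linear_sum; apply: eq_bigr => i _.
by rewrite !linearZ /=; exact: mulrC.
Qed.

(** Since [f f^-1 f = f], the vectors [f^-1 (f x)] and [x] differ by an element of the kernel of
    [f], which [g] kills. *)
Lemma lfun_descend V W U (f : 'Hom(V, W)) (g : 'Hom(V, U)) :
  (forall x, f x = 0 -> g x = 0) -> forall x, (g \o f^-1)%VF (f x) = g x.
Proof.
move=> fg x; rewrite comp_lfunE; apply/eqP; rewrite -subr_eq0 -linearB.
apply/eqP/fg; rewrite linearB /=.
have /lfunP/(_ x) := inv_lfun_def f; rewrite !comp_lfunE => ->.
by rewrite subrr.
Qed.

End LinearAlgebra.

(** * Module morphisms, short exact sequences, submodules and quotients *)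

Section Homs.
Variables (k : fieldType) (A : falgType k).
Implicit Types X Y Z W P I : rmod A.

Section Action.
Variable X : rmod A.

Lemma ractDl (x y : X) a : ract (x + y) a = ract x a + ract y a.
Proof. by have := ract_linl a 1 x y; rewrite !scale1r. Qed.

Lemma ract0l a : ract (0 : X) a = 0.
Proof. by apply: (addrI (ract 0 a)); rewrite -ractDl !addr0. Qed.

Lemma ractZl c (x : X) a : ract (c *: x) a = c *: ract x a.
Proof. by have := ract_linl a c x 0; rewrite ract0l !addr0. Qed.

Lemma ractNl (x : X) a : ract (- x) a = - ract x a.
Proof. by rewrite -scaleN1r ractZl scaleN1r. Qed.

Lemma ractBl (x y : X) a : ract (x - y) a = ract x a - ract y a.
Proof. by rewrite ractDl ractNl. Qed.

Lemma ract_suml T (r : seq T) (Q : pred T) (F : T -> X) a :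
  ract (\sum_(i <- r | Q i) F i) a = \sum_(i <- r | Q i) ract (F i) a.
Proof.
by apply: (big_morph (fun x => ract x a)) => [x y|]; rewrite ?ractDl ?ract0l.
Qed.

Lemma ractDr (x : X) a b : ract x (a + b) = ract x a + ract x b.
Proof. by have := ract_linr x 1 a b; rewrite !scale1r. Qed.

Lemma ract0r (x : X) : ract x 0 = 0.
Proof. by apply: (addrI (ract x 0)); rewrite -ractDr !addr0. Qed.

Lemma ractZr c (x : X) a : ract x (c *: a) = c *: ract x a.
Proof. by have := ract_linr x c a 0; rewrite ract0r !addr0. Qed.

Lemma ract_sumr T (r : seq T) (Q : pred T) (F : T -> A) (x : X) :
  ract x (\sum_(i <- r | Q i) F i) = \sum_(i <- r | Q i) ract x (F i).
Proof. by apply: (big_morph (ract x)) => [a b|]; rewrite ?ractDr ?ract0r. Qed.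

End Action.

Record rmor X Y := RMor { mfun :> 'Hom(X, Y); mact : rhom mfun }.

Lemma morA X Y (f : rmor X Y) x a : f (ract x a) = ract (f x) a.
Proof. exact: mact. Qed.

Section MorLinear.
Variables (X Y : rmod A) (f : rmor X Y).

Lemma mor0 : f 0 = 0. Proof. exact: linear0. Qed.
Lemma morD x y : f (x + y) = f x + f y. Proof. exact: linearD. Qed.
Lemma morB x y : f (x - y) = f x - f y. Proof. exact: linearB. Qed.
Lemma morZ c x : f (c *: x) = c *: f x. Proof. exact: linearZ. Qed.
Lemma mor_sum T (r : seq T) (Q : pred T) (F : T -> X) :
  f (\sum_(i <- r | Q i) F i) = \sum_(i <- r | Q i) f (F i).
Proof. exact: linear_sum. Qed.

End MorLinear.

Lemma mor_of_subproof X Y (f : X -> Y) : linear f ->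
    (forall x a, f (ract x a) = ract (f x) a) ->
  {g : rmor X Y | forall x, g x = f x}.
Proof.
move=> fL fA; have gA : rhom (lfun_of fL) by move=> x a; rewrite !lfun_ofE.
by exists (RMor gA) => x; rewrite /= lfun_ofE.
Qed.

Definition mor_of X Y (f : X -> Y) (fL : linear f)
    (fA : forall x a, f (ract x a) = ract (f x) a) : rmor X Y :=
  sval (mor_of_subproof fL fA).

Lemma mor_ofE X Y (f : X -> Y) (fL : linear f) fA x :
  mor_of fL fA x = f x.
Proof. exact: (svalP (mor_of_subproof fL fA)). Qed.

Fact id_mor_act X (x : X) a : idfun (ract x a) = ract (idfun x) a.
Proof. by []. Qed.

Definition mid X : rmor X X := @mor_of X X idfun (fun _ _ _ => erefl) (@id_mor_act X).

Fact mcomp_act X Y Z (g : rmor Y Z) (f : rmor X Y) : rhom (g \o f)%VF.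
Proof. by move=> x a; rewrite !comp_lfunE !morA. Qed.

Fact madd_act X Y (f g : rmor X Y) : rhom (mfun f + mfun g).
Proof. by move=> x a; rewrite !add_lfunE !morA ractDl. Qed.

Fact mopp_act X Y (f : rmor X Y) : rhom (- mfun f).
Proof. by move=> x a; rewrite !opp_lfunE morA ractNl. Qed.

Fact mscale_act X Y (c : k) (f : rmor X Y) : rhom (c *: mfun f).
Proof. by move=> x a; rewrite !scale_lfunE morA ractZl. Qed.

Fact mzero_act X Y : rhom (0 : 'Hom(X, Y)).
Proof. by move=> x a; rewrite !zero_lfunE ract0l. Qed.

Definition mcomp X Y Z (g : rmor Y Z) (f : rmor X Y) := locked (RMor (mcomp_act g f)).
Definition madd X Y (f g : rmor X Y) := locked (RMor (madd_act f g)).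
Definition mopp X Y (f : rmor X Y) := locked (RMor (mopp_act f)).
Definition mscale X Y (c : k) (f : rmor X Y) := locked (RMor (mscale_act c f)).
Definition mzero X Y : rmor X Y := locked (RMor (@mzero_act X Y)).

Lemma midE X x : mid X x = x. Proof. exact: mor_ofE. Qed.
Lemma mcompE X Y Z (g : rmor Y Z) (f : rmor X Y) x : mcomp g f x = g (f x).
Proof. by rewrite /mcomp -lock comp_lfunE. Qed.
Lemma maddE X Y (f g : rmor X Y) x : madd f g x = f x + g x.
Proof. by rewrite /madd -lock add_lfunE. Qed.
Lemma moppE X Y (f : rmor X Y) x : mopp f x = - f x.
Proof. by rewrite /mopp -lock opp_lfunE. Qed.
Lemma mscaleE X Y c (f : rmor X Y) x : mscale c f x = c *: f x.
Proof. by rewrite /mscale -lock scale_lfunE. Qed.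
Lemma mzeroE X Y x : mzero X Y x = 0.
Proof. by rewrite /mzero -lock zero_lfunE. Qed.

Definition morE := (midE, mcompE, maddE, moppE, mzeroE).

Definition inje X Y (f : rmor X Y) := forall x, f x = 0 -> x = 0.
Definition surje X Y (f : rmor X Y) := forall y, exists x, f x = y.

Lemma inje_inj X Y (f : rmor X Y) : inje f -> injective f.
Proof.
move=> f0 x y fxy; apply/eqP; rewrite -subr_eq0; apply/eqP/f0.
by rewrite linearB /= fxy subrr.
Qed.

(* 0 -> X -> Y -> Z -> 0 *)
Record ses X Y Z (i : rmor X Y) (p : rmor Y Z) : Prop := Ses {
  ses_inj : inje i;
  ses_surj : surje p;
  ses_comp : forall x, p (i x) = 0;
  ses_ker : forall y, p y = 0 -> exists x, i x = y
}.

Lemma proj_lift P : projective P -> forall X Y (g : rmor X Y) (f : rmor P Y),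
  surje g -> exists h : rmor P X, forall x, g (h x) = f x.
Proof.
move=> pP X Y g f /surj_lfunP gs.
have [h hA /lfunP ghf] := pP X Y g f (@mact _ _ g) gs (@mact _ _ f).
by exists (RMor hA) => x; rewrite -ghf comp_lfunE.
Qed.

Lemma projI P : (forall X Y (g : rmor X Y) (f : rmor P Y),
  surje g -> exists h : rmor P X, forall x, g (h x) = f x) -> projective P.
Proof.
move=> pP X Y g f gA /surj_lfunP gs fA.
have [h hE] := pP X Y (RMor gA) (RMor fA) gs.
by exists h; [apply: mact | apply/lfunP=> x; rewrite comp_lfunE -[RHS]hE].
Qed.

Lemma inj_ext I : injective_rmod I -> forall X Y (g : rmor X Y) (f : rmor X I),
  inje g -> exists h : rmor Y I, forall x, h (g x) = f x.
Proof.
move=> pI X Y g f /inj_lfunP gs.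
have [h hA /lfunP ghf] := pI X Y g f (@mact _ _ g) gs (@mact _ _ f).
by exists (RMor hA) => x; rewrite -ghf comp_lfunE.
Qed.

Lemma injI I : (forall X Y (g : rmor X Y) (f : rmor X I),
  inje g -> exists h : rmor Y I, forall x, h (g x) = f x) -> injective_rmod I.
Proof.
move=> pI X Y g f gA /inj_lfunP gs fA.
have [h hE] := pI X Y (RMor gA) (RMor fA) gs.
by exists h; [apply: mact | apply/lfunP=> x; rewrite comp_lfunE -[RHS]hE].
Qed.

Lemma mor_factor_inj X Y W (i : rmor X Y) (f : rmor W Y) : inje i ->
    (forall w, exists x, i x = f w) ->
  exists g : rmor W X, forall w, i (g w) = f w.
Proof.
move=> i0 fi; pose g := (i^-1 \o f)%VF.
have igE w : i (g w) = f w.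
  by rewrite comp_lfunE; have [x <-] := fi w; rewrite inj_lfunK.
have gA : rhom g.
  by move=> w a; apply: (inje_inj i0); rewrite morA !igE morA.
by exists (RMor gA).
Qed.

Lemma mor_factor_surj Y Z W (p : rmor Y Z) (f : rmor Y W) : surje p ->
    (forall y, p y = 0 -> f y = 0) ->
  exists g : rmor Z W, forall y, g (p y) = f y.
Proof.
move=> ps pf; pose g := (f \o p^-1)%VF.
have gE y : g (p y) = f y by apply: lfun_descend.
have gA : rhom g.
  by move=> z a; have [y <-] := ps z; rewrite -morA !gE morA.
by exists (RMor gA).
Qed.

Lemma ses_factor_l X Y Z W (i : rmor X Y) (p : rmor Y Z) (f : rmor W Y) :
  ses i p -> (forall w, p (f w) = 0) ->
  exists g : rmor W X, forall w, i (g w) = f w.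
Proof.
by case=> i0 _ _ ke pf; apply: mor_factor_inj => // w; apply/ke/pf.
Qed.

Lemma ses_factor_r X Y Z W (i : rmor X Y) (p : rmor Y Z) (f : rmor Y W) :
  ses i p -> (forall x, f (i x) = 0) ->
  exists g : rmor Z W, forall y, g (p y) = f y.
Proof.
case=> _ ps _ ke fi; apply: mor_factor_surj => // y /ke[x <-]; exact: fi.
Qed.

Section Submodule.
Variables (X : rmod A) (U : {vspace X}).
Hypothesis Uact : rsubmod U.

Definition sub_act (u : subvs_of U) (a : A) : subvs_of U :=
  vsproj U (ract (vsval u) a).

Fact sub_actE u a : vsval (sub_act u a) = ract (vsval u) a.
Proof. by rewrite /sub_act vsprojK // Uact ?subvsP. Qed.

Fact sub_linl a : linear (sub_act^~ a).
Proof.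
by move=> c u v; apply: subvs_inj; rewrite sub_actE !linearP /= !sub_actE ract_linl.
Qed.

Fact sub_linr u : linear (sub_act u).
Proof. by move=> c a b; apply: subvs_inj;
  rewrite sub_actE linearP /= !sub_actE ract_linr. Qed.

Fact sub_act1 u : sub_act u 1 = u.
Proof. by apply: subvs_inj; rewrite sub_actE ract1. Qed.

Fact sub_actM u a b : sub_act u (a * b) = sub_act (sub_act u a) b.
Proof. by apply: subvs_inj; rewrite !sub_actE ractM. Qed.

Definition submod : rmod A :=
  @RMod k A (subvs_of U) sub_act sub_linl sub_linr sub_act1 sub_actM.

Fact submod_incl_linear : linear (vsval : submod -> X).
Proof. by move=> c u v; rewrite linearP. Qed.

Definition sincl : rmor submod X :=
  mor_of submod_incl_linear sub_actE.

Lemma sinclE u : sincl u = vsval u. Proof. exact: mor_ofE. Qed.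

Lemma sincl_inj : inje sincl.
Proof. by move=> u; rewrite sinclE => u0; apply: subvs_inj; rewrite u0 linear0. Qed.

Lemma sinclP x : x \in U <-> exists u, sincl u = x.
Proof.
split=> [xU | [u <-]]; last by rewrite sinclE subvsP.
by exists (vsproj U x); rewrite sinclE vsprojK.
Qed.

(** The quotient by [U] is carried by a linear complement of [U]: one acts in [X] and projects back
    along [U]. *)
Definition quo_act (u : subvs_of U^C%VS) (a : A) : subvs_of U^C%VS :=
  vsproj U^C (daddv_pi U^C U (ract (vsval u) a)).

Definition quo_fun (x : X) : subvs_of U^C%VS := vsproj U^C (daddv_pi U^C U x).

Fact quo_fun_linear : linear quo_fun.
Proof. by move=> c x y; rewrite /quo_fun !linearP. Qed.

Fact quo_fun_val u : quo_fun (vsval u) = u.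
Proof.
by rewrite /quo_fun daddv_pi_id ?vsvalK ?subvsP // capvC capv_compl.
Qed.

Fact quo_fun0 x : (quo_fun x = 0) <-> (x \in U).
Proof.
have dUC : (U^C :&: U = 0)%VS by rewrite capvC capv_compl.
have xE : daddv_pi U^C U x + daddv_pi U U^C x = x.
  by apply: daddv_pi_add; rewrite // addvC addv_complf memvf.
split=> [/(congr1 vsval) | xU].
  by rewrite vsprojK ?memv_pi // linear0 => E; rewrite -xE E add0r memv_pi.
suff -> : quo_fun x = vsproj U^C 0 by rewrite linear0.
congr (vsproj _ _); apply: (addIr x); rewrite add0r -[RHS]xE.
by congr (_ + _); rewrite daddv_pi_id ?capv_compl.
Qed.

Fact quo_act_fun x a : quo_act (quo_fun x) a = quo_fun (ract x a).
Proof.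
have qB y z : quo_fun (y - z) = quo_fun y - quo_fun z.
  by rewrite -scaleN1r addrC quo_fun_linear scaleN1r addrC.
apply/eqP; rewrite -subr_eq0 -[quo_act _ _]/(quo_fun _) -qB.
apply/eqP/quo_fun0; rewrite -ractBl; apply: Uact.
by apply/quo_fun0; rewrite qB quo_fun_val subrr.
Qed.

Fact quo_linl a : linear (quo_act^~ a).
Proof. by move=> c u v; rewrite /quo_act linearP ract_linl; apply: quo_fun_linear. Qed.

Fact quo_linr u : linear (quo_act u).
Proof. by move=> c a b; rewrite /quo_act ract_linr; apply: quo_fun_linear. Qed.

Fact quo_act1 u : quo_act u 1 = u.
Proof. by rewrite -(quo_fun_val u) quo_act_fun ract1. Qed.

Fact quo_actM u a b : quo_act u (a * b) = quo_act (quo_act u a) b.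
Proof. by rewrite -(quo_fun_val u) !quo_act_fun ractM. Qed.

Definition quomod : rmod A :=
  @RMod k A (subvs_of U^C%VS) quo_act quo_linl quo_linr quo_act1 quo_actM.

Definition qproj : rmor X quomod :=
  @mor_of X quomod quo_fun quo_fun_linear (fun x a => esym (quo_act_fun x a)).

Lemma qproj_surj : surje qproj.
Proof. by move=> u; exists (vsval u); rewrite mor_ofE; apply: quo_fun_val. Qed.

Lemma qprojP x : qproj x = 0 <-> x \in U.
Proof. by rewrite mor_ofE; apply: quo_fun0. Qed.

Lemma submod_ses : ses sincl qproj.
Proof.
split=> [||x|y]; [exact: sincl_inj | exact: qproj_surj | |].
  by apply/qprojP/sinclP; exists x.
by move/qprojP/sinclP.
Qed.

End Submodule.

Lemma mor_lker X Y (f : rmor X Y) : rsubmod (lker f).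
Proof. by move=> x a; rewrite !memv_ker morA => /eqP->; rewrite ract0l. Qed.

Lemma mor_limg X Y (f : rmor X Y) : rsubmod (limg f).
Proof. by move=> y a /limgP[x <-]; apply/limgP; exists (ract x a); rewrite morA. Qed.

Arguments mor_lker {X Y} f _ _.
Arguments mor_limg {X Y} f _ _.

Lemma ses_of_surj Y Z (p : rmor Y Z) : surje p -> exists X (i : rmor X Y), ses i p.
Proof.
move=> ps; exists (submod (mor_lker p)), (sincl (mor_lker p)).
split=> // [|x|y py]; first exact: sincl_inj.
  have /sinclP : exists u, sincl (mor_lker p) u = sincl (mor_lker p) x by exists x.
  by rewrite memv_ker => /eqP.
by apply/sinclP; rewrite memv_ker py.
Qed.

Lemma ses_of_inj X Y (i : rmor X Y) : inje i -> exists Z (p : rmor Y Z), ses i p.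
Proof.
move=> i0; exists (quomod (mor_limg i)), (qproj (mor_limg i)).
split=> // [|x|y]; first exact: qproj_surj.
  by apply/qprojP/limgP; exists x.
by move/qprojP/limgP.
Qed.

Lemma ses_of_pred X (Q : X -> Prop) : Q 0 ->
    (forall (c : k) x y, Q x -> Q y -> Q (c *: x + y)) ->
    (forall x a, Q x -> Q (ract x a)) ->
  exists Y Z (i : rmor Y X) (p : rmor X Z),
    ses i p /\ (forall x, Q x <-> p x = 0).
Proof.
move=> Q0 QL QA; have UA : rsubmod (vset Q0 QL).
  by move=> x a /vsetP Qx; apply/vsetP/QA.
exists (submod UA), (quomod UA), (sincl UA), (qproj UA); split.
  exact: submod_ses.
by move=> x; rewrite qprojP vsetP.
Qed.

End Homs.

Arguments mor_lker {k A X Y} f _ _.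
Arguments mor_limg {k A X Y} f _ _.

(** * Sums of copies, retracts, free and cofree modules *)

Section Add.
Variables (k : fieldType) (A : falgType k).
Implicit Types X Y Z W P I M : rmod A.

Fact copies_pairing X Y m (f : 'I_m -> rmor Y X) :
  exists g : rmor Y (copies X m), forall y i, g y i = f i y.
Proof.
pose g (y : Y) : copies X m := [ffun i => f i y].
have gL : linear g by move=> c x y; apply/ffunP=> i; rewrite !ffunE linearP.
have gA x a : g (ract x a) = ract (g x) a.
  by apply/ffunP=> i; rewrite !ffunE morA.
by exists (mor_of gL gA) => y i; rewrite mor_ofE ffunE.
Qed.

Definition cpair X Y m (f : 'I_m -> rmor Y X) : rmor Y (copies X m) :=
  sval (constructive_indefinite_description _ (copies_pairing f)).

Lemma cpairE X Y m (f : 'I_m -> rmor Y X) y i : cpair f y i = f i y.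
Proof. by rewrite /cpair; case: constructive_indefinite_description => g /=. Qed.

Fact copies_copairing X Y m (f : 'I_m -> rmor X Y) :
  exists g : rmor (copies X m) Y, forall u, g u = \sum_i f i (u i).
Proof.
pose g (u : copies X m) : Y := \sum_i f i (u i).
have gL : linear g.
  move=> c u v; rewrite /g scaler_sumr -big_split /=; apply: eq_bigr => i _.
  by rewrite !ffunE linearP.
have gA u a : g (ract u a) = ract (g u) a.
  by rewrite /g ract_suml; apply: eq_bigr => i _; rewrite ffunE morA.
by exists (mor_of gL gA) => u; rewrite mor_ofE.
Qed.

Definition csum X Y m (f : 'I_m -> rmor X Y) : rmor (copies X m) Y :=
  sval (constructive_indefinite_description _ (copies_copairing f)).

Lemma csumE X Y m (f : 'I_m -> rmor X Y) u : csum f u = \sum_i f i (u i).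
Proof. by rewrite /csum; case: constructive_indefinite_description => g /=. Qed.

Definition cproj X m i : rmor (copies X m) X :=
  csum (fun j => if j == i then mid X else mzero X X).

Lemma cprojE X m i u : @cproj X m i u = u i.
Proof.
rewrite csumE (bigD1 i) //= eqxx midE big1 ?addr0 // => j /negPf->.
exact: mzeroE.
Qed.

Definition cinj X m i : rmor X (copies X m) :=
  cpair (fun j => if j == i then mid X else mzero X X).

Lemma cinjE X m i x j : @cinj X m i x j = if j == i then x else 0.
Proof. by rewrite cpairE; case: ifP; rewrite ?midE ?mzeroE. Qed.

Lemma copies_sum X m (u : copies X m) : u = \sum_i cinj _ i (u i).
Proof.
apply/ffunP=> j; rewrite sum_ffunE (bigD1 j) //= cinjE eqxx big1 ?addr0 // => i ij.
by rewrite cinjE eq_sym (negPf ij).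
Qed.

Definition retract X Y : Prop :=
  exists (s : rmor X Y) (r : rmor Y X), forall x, r (s x) = x.

Lemma retract_refl X : retract X X.
Proof. by exists (mid X), (mid X) => x; rewrite !midE. Qed.

Lemma retract_trans Y X Z : retract X Y -> retract Y Z -> retract X Z.
Proof.
move=> [s [r rs]] [s' [r' rs']]; exists (mcomp s' s), (mcomp r r') => x.
by rewrite !mcompE rs' rs.
Qed.

Lemma retract_copies1 X : retract X (copies X 1).
Proof. by exists (cinj _ ord0), (cproj _ ord0) => x; rewrite cprojE cinjE eqxx. Qed.

Lemma bij_inv X Y (f : rmor X Y) : inje f -> surje f ->
  exists g : rmor Y X, (forall x, g (f x) = x) /\ forall y, f (g y) = y.
Proof.
move=> fi fs; have [g gE] : exists g : rmor Y X, forall y, f (g y) = mid Y y.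
  by apply: mor_factor_inj => // y; rewrite midE.
have fg y : f (g y) = y by rewrite gE midE.
by exists g; split=> // x; apply: (inje_inj fi); rewrite fg.
Qed.

Lemma bij_retract X Y (f : rmor X Y) : inje f -> surje f -> retract Y X.
Proof. by move=> fi fs; have [g [_ fg]] := bij_inv fi fs; exists g, f. Qed.

Lemma bij_retractV X Y (f : rmor X Y) : inje f -> surje f -> retract X Y.
Proof. by move=> fi fs; have [g [gf _]] := bij_inv fi fs; exists f, g. Qed.

(** The kernel of the retraction is the missing complement; from here on direct summands are handled
    as retracts. *)
Lemma in_addP M X : in_add M X <-> exists m, retract X (copies M m).
Proof.
split=> [[m [Y [f [fA f0 fs]]]] | [m [s [r rs]]]].
  have s_lin : linear (fun x : X => f (x, 0)).
    move=> c x y; have E : (0 : Y) = c *: 0 + 0 by rewrite scaler0 addr0.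
    by rewrite -linearP {1}E.
  have sA x a : f (ract x a, 0) = ract (f (x, 0)) a.
    by rewrite -fA; congr (f _); rewrite /= /dsum_act /= ract0l.
  have t_lin : linear (fun u : dsum X Y => u.1) by move=> c u v.
  pose t : rmor (dsum X Y) X := mor_of t_lin (fun u a => erefl).
  have [g gE] : exists g : rmor (copies M m) (dsum X Y),
      forall u, RMor fA (g u) = mid _ u.
    apply: mor_factor_inj; first by apply/inj_lfunP.
    by move=> u; rewrite midE; move/surj_lfunP: fs; apply.
  exists m, (mor_of s_lin sA), (mcomp t g) => x.
  rewrite mcompE !mor_ofE (_ : g _ = (x, 0)) //.
  have fI : inje (RMor fA) by apply/inj_lfunP.
  by apply: (inje_inj fI); rewrite gE midE.
have rS : surje r by move=> x; exists (s x).
have [Y [i ses_ir]] := ses_of_surj rS.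
pose f (u : dsum X Y) : copies M m := s u.1 + i u.2.
have fL : linear f.
  move=> c u v; rewrite /f [(c *: u + v).1]/(c *: u.1 + v.1).
  rewrite [(c *: u + v).2]/(c *: u.2 + v.2) !linearP scalerDr.
  by rewrite -!addrA; congr (_ + _); rewrite addrCA.
have fA u a : f (ract u a) = ract (f u) a by rewrite /f ractDl -!morA.
exists m, Y, (mor_of fL fA); split; first exact: mact.
  apply/inj_lfunP=> [[x y]]; rewrite mor_ofE /f /= => E.
  have x0 : x = 0.
    have := congr1 r E; rewrite linearD /= rs (ses_comp ses_ir) addr0 => ->.
    by rewrite linear0.
  rewrite x0 in E *; congr (_, _); apply: (ses_inj ses_ir).
  by rewrite linear0 add0r in E.
apply/surj_lfunP=> v.
have [y yE] : exists y, i y = v - s (r v).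
  by apply: (ses_ker ses_ir); rewrite linearB /= rs subrr.
by exists (r v, y); rewrite mor_ofE /f /= yE addrC subrK.
Qed.

Lemma proj_retract X Y : retract X Y -> projective Y -> projective X.
Proof.
move=> [s [r rs]] pY; apply: projI => U V g f gs.
have [h hE] := proj_lift pY (mcomp f r) gs.
by exists (mcomp h s) => x; rewrite mcompE hE mcompE rs.
Qed.

Lemma inj_retract X Y : retract X Y -> injective_rmod Y -> injective_rmod X.
Proof.
move=> [s [r rs]] pY; apply: injI => U V g f gi.
have [h hE] := inj_ext pY (mcomp s f) gi.
by exists (mcomp r h) => x; rewrite mcompE hE mcompE rs.
Qed.

Lemma proj_copies P m : projective P -> projective (copies P m).
Proof.
move=> pP; apply: projI => U V g f gs.
have /fin_all_exists[h hE] i : exists h : rmor P U,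
    forall x, g (h x) = mcomp f (cinj _ i) x by apply: proj_lift.
exists (csum h) => u; rewrite csumE linear_sum /= [in RHS](copies_sum u) linear_sum.
by apply: eq_bigr => i _; rewrite hE mcompE.
Qed.

Lemma inj_copies I m : injective_rmod I -> injective_rmod (copies I m).
Proof.
move=> pP; apply: injI => U V g f gi.
have /fin_all_exists[h hE] i : exists h : rmor V I,
    forall x, h (g x) = mcomp (cproj I i) f x by apply: inj_ext.
by exists (cpair h) => u; apply/ffunP=> i; rewrite cpairE hE mcompE cprojE.
Qed.

Definition elt_mor X (x : X) : rmor (regular_rmod A) X :=
  @mor_of _ _ (regular_rmod A) X (ract x) (@ract_linr _ _ _ x) (@ractM _ _ _ x).

Lemma elt_morE X (x : X) a : elt_mor x a = ract x a.
Proof. exact: mor_ofE. Qed.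

Lemma regular_morE X (f : rmor (regular_rmod A) X) a : f a = ract (f 1) a.
Proof. by rewrite -morA /= mul1r. Qed.

Lemma regular_proj : projective (regular_rmod A).
Proof.
apply: projI => U V g f gs; have [u uE] := gs (f 1).
by exists (elt_mor u) => a; rewrite elt_morE morA uE [RHS]regular_morE.
Qed.

Lemma free_cover X : exists m (p : rmor (copies (regular_rmod A) m) X), surje p.
Proof.
exists (\dim {:X}), (csum (fun i : 'I_(\dim {:X}) => elt_mor (vbasis {:X})`_i)) => x.
exists [ffun i => (coordf i x)%:A]; rewrite csumE [RHS](coordf_sum x).
by apply: eq_bigr => i _; rewrite elt_morE ffunE ractZr ract1.
Qed.

Lemma projP P : projective P <-> exists m, retract P (copies (regular_rmod A) m).
Proof.
split=> [pP | [m rP]]; last exact/(proj_retract rP)/proj_copies/regular_proj.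
have [m [p ps]] := free_cover P; exists m.
by have [s sE] := proj_lift pP (mid P) ps; exists s, p => x; rewrite sE midE.
Qed.

(** One half of the adjunction [Hom(X, D A) = D X]; by [mor_dualE] every morphism is recovered from
    its values at 1. *)
Fact dual_mor_subproof X (xi : 'Hom(X, k^o)) : exists f : rmor X (dual_regular A),
  forall x a, f x a = xi (ract x a).
Proof.
have vL (x : X) : linear (fun a : A => xi (ract x a) : k^o).
  by move=> c a b; rewrite ract_linr linearP.
pose f (x : X) : dual_regular A := lfun_of (vL x).
have fL : linear f.
  move=> c x y; apply/lfunP=> a; rewrite add_lfunE scale_lfunE !lfun_ofE.
  by rewrite ract_linl linearP.
have fA x a : f (ract x a) = ract (f x) a.
  by apply/lfunP=> b; rewrite dual_actE !lfun_ofE ractM.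
by exists (mor_of fL fA) => x a; rewrite mor_ofE lfun_ofE.
Qed.

Definition dual_mor X (xi : 'Hom(X, k^o)) : rmor X (dual_regular A) :=
  sval (constructive_indefinite_description _ (dual_mor_subproof xi)).

Lemma dual_morE X (xi : 'Hom(X, k^o)) x a : dual_mor xi x a = xi (ract x a).
Proof. by rewrite /dual_mor; case: constructive_indefinite_description => g /=. Qed.

Lemma mor_dualE X (f : rmor X (dual_regular A)) x a : f x a = f (ract x a) 1.
Proof. by rewrite morA dual_actE mulr1. Qed.

Fact eval1_linear : linear (fun phi : dual_regular A => (phi : 'Hom(A, k^o)) 1 : k^o).
Proof. by move=> c f g; rewrite add_lfunE scale_lfunE. Qed.

Definition eval1 : 'Hom(dual_regular A, k^o) := lfun_of eval1_linear.

Lemma eval1E phi : eval1 phi = (phi : 'Hom(A, k^o)) 1.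
Proof. exact: lfun_ofE. Qed.

(** By the adjunction [Hom(-, D A) = D], extending a morphism amounts to extending a functional from
    a subspace. *)
Lemma dual_inj : injective_rmod (dual_regular A).
Proof.
apply: injI => U V g f gi; exists (dual_mor ((eval1 \o f) \o g^-1)%VF) => x.
apply/lfunP=> a; rewrite dual_morE comp_lfunE -morA inj_lfunK //.
by rewrite comp_lfunE eval1E -mor_dualE.
Qed.

Lemma cofree_embed X :
  exists m (f : rmor X (copies (dual_regular A) m)), inje f.
Proof.
exists (\dim {:X}), (cpair (fun i : 'I_(\dim {:X}) => dual_mor (coordf i))) => x x0.
rewrite (coordf_sum x) big1 // => i _.
have := congr1 (cproj (dual_regular A) i) x0; rewrite cprojE cpairE linear0 => E.
have := dual_morE (coordf i) x 1; rewrite E ract1 => <-.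
by rewrite zero_lfunE scale0r.
Qed.

Lemma cofree_inj m : injective_rmod (copies (dual_regular A) m).
Proof. exact/inj_copies/dual_inj. Qed.

Lemma injP I : injective_rmod I <-> exists m, retract I (copies (dual_regular A) m).
Proof.
split=> [iI | [m rI]]; last by apply: (inj_retract rI); apply: cofree_inj.
have [m [p ps]] := cofree_embed I; exists m.
by have [s sE] := inj_ext iI (mid I) ps; exists p, s => x; rewrite sE midE.
Qed.

Lemma proj_ses X : exists P K (i : rmor K P) (p : rmor P X), projective P /\ ses i p.
Proof.
have [m [p ps]] := free_cover X; have [K [i s]] := ses_of_surj ps.
by exists (copies (regular_rmod A) m), K, i, p; split=> //;
  apply/proj_copies/regular_proj.
Qed.

Lemma inj_ses X : exists I Z (i : rmor X I) (p : rmor I Z), injective_rmod I /\ ses i p.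
Proof.
have [m [i ii]] := cofree_embed X; have [Z [p s]] := ses_of_inj ii.
by exists (copies (dual_regular A) m), Z, i, p; split=> //; apply/cofree_inj.
Qed.

End Add.

(** * Syzygies, projective dimension and Ext *)

Section Ext.
Variables (k : fieldType) (A : falgType k).
Implicit Types (X Y Z W P I M K : rmod A) (S : rmod A -> Prop).

(* X is a retract of X' in the stable category. *)
Definition sretract X X' : Prop :=
  exists (s : rmor X X') (r : rmor X' X) (T : rmod A) (u : rmor X T) (v : rmor T X),
    projective T /\ forall x, x = r (s x) + v (u x).

Lemma zero_proj : projective (copies (regular_rmod A) 0).
Proof. apply: proj_copies; exact: regular_proj. Qed.

Lemma retract_sretract X X' : retract X X' -> sretract X X'.
Proof.
move=> [s [r rs]]; exists s, r, (copies (regular_rmod A) 0), (mzero _ _), (mzero _ _).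
by split=> [|x]; [exact: zero_proj | rewrite rs mzeroE addr0].
Qed.

Lemma sretract_refl X : sretract X X.
Proof. exact/retract_sretract/retract_refl. Qed.

Lemma proj_sretract X X' : sretract X X' -> projective X' -> projective X.
Proof.
move=> [s [r [T [u [v [pT E]]]]]] pX'; apply: projI => U V g f gs.
have [h hE] := proj_lift pX' (mcomp f r) gs.
have [h' h'E] := proj_lift pT (mcomp f v) gs.
exists (madd (mcomp h s) (mcomp h' u)) => x.
by rewrite maddE !mcompE linearD /= hE h'E !mcompE -linearD -E.
Qed.

(** A form of Schanuel's lemma: syzygies of a stable retract are stable retracts, whatever
    presentations are chosen. The lift [a] is recorded because extension problems are transported
    along it. *)
Lemma sretract_syzygy X X' P P' K K' (i : rmor K P) (p : rmor P X)
    (i' : rmor K' P') (p' : rmor P' X') :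
  ses i p -> ses i' p' -> projective P -> projective P' ->
  sretract X X' ->
  exists (s : rmor K K') (r : rmor K' K) (a : rmor P P') (b : rmor P' P) (h : rmor P K),
    [/\ forall x, i' (s x) = a (i x), forall x, i (r x) = b (i' x)
      & forall x, x = r (s x) + h (i x)].
Proof.
move=> sip sip' pP pP' [s [r [T [u [v [pT E]]]]]].
have [a aE] := proj_lift pP (mcomp s p) (ses_surj sip').
have [b bE] := proj_lift pP' (mcomp r p') (ses_surj sip).
have [w wE] := proj_lift pT v (ses_surj sip).
have [s1 s1E] : exists s1 : rmor K K', forall x, i' (s1 x) = mcomp a i x.
  apply: (ses_factor_l sip') => x.
  by rewrite !mcompE aE mcompE (ses_comp sip) linear0.
have [r1 r1E] : exists r1 : rmor K' K, forall x, i (r1 x) = mcomp b i' x.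
  apply: (ses_factor_l sip) => x.
  by rewrite !mcompE bE mcompE (ses_comp sip') linear0.
(* [c = 1 - b a - w u p] lands in [K], since [p c = (1 - r s - v u) p = 0]. *)
pose c := madd (mid P) (mopp (madd (mcomp b a) (mcomp w (mcomp u p)))).
have [h hE] : exists h : rmor P K, forall x, i (h x) = c x.
  apply: (ses_factor_l sip) => x.
  rewrite !morE linearB linearD /= bE mcompE aE mcompE wE.
  by rewrite [X in X - _](E (p x)) subrr.
exists s1, r1, a, b, h; split=> [x|x|x]; first by rewrite s1E mcompE.
  by rewrite r1E mcompE.
apply: (inje_inj (ses_inj sip)).
rewrite linearD /= r1E mcompE s1E hE /c !morE (ses_comp sip) !linear0 addr0.
by rewrite addrC subrK.
Qed.

(** All projective presentations are quantified over, so that no resolution is fixed; for predicates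
    closed under stable retracts a single choice decides ([on_syzygy_syzygy]). *)
Fixpoint on_syzygy (j : nat) S X : Prop :=
  if j is j'.+1 then
    forall K P (i : rmor K P) (p : rmor P X), projective P -> ses i p ->
      on_syzygy j' S K
  else S X.

Definition sclosed S := forall X X', sretract X X' -> S X' -> S X.

Lemma on_syzygy_sclosed j S : sclosed S -> sclosed (on_syzygy j S).
Proof.
move=> Sc; elim: j => // j IHj X X' XX' /= SX' K P i p pP sip.
have [P' [K' [i' [p' [pP' sip']]]]] := proj_ses X'.
have [s [r [a [b [h [_ _ E]]]]]] := sretract_syzygy sip sip' pP pP' XX'.
by apply: IHj (SX' _ _ _ _ pP' sip'); exists s, r, P, i, h.
Qed.

Lemma on_syzygy_retract j S X X' : sclosed S -> retract X X' -> on_syzygy j S X' ->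
  on_syzygy j S X.
Proof. by move=> Sc /retract_sretract; apply: on_syzygy_sclosed. Qed.

Lemma on_syzygy_syzygy j S X K P (i : rmor K P) (p : rmor P X) : sclosed S ->
  projective P -> ses i p -> on_syzygy j S K -> on_syzygy j.+1 S X.
Proof.
move=> Sc pP sip SK K' P' i' p' pP' sip'.
have [s [r [a [b [h [_ _ E]]]]]] := sretract_syzygy sip' sip pP' pP (sretract_refl X).
by apply: (on_syzygy_sclosed Sc) SK; exists s, r, P', i', h.
Qed.

Lemma on_syzygy_sub j S S' X : (forall Y, S Y -> S' Y) -> on_syzygy j S X ->
  on_syzygy j S' X.
Proof.
by move=> SS'; elim: j X => [|j IHj] X /= SX; [exact: SS' | eauto].
Qed.

Definition pd_le d X := on_syzygy d (@projective k A) X.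

Lemma proj_pd_le d X : projective X -> pd_le d X.
Proof.
elim: d X => //= d IHd X pX K P i p pP sip; apply: IHd.
have [s sE] := proj_lift pX (mid X) (ses_surj sip).
have [r rE] : exists r : rmor P K,
    forall x, i (r x) = madd (mid P) (mopp (mcomp s p)) x.
  apply: (ses_factor_l sip) => x.
  by rewrite !morE linearB /= sE midE subrr.
apply: (proj_retract _ pP); exists i, r => x; apply: (inje_inj (ses_inj sip)).
by rewrite rE !morE (ses_comp sip) linear0 subr0.
Qed.

(* ext1_vanish Y X: Ext^1(X, Y) = 0. *)
Definition ext1_vanish Y X : Prop :=
  forall K P (i : rmor K P) (p : rmor P X), projective P -> ses i p ->
    forall f : rmor K Y, exists g : rmor P Y, forall x, g (i x) = f x.

Lemma ext1_vanish_sclosed Y : sclosed (ext1_vanish Y).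
Proof.
move=> X X' XX' EX' K P i p pP sip f.
have [P' [K' [i' [p' [pP' sip']]]]] := proj_ses X'.
have [s [r [a [b [h [sE rE E]]]]]] := sretract_syzygy sip sip' pP pP' XX'.
have [g gE] := EX' _ _ _ _ pP' sip' (mcomp f r).
exists (madd (mcomp g a) (mcomp f h)) => x.
by rewrite maddE !mcompE -sE gE mcompE -linearD -E.
Qed.

(* ext_vanish j X Y: Ext^{j+1}(X, Y) = 0. *)
Definition ext_vanish j X Y := on_syzygy j (ext1_vanish Y) X.

Lemma ext_vanish_retractl j X X' Y : retract X X' -> ext_vanish j X' Y ->
  ext_vanish j X Y.
Proof. exact/on_syzygy_retract/ext1_vanish_sclosed. Qed.

Lemma ext_vanish_sretractl j X X' Y : sretract X X' -> ext_vanish j X' Y ->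
  ext_vanish j X Y.
Proof. by move=> XX'; apply: (on_syzygy_sclosed (@ext1_vanish_sclosed Y)). Qed.

Lemma ext_vanish_retractr j X Y Y' : retract Y Y' -> ext_vanish j X Y' ->
  ext_vanish j X Y.
Proof.
move=> [s [r rs]]; apply: on_syzygy_sub => Z EZ K P i p pP sip f.
have [g gE] := EZ _ _ _ _ pP sip (mcomp s f).
by exists (mcomp r g) => x; rewrite mcompE gE mcompE rs.
Qed.

Lemma ext1_vanish_copies X Y m : ext1_vanish Y X -> ext1_vanish (copies Y m) X.
Proof.
move=> EZ K P i p pP sip f.
have /fin_all_exists[g gE] (l : 'I_m) : exists g : rmor P Y,
  forall x, g (i x) = mcomp (cproj Y l) f x by apply: EZ sip _.
exists (cpair g) => x; apply/ffunP=> l.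
by rewrite cpairE gE mcompE cprojE.
Qed.

Lemma ext_vanish_copiesr j X Y m : ext_vanish j X Y -> ext_vanish j X (copies Y m).
Proof. by apply: on_syzygy_sub => Z; apply: ext1_vanish_copies. Qed.

(** The obstruction to lifting [f] is the class of [c] in Ext^1(X, Y): extending [c] to [d] corrects
    [h] so that it descends to [X]. *)
Lemma ext1_vanish_lift X Y U V (i : rmor Y U) (p : rmor U V) (f : rmor X V) :
  ses i p -> ext1_vanish Y X -> exists g : rmor X U, forall x, p (g x) = f x.
Proof.
move=> sip EX; have [P [K [a [b [pP sab]]]]] := proj_ses X.
have [h hE] := proj_lift pP (mcomp f b) (ses_surj sip).
have [c cE] : exists c : rmor K Y, forall x, i (c x) = mcomp h a x.
  apply: (ses_factor_l sip) => x.
  by rewrite !mcompE hE mcompE (ses_comp sab) linear0.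
have [d dE] := EX _ _ _ _ pP sab c.
have [g gE] : exists g : rmor X U, forall x, g (b x) = madd h (mopp (mcomp i d)) x.
  apply: (ses_factor_r sab) => x.
  by rewrite !morE dE cE mcompE subrr.
exists g => x; have [y <-] := ses_surj sab x.
by rewrite gE !morE linearB /= (ses_comp sip) subr0 hE mcompE.
Qed.

(** Exactness of [Hom(X, U) -> Hom(X, V) -> Ext^1(X, Y) -> Ext^1(X, U)]. With [U] injective, Ext^1
    can thus be tested on a coresolution of [Y]. *)
Lemma ext1_vanish_of_lift X Y U V (i : rmor Y U) (p : rmor U V) :
  ses i p -> ext1_vanish U X ->
  (forall f : rmor X V, exists g : rmor X U, forall x, p (g x) = f x) ->
    ext1_vanish Y X.
Proof.
move=> sip EU lft K P a b pP sab f.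
have [g gE] := EU _ _ _ _ pP sab (mcomp i f).
have [c cE] : exists c : rmor X V, forall x, c (b x) = mcomp p g x.
  apply: (ses_factor_r sab) => x.
  by rewrite mcompE gE mcompE (ses_comp sip).
have [d dE] := lft c.
have [h hE] : exists h : rmor P Y, forall x, i (h x) = madd g (mopp (mcomp d b)) x.
  apply: (ses_factor_l sip) => x.
  by rewrite !morE linearB /= dE cE mcompE subrr.
exists h => x; apply: (inje_inj (ses_inj sip)).
by rewrite hE !morE gE mcompE (ses_comp sab) linear0 subr0.
Qed.

Lemma inj_ext1_vanish X I : injective_rmod I -> ext1_vanish I X.
Proof. by move=> iI K P a b pP sab f; apply: (inj_ext iI) (ses_inj sab). Qed.

Lemma proj_ext1_vanish P Y : projective P -> ext1_vanish Y P.
Proof.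
move=> pP; have [I [Z [i [p [iI sip]]]]] := inj_ses Y.
apply: (ext1_vanish_of_lift sip (inj_ext1_vanish iI)) => f;
  exact: (proj_lift pP) (ses_surj sip).
Qed.

Lemma ext_vanish_inj j X I : injective_rmod I -> ext_vanish j X I.
Proof.
move=> iI; elim: j X => [|j IHj] X; first exact: inj_ext1_vanish.
by move=> K P a b pP sab; apply: IHj.
Qed.

Lemma pd_le_ext_vanish d X Y : pd_le d X -> ext_vanish d X Y.
Proof. by apply: on_syzygy_sub => Z; apply: proj_ext1_vanish. Qed.

Lemma proj_ext_vanish j X Y : projective X -> ext_vanish j X Y.
Proof. by move=> pX; apply/pd_le_ext_vanish/proj_pd_le. Qed.

(* Long exact sequence of Ext(X, -):
   Ext^{j+1}(X, U) -> Ext^{j+1}(X, V) -> Ext^{j+2}(X, Y) -> Ext^{j+2}(X, U). *)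
Lemma ext_vanish_les_quo j X Y U V (i : rmor Y U) (p : rmor U V) : ses i p ->
  ext_vanish j X U -> ext_vanish j.+1 X Y -> ext_vanish j X V.
Proof.
move=> sip; elim: j X => [|j IHj] X EU EY; last first.
  by move=> K P a b pP sab; apply: IHj; [apply: EU sab | apply: EY sab].
move=> K P a b pP sab f.
have [g gE] := ext1_vanish_lift f sip (EY _ _ _ _ pP sab).
have [h hE] := EU _ _ _ _ pP sab g.
by exists (mcomp p h) => x; rewrite mcompE hE gE.
Qed.

Lemma ext_vanish_les_sub j X Y U V (i : rmor Y U) (p : rmor U V) : ses i p ->
  ext_vanish j X V -> ext_vanish j.+1 X U -> ext_vanish j.+1 X Y.
Proof.
move=> sip; elim: j X => [|j IHj] X EV EU; last first.
  by move=> K P a b pP sab; apply: IHj; [apply: EV sab | apply: EU sab].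
move=> K P a b pP sab; apply: (ext1_vanish_of_lift sip (EU _ _ _ _ pP sab)) => f.
have [g gE] := EV _ _ _ _ pP sab f.
have [h hE] := proj_lift pP g (ses_surj sip).
by exists (mcomp h a) => x; rewrite mcompE hE gE.
Qed.

Lemma ext_vanish_shift_sub j X Y I V (i : rmor Y I) (p : rmor I V) :
  injective_rmod I -> ses i p -> ext_vanish j X V -> ext_vanish j.+1 X Y.
Proof. by move=> iI sip EV; apply: (ext_vanish_les_sub sip EV);
  apply: ext_vanish_inj. Qed.

Lemma ext_vanish_shift_quo j X Y I V (i : rmor Y I) (p : rmor I V) :
  injective_rmod I -> ses i p -> ext_vanish j.+1 X Y -> ext_vanish j X V.
Proof. by move=> iI sip EV; apply: (ext_vanish_les_quo sip _ EV);
  apply: ext_vanish_inj. Qed.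

Lemma ses_split X Y Z (i : rmor X Y) (p : rmor Y Z) : ses i p -> ext1_vanish X Z ->
  exists s : rmor Z Y, forall z, p (s z) = z.
Proof.
move=> sip EZ; have [s sE] := ext1_vanish_lift (mid Z) sip EZ.
by exists s => z; rewrite sE midE.
Qed.

End Ext.

(** * Agreement with Ext and projective dimension defined by resolutions *)

Section Resolutions.
Variables (k : fieldType) (A : falgType k).
Implicit Types (X Y Z W P I M K : rmod A) (S : rmod A -> Prop).

Definition cmap X Y m (f : rmor X Y) : rmor (copies X m) (copies Y m) :=
  cpair (fun i => mcomp f (cproj X i)).

Lemma cmapE X Y m (f : rmor X Y) (u : copies X m) i : cmap m f u i = f (u i).
Proof. by rewrite cpairE mcompE cprojE. Qed.

Lemma ses_copies X Y Z (i : rmor X Y) (p : rmor Y Z) m :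
  ses i p -> ses (cmap m i) (cmap m p).
Proof.
case=> i0 ps pi ke; split=> [u u0|u|u|u u0].
- apply/ffunP=> l; rewrite ffunE; apply: i0.
  by rewrite -cmapE u0 ffunE.
- have /fin_all_exists[v vE] l : exists y, p y = u l by apply: ps.
  by exists (finfun v); apply/ffunP=> l; rewrite cmapE ffunE.
- by apply/ffunP=> l; rewrite !cmapE pi ffunE.
have /fin_all_exists[v vE] l : exists y, i y = u l.
  by apply: ke; rewrite -cmapE u0 ffunE.
by exists (finfun v); apply/ffunP=> l; rewrite cmapE ffunE.
Qed.

(** In degree 1 an injective coresolution of [Y] is used, because morphisms out of a direct sum lift
    summand by summand. *)
Lemma ext_vanish_copiesl j X Y m : ext_vanish j X Y -> ext_vanish j (copies X m) Y.
Proof.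
elim: j X => [|j IHj] X EX; last first.
  have [P [K [i [p [pP sip]]]]] := proj_ses X.
  apply: (on_syzygy_syzygy (@ext1_vanish_sclosed _ _ Y) _ (ses_copies m sip)).
    exact: proj_copies.
  by apply: IHj; apply: EX sip.
have [I [Z [i [p [iI sip]]]]] := inj_ses Y.
apply: (ext1_vanish_of_lift sip (inj_ext1_vanish iI)) => f.
have /fin_all_exists[g gE] (l : 'I_m) : exists g : rmor X I,
  forall x, p (g x) = mcomp f (cinj X l) x by apply: (ext1_vanish_lift _ sip EX).
exists (csum g) => u; rewrite csumE linear_sum /= [in RHS](copies_sum u) linear_sum.
by apply: eq_bigr => l _; rewrite gE mcompE.
Qed.

Lemma dim0P X : dim X = 0%N <-> (forall x : X, x = 0).
Proof.
rewrite -dimvf; split=> [/eqP | X0].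
  rewrite dimv_eq0 => /eqP X0 x; apply/eqP.
  by rewrite -memv0 -X0 memvf.
apply/eqP; rewrite dimv_eq0 -subv0; apply/subvP=> x _.
by rewrite memv0 (X0 x).
Qed.

Lemma dim0_proj X : dim X = 0%N -> projective X.
Proof.
move=> /dim0P X0; apply: projI => U V g f _; exists (mzero X U) => x.
by rewrite (X0 x) !linear0.
Qed.

(* The covers are chosen so that the resolution of a projective module is
   trivial: this makes resolutions stop as early as possible. *)
Record cover X := Cover {
  cvP : rmod A; cvK : rmod A;
  cvi : rmor cvK cvP; cvp : rmor cvP X;
  cv_proj : projective cvP;
  cv_ses : ses cvi cvp;
  cv_triv : projective X -> dim cvP = dim X /\ dim cvK = 0%N
}.

Lemma cover_exists X : exists _ : cover X, True.
Proof.
have [pX | npX] := classic (projective X).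
  have [|K [i sip]] := @ses_of_surj _ _ _ _ (mid X).
    by move=> x; exists x; rewrite midE.
  have K0 : dim K = 0%N.
    apply/dim0P=> x; apply: (ses_inj sip).
    by rewrite -(midE (i x)) (ses_comp sip).
  by exists (@Cover X X K i _ pX sip (fun _ => conj erefl K0)).
have [P [K [i [p [pP sip]]]]] := proj_ses X.
by exists (@Cover X P K i _ pP sip (fun pX => False_ind _ (npX pX))).
Qed.

Definition the_cover X : cover X :=
  sval (constructive_indefinite_description _ (cover_exists X)).

Fixpoint syz X i : rmod A :=
  if i is i'.+1 then cvK (the_cover (syz X i')) else X.

Definition res_obj X i := cvP (the_cover (syz X i)).
Definition res_incl X i : rmor (syz X i.+1) (res_obj X i) := cvi (the_cover (syz X i)).
Definition res_cover X i : rmor (res_obj X i) (syz X i) := cvp (the_cover (syz X i)).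
Definition res_ses X i : ses (res_incl X i) (res_cover X i) :=
  cv_ses (the_cover (syz X i)).
Definition res_diff X i : rmor (res_obj X i.+1) (res_obj X i) :=
  mcomp (res_incl X i) (res_cover X i.+1).

Lemma eq_img_ker X Y Z (f : rmor X Y) (g : rmor Y Z) :
  (forall x, g (f x) = 0) -> (forall y, g y = 0 -> exists x, f x = y) ->
  limg f = lker g.
Proof.
move=> gf ke; apply/vspaceP=> y; rewrite memv_ker.
by apply/idP/eqP=> [/limgP[x <-] | /ke[x <-]] //; apply/limgP; exists x.
Qed.

Definition std_res X : proj_res X.
Proof.
apply: (@ProjRes _ _ X (res_obj X) (res_diff X) (res_cover X 0)).
- by move=> i; apply: cv_proj.
- by move=> i; apply: mact.
- exact: mact.
- by apply/surj_lfunP; apply: (ses_surj (res_ses X 0)).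
- apply: eq_img_ker => [x|y /(ses_ker (res_ses X 0))[x <-]].
    by rewrite mcompE (ses_comp (res_ses X 0)).
  have [z <-] := ses_surj (res_ses X 1) x.
  by exists z; rewrite mcompE.
move=> i; apply: eq_img_ker => [x|y].
  by rewrite !mcompE (ses_comp (res_ses X i.+1)) linear0.
rewrite mcompE => /(ses_inj (res_ses X i)) /(ses_ker (res_ses X i.+1))[x <-].
have [z <-] := ses_surj (res_ses X i.+2) x.
by exists z; rewrite mcompE.
Defined.

Lemma on_syzygy_syz j S X : on_syzygy j S X -> S (syz X j).
Proof.
have syzS i Y : syz Y i.+1 = syz (syz Y 1) i by elim: i => //= i <-.
elim: j X => // j IHj X SX; rewrite syzS; apply: IHj.
by apply: SX (res_ses X 0); apply: cv_proj.
Qed.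

Section OfResolution.
Variables (X : rmod A) (R : proj_res X).

Definition rdiff i : rmor (pobj R i.+1) (pobj R i) := RMor (@pdiff_hom _ _ _ R i).
Definition raug : rmor (pobj R 0) X := RMor (@paug_hom _ _ _ R).

Definition rsyz i : rmod A :=
  if i is i'.+1 then submod (mor_limg (rdiff i')) else X.
Definition rincl i : rmor (rsyz i.+1) (pobj R i) := sincl (mor_limg (rdiff i)).

Lemma rcover_exists i : exists c : rmor (pobj R i) (rsyz i),
  match i return rmor (pobj R i) (rsyz i) -> Prop with
  | 0 => fun c => c = raug
  | i'.+1 => fun c => forall x, rincl i' (c x) = rdiff i' x
  end c.
Proof.
case: i => [|i]; first by exists raug.
apply: mor_factor_inj; first exact: sincl_inj.
by move=> x; apply/sinclP/limgP; exists x.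
Qed.

Lemma rsyz_ses i : exists c : rmor (pobj R i) (rsyz i), ses (rincl i) c.
Proof.
case: i => [|i].
  exists raug; split=> [||u|x]; first exact: sincl_inj.
  - by apply/surj_lfunP; apply: paug_surj.
  - have /sinclP : exists v, rincl 0 v = rincl 0 u by exists u.
    by rewrite [limg _](@pexact0 _ _ _ R) memv_ker => /eqP.
  by move=> x0; apply/sinclP; rewrite [limg _](@pexact0 _ _ _ R) memv_ker; apply/eqP.
have [c cE] := rcover_exists i.+1; exists c; split=> [|v|u|x cx0].
- exact: sincl_inj.
- have /sinclP/limgP[x xE] : exists w, rincl i w = rincl i v by exists v.
  by exists x; apply: (inje_inj (@sincl_inj _ _ _ _ _)); rewrite cE xE.
- have /sinclP : exists v, rincl i.+1 v = rincl i.+1 u by exists u.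
  rewrite [limg _](@pexactS _ _ _ R) memv_ker => /eqP u0.
  by apply: (@sincl_inj _ _ _ _ (mor_limg (rdiff i))); rewrite cE.
apply/sinclP; rewrite [limg _](@pexactS _ _ _ R) memv_ker; apply/eqP.
by rewrite -[LHS](cE x) cx0 linear0.
Qed.

Lemma rsyz_on_syzygy i j S : on_syzygy (i + j) S X -> on_syzygy j S (rsyz i).
Proof.
elim: i j => // i IHi j; rewrite addSnnS => /IHi H.
by have [c sic] := rsyz_ses i; apply: (H _ _ _ _ _ sic); exact: (@pobj_proj _ _ _ R i).
Qed.

Lemma on_syzygy_rsyz i j S : sclosed S -> on_syzygy j S (rsyz i) ->
  on_syzygy (i + j) S X.
Proof.
move=> Sc; elim: i j => // i IHi j SR; rewrite addSnnS; apply: IHi.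
have [c sic] := rsyz_ses i.
exact: (on_syzygy_syzygy Sc (@pobj_proj _ _ _ R i) sic SR).
Qed.

(** Cocycles in degree [i + 1] are the morphisms factoring through the image [rsyz i.+1], and
    coboundaries those whose factor extends along [rincl i]; this is Ext^1 of the [i]-th syzygy. *)
Lemma ext_vanish_resP i Y :
  (forall f : 'Hom(pobj R i.+1, Y), ext_cocycle f ->
    ext_coboundary f) <-> ext_vanish i X Y.
Proof.
have [c cE] := rcover_exists i.+1; have [b sib] := rsyz_ses i.
have [c' sic'] := rsyz_ses i.+1.
have cs : surje c.
  move=> v; have /sinclP/limgP[x xE] : exists w, rincl i w = rincl i v by exists v.
  by exists x; apply: (inje_inj (@sincl_inj _ _ _ _ _)); rewrite cE xE.
have EvE : ext_vanish i X Y <-> forall f : rmor (rsyz i.+1) Y,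
    exists g : rmor (pobj R i) Y, forall x, g (rincl i x) = f x.
  split=> [H f | H].
    have H0 : ext1_vanish Y (rsyz i) by have :=
      @rsyz_on_syzygy i 0 (ext1_vanish Y); rewrite addn0; apply.
    exact: (H0 _ _ _ _ (@pobj_proj _ _ _ R i) sib f).
  have := @on_syzygy_rsyz i 0 (ext1_vanish Y) (@ext1_vanish_sclosed _ _ Y);
    rewrite addn0; apply.
  (* Testing on a coresolution of [Y] removes the dependence on the presentation: a lift [h] over
     the term of [R], corrected by [g], descends to [rsyz i]. *)
  have [I [Z [a [p [iI sap]]]]] := inj_ses Y.
  apply: (ext1_vanish_of_lift sap (inj_ext1_vanish iI)) => f.
  have [h hE] := proj_lift (@pobj_proj _ _ _ R i) (mcomp f b) (ses_surj sap).
  have [l lE] : exists l : rmor (rsyz i.+1) Y, forall x, a (l x) = mcomp h (rincl i) x.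
    apply: (ses_factor_l sap) => x.
    by rewrite mcompE hE mcompE (ses_comp sib) linear0.
  have [g gE] := H l.
  have [d dE] : exists d : rmor (rsyz i) I,
    forall x, d (b x) = madd h (mopp (mcomp a g)) x.
    apply: (ses_factor_r sib) => x.
    by rewrite !morE gE lE mcompE subrr.
  exists d => x; have [y <-] := ses_surj sib x.
  by rewrite dE !morE linearB /= (ses_comp sap) subr0 hE mcompE.
rewrite EvE; split=> [H f | H f [fA /lfunP fd]].
  have [|g gA /lfunP gE] := H (mcomp f c).
    split; first exact: mact.
    apply/lfunP=> x; rewrite comp_lfunE mcompE zero_lfunE.
    suff -> : c (pdiff R i.+1 x) = 0 by rewrite linear0.
    apply: (@sincl_inj _ _ _ _ (mor_limg (rdiff i))); rewrite cE.
    apply/eqP; rewrite -memv_ker -[lker _](@pexactS _ _ _ R i).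
    by apply/limgP; exists x.
  exists (RMor gA) => x; have [y <-] := cs x.
  by have := gE y; rewrite mcompE comp_lfunE => ->; rewrite cE.
have [h hE] : exists h : rmor (rsyz i.+1) Y, forall x, h (c x) = RMor fA x.
  apply: mor_factor_surj => // x cx0; apply/eqP; rewrite -memv_ker.
  have : x \in lker (rdiff i) by rewrite memv_ker -cE cx0 linear0.
  rewrite -[lker _](@pexactS _ _ _ R i) => /limgP[y <-].
  by rewrite memv_ker; have := fd y; rewrite comp_lfunE zero_lfunE => /eqP.
have [g gE] := H h; exists g; first exact: mact.
apply/lfunP=> x; rewrite comp_lfunE; have := gE (c x); rewrite hE /= => <-.
by rewrite cE.
Qed.

End OfResolution.

Lemma ext_zeroP i X Y : ext_zero i.+1 X Y <-> ext_vanish i X Y.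
Proof.
split=> [[R /ext_vanish_resP] // | EX].
by exists (std_res X); apply/ext_vanish_resP.
Qed.

(** If the term [d + 1] vanishes, so does the next syzygy, and the [d]-th one is isomorphic to a
    projective term. Conversely, the trivial covers make all terms after the projective [d]-th
    syzygy zero. *)
Lemma pdim_leP X d : pdim_le X d <-> pd_le d X.
Proof.
split=> [[R Rd] | dX].
  rewrite /pd_le -[d]addn0; apply: (@on_syzygy_rsyz _ R d 0);
    first exact: proj_sretract.
  have [c sic] := rsyz_ses R d.
  have cI : inje c.
    move=> x /(ses_ker sic)[u <-]; suff -> : u = 0 by rewrite linear0.
    have [v sv] := rsyz_ses R d.+1; have [y <-] := ses_surj sv u.
    by have /dim0P/(_ y)-> := Rd d.+1 (leqnn _); rewrite linear0.
  by have H := bij_retract cI (ses_surj sic); apply: (proj_retract H);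
    apply: (@pobj_proj _ _ _ R d).
exists (std_res X).
have pd i : projective (syz X (d + i)).
  elim: i => [|i IHi]; first by rewrite addn0; apply: on_syzygy_syz.
  rewrite addnS; apply: dim0_proj.
  by case: (cv_triv (the_cover (syz X (d + i))) IHi).
move=> i; case: i => // i; rewrite ltnS => /subnKC <-.
have [_ E] := cv_triv (the_cover (syz X (d + (i - d)))) (pd _).
by have [-> _] := cv_triv (the_cover (syz X (d + (i - d)).+1)) (dim0_proj E).
Qed.

End Resolutions.

(** * Injective hulls and dominant dimension *)

Lemma ex_min (Q : nat -> Prop) : (exists n, Q n) ->
  exists n, Q n /\ forall m, Q m -> (n <= m)%N.
Proof.
case=> n Qn; elim/ltn_ind: n Qn => n IHn Qn.
have [[m [lt_mn Qm]] | H] := classic (exists m, (m < n)%N /\ Q m).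
  exact: (IHn m).
exists n; split=> // m Qm; rewrite leqNgt; apply/negP=> lt_mn.
by apply: H; exists m.
Qed.

Section Hulls.
Variables (k : fieldType) (A : falgType k).
Implicit Types (X Y Z W P I M K J : rmod A) (JJ : rmod A -> Prop).

Lemma inje_surje X (f : rmor X X) : inje f -> surje f.
Proof.
move=> /inj_lfunP fi; apply/surj_lfunP; apply/eqP; rewrite eqEdim subvf /=.
by have := limg_ker_dim f {:X}; rewrite fi capv0 dimv0 add0n => ->.
Qed.

Lemma surje_inje X (f : rmor X X) : surje f -> inje f.
Proof.
move=> /surj_lfunP fs; apply/inj_lfunP; apply/eqP; rewrite -dimv_eq0.
have := limg_ker_dim f {:X}; rewrite fs capfv => /eqP.
by rewrite -[X in _ == X]add0n eqn_add2r.
Qed.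

Definition essential X I (i : rmor X I) : Prop :=
  forall U : {vspace I}, rsubmod U -> U <> 0%VS -> exists x, i x \in U /\ x <> 0.

(** An injective [I] of least dimension containing [X] is taken. If a nonzero [U] met [X] trivially,
    [I -> I/U -> I] would fix [X] without being injective; an endomorphism [g] of least rank fixing
    [X] would then have a proper image that is injective and contains [X]. *)
Lemma inj_hull X : exists I (i : rmor X I), [/\ injective_rmod I, inje i & essential i].
Proof.
have [I0 [i0 [iI0 i0i]]] : exists I (i : rmor X I), injective_rmod I /\ inje i.
  have [I [Z [i [p [iI sip]]]]] := inj_ses X.
  by exists I, i; split=> //; apply: ses_inj sip.
have [d [[I [i [iI ii dI]]] dmin]] : exists d, (exists I (i : rmor X I),
    [/\ injective_rmod I, inje i & dim I = d]) /\ forall d', (exists I (i : rmor X I),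
    [/\ injective_rmod I, inje i & dim I = d']) -> (d <= d')%N.
  by apply: ex_min; exists (dim I0), I0, i0.
exists I, i; split=> // U Uact U0; apply: NNPP => noU.
have noU' x : i x \in U -> x = 0.
  by move=> ixU; apply: NNPP => x0; apply: noU; exists x.
pose q := qproj Uact.
have [h hE] : exists h : rmor (quomod Uact) I, forall x, h (mcomp q i x) = i x.
  apply: (inj_ext iI) => x; rewrite mcompE => /qprojP; exact: noU'.
have [r [[g [gi gr]] rmin]] : exists r, (exists g : rmor I I,
    (forall x, g (i x) = i x) /\ \dim (limg g) = r) /\ forall r', (exists g : rmor I I,
    (forall x, g (i x) = i x) /\ \dim (limg g) = r') -> (r <= r')%N.
  by apply: ex_min; exists (\dim (limg (mid I))), (mid I); split=> // x; rewrite midE.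
have lt_r : (r < dim I)%N.
  apply: leq_ltn_trans (_ : (\dim (limg (mcomp h q)) < _)%N).
    by apply: rmin; exists (mcomp h q); split=> // x; rewrite mcompE -[RHS]hE mcompE.
  have := limg_ker_dim (mcomp h q) {:I}; rewrite capfv dimvf => <-.
  rewrite -[X in (X < _)%N]add0n ltn_add2r lt0n dimv_eq0.
  apply/eqP=> lk0; apply: U0; apply/eqP; rewrite -subv0 -lk0.
  apply/subvP=> x xU; rewrite memv_ker mcompE.
  by have /qprojP-> := xU; rewrite linear0.
(* By minimality of the rank [g g] and [g] have the same image, so [g] is bijective on its image and
   the image is a retract of [I]. *)
have gg y : exists x, g (g x) = g y.
  suff E : limg (mcomp g g) = limg g.
    have : g y \in limg (mcomp g g) by rewrite E; apply/limgP; exists y.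
    by case/limgP=> x; rewrite mcompE => <-; exists x.
  apply/eqP; rewrite eqEdim; apply/andP; split.
    by apply/subvP=> z /limgP[x <-]; rewrite mcompE; apply/limgP; exists (g x).
  rewrite gr; apply: rmin; exists (mcomp g g); split=> // x.
  by rewrite mcompE !gi.
pose I' := submod (mor_limg g); pose s : rmor I' I := sincl (mor_limg g).
have [c cE] : exists c : rmor I I', forall x, s (c x) = g x.
  apply: mor_factor_inj; first exact: sincl_inj.
  by move=> x; apply/sinclP/limgP; exists x.
have sP u : exists x, s u = g x.
  have /sinclP/limgP[x <-] : exists v, s v = s u by exists u.
  by exists x.
have cs_surj : surje (mcomp c s).
  move=> u; have [x ux] := sP u; have [y yE] := gg x.
  exists (c y); apply: (inje_inj (@sincl_inj _ _ _ _ (mor_limg g))).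
  by rewrite mcompE -!/s cE cE yE ux.
have [t [tcs _]] := bij_inv (surje_inje cs_surj) cs_surj.
have iI' : injective_rmod I'.
  apply: (inj_retract _ iI); exists s, (mcomp t c) => u.
  by rewrite mcompE -[RHS]tcs mcompE.
have [j jE] : exists j : rmor X I', forall x, s (j x) = i x.
  apply: mor_factor_inj; first exact: sincl_inj.
  by move=> x; apply/sinclP/limgP; exists (i x).
have : (d <= dim I')%N.
  apply: dmin; exists I', j; split=> // x jx0; apply: ii.
  by rewrite -jE jx0 linear0.
by rewrite leqNgt -dI [dim I']gr lt_r.
Qed.

Record hull X := Hull {
  huI : rmod A; huZ : rmod A;
  hui : rmor X huI; hup : rmor huI huZ;
  hu_inj : injective_rmod huI;
  hu_ses : ses hui hup;
  hu_ess : essential hui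
}.

Lemma hull_exists X : exists _ : hull X, True.
Proof.
have [I [i [iI ii ei]]] := inj_hull X; have [Z [p sip]] := ses_of_inj ii.
by exists (Hull iI sip ei).
Qed.

Definition the_hull X : hull X :=
  sval (constructive_indefinite_description _ (hull_exists X)).

Fixpoint cosyz X i : rmod A :=
  if i is i'.+1 then huZ (the_hull (cosyz X i')) else X.

Lemma cosyzS i X : cosyz X i.+1 = cosyz (cosyz X 1) i.
Proof. by elim: i => //= i <-. Qed.

Definition cores_obj X i := huI (the_hull (cosyz X i)).
Definition cores_incl X i : rmor (cosyz X i) (cores_obj X i) :=
  hui (the_hull (cosyz X i)).
Definition cores_proj X i : rmor (cores_obj X i) (cosyz X i.+1) :=
  hup (the_hull (cosyz X i)).
Definition cores_ses X i : ses (cores_incl X i) (cores_proj X i) :=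
  hu_ses (the_hull (cosyz X i)).
Definition cores_diff X i : rmor (cores_obj X i) (cores_obj X i.+1) :=
  mcomp (cores_incl X i.+1) (cores_proj X i).

Lemma cores_diff_ker X i x : cores_diff X i x = 0 <-> exists y, cores_incl X i y = x.
Proof.
rewrite mcompE; split=> [/(ses_inj (cores_ses X i.+1)) /(ses_ker (cores_ses X i)) // |].
by case=> y <-; rewrite (ses_comp (cores_ses X i)) linear0.
Qed.

Definition std_cores X : inj_res X.
Proof.
apply: (@InjRes _ _ X (cores_obj X) (cores_diff X) (cores_incl X 0)).
- by move=> i; apply: hu_inj.
- by move=> i; apply: mact.
- exact: mact.
- by apply/inj_lfunP; apply: (ses_inj (cores_ses X 0)).
- by apply: eq_img_ker => [x|y /cores_diff_ker //]; apply/cores_diff_ker; exists x.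
move=> i; apply: eq_img_ker => [x|y /cores_diff_ker[z <-]].
  by apply/cores_diff_ker; exists (cores_proj X i x); rewrite mcompE.
by have [w <-] := ses_surj (cores_ses X i) z; exists w; rewrite mcompE.
Defined.

Lemma std_cores_minimal X : minimal_inj_res (std_cores X).
Proof.
move=> i U Uact /(hu_ess Uact)[x [xU x0]] /eqP; rewrite -subv0 => /subvP UK.
apply: x0; apply: (ses_inj (cores_ses X i)); apply/eqP; rewrite -memv0; apply: UK.
by rewrite memv_cap xU memv_ker /=; apply/eqP/cores_diff_ker; exists x.
Qed.

(** The composite [b a] fixes [X], so its kernel misses [X] and vanishes by essentiality; being an
    automorphism, it splits [a]. Iterated, this makes a minimal coresolution a termwise retract of
    any other. *)
Lemma hull_retract X X' I Z J Z' (i : rmor X I) (p : rmor I Z)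
    (i' : rmor X' J) (p' : rmor J Z') :
  injective_rmod I -> essential i -> injective_rmod J ->
  ses i p -> ses i' p' -> retract X X' -> retract I J /\ retract Z Z'.
Proof.
move=> iI ei iJ sip sip' [s [r rs]].
have [a aE] := inj_ext iJ (mcomp i' s) (ses_inj sip).
have [b bE] := inj_ext iI (mcomp i r) (ses_inj sip').
have baE x : mcomp b a (i x) = i x by rewrite mcompE aE mcompE bE mcompE rs.
have ba_inj : inje (mcomp b a).
  apply/inj_lfunP; apply: NNPP => /(ei _ (mor_lker _))[x [xU]]; apply.
  by apply: (ses_inj sip); rewrite -baE; apply/eqP; rewrite -memv_ker.
have [t [tba _]] := bij_inv ba_inj (inje_surje ba_inj).
have ti x : t (i x) = i x by rewrite -{1}baE tba.
have tbaE x : t (b (a x)) = x by rewrite -[RHS]tba mcompE.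
split; first by exists a, (mcomp t b) => x; rewrite mcompE tbaE.
have [a' a'E] : exists a' : rmor Z Z', forall x, a' (p x) = mcomp p' a x.
  by apply: (ses_factor_r sip) => x; rewrite mcompE aE mcompE (ses_comp sip').
have [b' b'E] : exists b' : rmor Z' Z, forall x, b' (p' x) = mcomp p (mcomp t b) x.
  by apply: (ses_factor_r sip') => x; rewrite !mcompE bE mcompE ti (ses_comp sip).
exists a', b' => z; have [x <-] := ses_surj sip z.
by rewrite a'E mcompE b'E !mcompE tbaE.
Qed.

(* Z has an exact coresolution 0 -> Z -> J_0 -> ... -> J_{m-1} with all J_i in JJ. *)
Fixpoint cores JJ m Z : Prop :=
  if m is m'.+1 then
    exists J Z' (i : rmor Z J) (p : rmor J Z'), [/\ JJ J, ses i p & cores JJ m' Z']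
  else True.

Definition proj_inj J := projective J /\ injective_rmod J.

Lemma cores_retract_obj X X' m i : retract X X' -> cores proj_inj m X' ->
  (i < m)%N -> projective (cores_obj X i).
Proof.
elim: m X X' i => // m IHm X X' i XX' [J [Z' [a [p [[pJ iJ] sap cZ]]]]].
have [IJ ZZ] := hull_retract (@hu_inj _ (the_hull X)) (@hu_ess _ (the_hull X)) iJ
  (cores_ses X 0) sap XX'.
case: i => [_ | i]; first exact: proj_retract IJ pJ.
rewrite /cores_obj ltnS cosyzS; exact: IHm ZZ cZ.
Qed.

Lemma cores_iso JJ m X Y (f : rmor X Y) : inje f -> surje f ->
  cores JJ m Y -> cores JJ m X.
Proof.
move=> fi fs; case: m => // m [J [Z [i [p [jJ sip cZ]]]]].
exists J, Z, (mcomp i f), p; split=> //; split=> [x|||y].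
- by rewrite mcompE => /(ses_inj sip)/fi.
- exact: ses_surj sip.
- by move=> x; rewrite mcompE (ses_comp sip).
move=> /(ses_ker sip)[z <-]; have [x <-] := fs z.
by exists x; rewrite mcompE.
Qed.

(** Dominant dimension can be read off any coresolution, the minimal one being a termwise retract of
    it. Conversely, a given resolution is cut at the kernels of its differentials. *)
Lemma domdim_geP m : domdim_ge A m <-> cores proj_inj m (regular_rmod A).
Proof.
split=> [[R _ Rp] | cA]; last first.
  exists (std_cores (regular_rmod A)); first exact: std_cores_minimal.
  by move=> i; apply: (cores_retract_obj (retract_refl _) cA).
pose d i : rmor (iobj R i) (iobj R i.+1) := RMor (@idiff_hom _ _ _ R i).
pose Z i := submod (mor_lker (d i)).
have dP i x : x \in lker (d i.+1) <-> exists y, d i y = x.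
  by rewrite /= -(@iexactS _ _ _ R i); apply: limgP.
have [p pE] : exists p : forall i, rmor (iobj R i) (Z i.+1),
    forall i x, sincl (mor_lker (d i.+1)) (p i x) = d i x.
  suff H i : exists p : rmor (iobj R i) (Z i.+1),
      forall x, sincl (mor_lker (d i.+1)) (p x) = d i x.
    exists (fun i => sval (constructive_indefinite_description _ (H i))) => i.
    by case: constructive_indefinite_description.
  apply: mor_factor_inj; first exact: sincl_inj.
  by move=> x; apply/sinclP/dP; exists x.
have p_surj i : surje (p i).
  move=> z; have /sinclP/dP[x xE] : exists w, sincl (mor_lker (d i.+1)) w =
    sincl (mor_lker (d i.+1)) z by exists z.
  by exists x; apply: (inje_inj (@sincl_inj _ _ _ _ _)); rewrite pE xE.
have p0 i x : p i x = 0 <-> d i x = 0.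
  split=> [px0 | dx0]; first by rewrite -pE px0 linear0.
  by apply: (@sincl_inj _ _ _ _ (mor_lker (d i.+1))); rewrite pE.
have sZ i : ses (sincl (mor_lker (d i))) (p i).
  split=> [||u|x]; [exact: sincl_inj | exact: p_surj | |].
    apply/p0; apply/eqP; rewrite -memv_ker;
      apply/(sinclP (mor_lker (d i))). by exists u.
  by move=> /p0 dx0; apply/sinclP; rewrite memv_ker dx0.
have cZ l i : (i + l <= m)%N -> cores proj_inj l (Z i).
  elim: l i => // l IHl i; rewrite addnS => lm.
  exists (iobj R i), (Z i.+1), (sincl (mor_lker (d i))), (p i); split; [|exact: sZ|].
    split; last exact: iobj_inj.
    by apply: Rp; apply: leq_trans lm; rewrite ltnS leq_addr.
  by apply: IHl; rewrite addSn.
pose e : rmor (regular_rmod A) (iobj R 0) := RMor (@iaug_hom _ _ _ R).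
have eP x : x \in lker (d 0%N) <-> exists y, e y = x.
  by rewrite /= -(@iexact0 _ _ _ R); apply: limgP.
have [f fE] : exists f : rmor (regular_rmod A) (Z 0%N), forall x,
    sincl (mor_lker (d 0%N)) (f x) = e x.
  apply: mor_factor_inj; first exact: sincl_inj.
  by move=> x; apply/sinclP/eP; exists x.
have e_inj : inje e by apply/inj_lfunP; apply: iaug_inj.
apply: (@cores_iso _ _ _ _ f _ _ (cZ m 0%N (leqnn _))) => [x fx0|z].
  by apply: e_inj; rewrite -fE fx0 linear0.
have /sinclP/eP[x xE] : exists w, sincl (mor_lker (d 0%N)) w =
  sincl (mor_lker (d 0%N)) z by exists z.
by exists x; apply: (inje_inj (@sincl_inj _ _ _ _ _)); rewrite fE xE.
Qed.

End Hulls.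

Arguments proj_inj {k A} J.

(** * Approximations and cluster tilting *)

Section ClusterTilting.
Variables (k : fieldType) (A : falgType k).
Implicit Types (X Y Z W P I M K J : rmod A).

Fact rhomP X Y (c : k) (f g : 'Hom(X, Y)) : rhom f -> rhom g -> rhom (c *: f + g).
Proof.
move=> fA gA x a; rewrite !add_lfunE !scale_lfunE fA gA.
by rewrite ractDl ractZl.
Qed.

Definition homs X Y : {vspace 'Hom(X, Y)} := vset (@mzero_act k A X Y) (@rhomP X Y).

Lemma homsP X Y (f : 'Hom(X, Y)) : f \in homs X Y <-> rhom f.
Proof. exact: vsetP. Qed.

Lemma homs_mor X Y (f : rmor X Y) : mfun f \in homs X Y.
Proof. exact/homsP/mact. Qed.

Lemma hom_basis X Y : exists m (b : 'I_m -> rmor X Y),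
  forall f : rmor X Y, exists c : 'I_m -> k, forall x, f x = \sum_i c i *: b i x.
Proof.
pose U := homs X Y; exists (\dim U).
have bA (i : 'I_(\dim U)) : rhom (vbasis U)`_i.
  by apply/homsP/vbasis_mem; rewrite mem_nth ?size_tuple.
exists (fun i => RMor (bA i)) => f; exists (fun i => coord (vbasis U) i (mfun f)) => x.
rewrite {1}(coord_vbasis (homs_mor f)) sum_lfunE.
by apply: eq_bigr => i _; rewrite scale_lfunE.
Qed.

(** One copy of [M] is taken for each element of a basis of [Hom(M, X)]. *)
Lemma right_approx M X : exists m (f : rmor (copies M m) X),
  forall g : rmor M X, exists h : rmor M (copies M m), forall x, f (h x) = g x.
Proof.
have [m [b bE]] := hom_basis M X; exists m, (csum b) => g.
have [c cE] := bE g; exists (cpair (fun i => mscale (c i) (mid M))) => x.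
rewrite csumE cE; apply: eq_bigr => i _.
by rewrite cpairE mscaleE midE linearZ.
Qed.

Lemma left_approx M X : exists m (f : rmor X (copies M m)),
  forall g : rmor X M, exists h : rmor (copies M m) M, forall x, h (f x) = g x.
Proof.
have [m [b bE]] := hom_basis X M; exists m, (cpair b) => g.
have [c cE] := bE g; exists (csum (fun i => mscale (c i) (mid M))) => x.
rewrite csumE cE; apply: eq_bigr => i _.
by rewrite cpairE mscaleE midE.
Qed.

Lemma in_add_copies M m : in_add M (copies M m).
Proof. apply/in_addP; exists m; exact: retract_refl. Qed.

Lemma in_add_refl M : in_add M M.
Proof. by apply/in_addP; exists 1%N; apply: retract_copies1. Qed.

Lemma in_add_retract M X Y : retract X Y -> in_add M Y -> in_add M X.
Proof.
move=> XY /in_addP[m Ym]; apply/in_addP; exists m; exact: retract_trans XY Ym.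
Qed.

Lemma in_add_finite M : functorially_finite (in_add M).
Proof.
split=> X.
  have [m [f fE]] := right_approx M X; exists (copies M m), f.
  split=> [||Z g0 /in_addP[l [s [r rs]]] gA]; [exact: in_add_copies | exact: mact |].
  pose g := RMor gA.
  have /fin_all_exists[h hE] (i : 'I_l) : exists h : rmor M (copies M m),
    forall x, f (h x) = mcomp g (mcomp r (cinj M i)) x by apply: fE.
  exists (mcomp (csum h) s); first exact: mact.
  apply/lfunP=> z; rewrite comp_lfunE mcompE csumE mor_sum -[LHS]/(g z).
  rewrite -{1}(rs z) {1}(copies_sum (s z)) !mor_sum.
  by apply: eq_bigr => i _; rewrite hE !mcompE.
have [m [f fE]] := left_approx M X; exists (copies M m), f.
split=> [||Z g0 /in_addP[l [s [r rs]]] gA]; [exact: in_add_copies | exact: mact |].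
pose g := RMor gA.
have /fin_all_exists[h hE] (i : 'I_l) : exists h : rmor (copies M m) M,
  forall x, h (f x) = mcomp (cproj M i) (mcomp s g) x by apply: fE.
exists (mcomp r (cpair h)); first exact: mact.
apply/lfunP=> z; rewrite comp_lfunE mcompE -[LHS]/(g z) -{1}(rs (g z)).
congr (r _); apply/ffunP=> i.
by rewrite cpairE hE !mcompE cprojE.
Qed.

Lemma ext_addlP n X M :
  (forall Y, in_add M Y -> forall i, (0 < i < n)%N -> ext_zero i X Y) <->
  (forall j, (j.+1 < n)%N -> ext_vanish j X M).
Proof.
split=> [H j jn | H Y /in_addP[m Ym] [|j] // jn].
  by apply/ext_zeroP/H; first exact: in_add_refl.
by apply/ext_zeroP/(ext_vanish_retractr Ym)/ext_vanish_copiesr/H.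
Qed.

Lemma ext_addrP n X M :
  (forall Y, in_add M Y -> forall i, (0 < i < n)%N -> ext_zero i Y X) <->
  (forall j, (j.+1 < n)%N -> ext_vanish j M X).
Proof.
split=> [H j jn | H Y /in_addP[m Ym] [|j] // jn].
  by apply/ext_zeroP/H; first exact: in_add_refl.
by apply/ext_zeroP/(ext_vanish_retractl Ym)/ext_vanish_copiesl/H.
Qed.

(** As [A] is in add M, every element of [K] lies in the image of a morphism from copies of [M];
    hence the approximation is surjective. *)
Lemma add_approx M K : in_add M (regular_rmod A) ->
  exists m X (i : rmor X (copies M m)) (p : rmor (copies M m) K), ses i p /\
    forall g : rmor M K, exists h : rmor M (copies M m), forall x, p (h x) = g x.
Proof.
move=> /in_addP[l [s [r rs]]]; have [m [f fE]] := right_approx M K.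
have fs : surje f.
  move=> x; have /fin_all_exists[h hE] (i : 'I_l) : exists h : rmor M (copies M m),
    forall y, f (h y) = mcomp (elt_mor x) (mcomp r (cinj M i)) y by apply: fE.
  exists (csum h (s 1)); rewrite csumE mor_sum.
  have xE : x = mcomp (elt_mor x) r (s 1) by rewrite mcompE rs elt_morE ract1.
  rewrite [RHS]xE [in RHS](copies_sum (s 1)) mor_sum.
  by apply: eq_bigr => i _; rewrite hE !mcompE.
by have [X [i sif]] := ses_of_surj fs; exists m, X, i, f.
Qed.

(** * Resolutions by approximations of a rigid module *)

Section Rigid.
Variables (n : nat) (M : rmod A).
Hypothesis rigid : forall j, (j.+1 < n)%N -> ext_vanish j M M.

(** The kernel of an approximation gains one degree of vanishing: Ext^1 vanishes because morphisms
    from [M] lift, the higher degrees by the long exact sequence. *)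
Lemma approx_ext_vanish m X K (i : rmor X (copies M m)) (p : rmor (copies M m) K) l :
  ses i p ->
  (forall g : rmor M K, exists h : rmor M (copies M m), forall x, p (h x) = g x) ->
  (forall j, (j + l.+1 < n)%N -> ext_vanish j M K) ->
  forall j, (j + l < n)%N -> (j.+1 < n)%N -> ext_vanish j M X.
Proof.
move=> sip app EK [|j] jln jn.
  by apply: (ext1_vanish_of_lift sip) => //; apply/ext1_vanish_copies/(rigid (j :=
    0)); lia.
apply: (ext_vanish_les_sub sip); first by apply: EK; lia.
by apply/ext_vanish_copiesr/rigid; lia.
Qed.

(** After [l] approximations the kernel is in add M, so [K] has an add M-resolution of length [l];
    the vanishing of Ext(X, M) is carried along it, losing [l] degrees. *)
Lemma ct_resolve l K :
    (forall X, (forall j, (j.+1 < n)%N -> ext_vanish j M X) -> in_add M X) ->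
    in_add M (regular_rmod A) ->
    (forall j, (j + l.+1 < n)%N -> ext_vanish j M K) ->
  forall X, (forall j, (j.+1 < n)%N -> ext_vanish j X M) ->
  forall j, (j + l.+1 < n)%N -> ext_vanish j X K.
Proof.
move=> ct gen; elim: l K => [|l IHl] K EK X EX j jn.
  have /ct/in_addP[m Km] : forall j, (j.+1 < n)%N -> ext_vanish j M K.
    by move=> i ?; apply: EK; lia.
  by apply/(ext_vanish_retractr Km)/ext_vanish_copiesr/EX; lia.
have [m [K' [i [p [sip app]]]]] := add_approx K gen.
apply: (ext_vanish_les_quo sip); first by apply/ext_vanish_copiesr/EX; lia.
apply: IHl => //; last by lia.
by move=> i' i'n; apply: (approx_ext_vanish sip app EK); lia.
Qed.

(** For [n >= 2] the approximation sequence of [X] splits, as its kernel [K] satisfies Ext^1(X, K) =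
    0. For [n <= 1] both conditions are void. *)
Lemma ct_left :
    (forall X, (forall j, (j.+1 < n)%N -> ext_vanish j M X) -> in_add M X) ->
    in_add M (regular_rmod A) ->
  forall X, (forall j, (j.+1 < n)%N -> ext_vanish j X M) -> in_add M X.
Proof.
move=> ct gen X EX; have [n1 | n2] := leqP n 1.
  by apply: ct => j jn; exfalso; lia.
have [m [K [i [p [sip app]]]]] := add_approx X gen.
have EK : ext_vanish 0 M K.
  by apply: (ext1_vanish_of_lift sip) => //; apply/ext1_vanish_copies/(rigid (j := 0)).
have {}EK : ext_vanish 0 X K.
  (* With [l = n - 2] the only degree concerned, in hypothesis and conclusion, is Ext^1. *)
  apply: (@ct_resolve (n - 2)) => // [j jn|]; last by lia.
  by have -> : j = 0%N by lia.
have [s sE] := ses_split sip EK.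
by apply/in_addP; exists m, s, p.
Qed.

End Rigid.

(** Only one of the two orthogonality conditions has to be checked; the other one is [ct_left]. *)
Lemma cluster_tilting_intro n M :
    in_add M (regular_rmod A) ->
    (forall j, (j.+1 < n)%N -> ext_vanish j M M) ->
    (forall X, (forall j, (j.+1 < n)%N -> ext_vanish j M X) -> in_add M X) ->
  cluster_tilting n M.
Proof.
move=> gen rig ct; split; first exact: in_add_finite.
  move=> X; rewrite ext_addlP; split; last exact: ct_left.
  by move=> /in_addP[m Xm] j jn; apply/(ext_vanish_retractl Xm)/ext_vanish_copiesl/rig.
move=> X; rewrite ext_addrP; split; last exact: ct.
by move=> /in_addP[m Xm] j jn; apply/(ext_vanish_retractr Xm)/ext_vanish_copiesr/rig.
Qed.

Lemma cluster_tilting_elim n M : cluster_tilting n M ->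
  [/\ in_add M (regular_rmod A), forall I, injective_rmod I -> in_add M I,
      forall j, (j.+1 < n)%N -> ext_vanish j M M &
      forall X, (forall j, (j.+1 < n)%N -> ext_vanish j M X) -> in_add M X].
Proof.
case=> _ ctl ctr; split.
- by apply/ctl/ext_addlP => j _; apply: proj_ext_vanish; apply: regular_proj.
- by move=> I iI; apply/ctr/ext_addrP => j _; apply: ext_vanish_inj.
- by apply/ext_addlP/ctl; apply: in_add_refl.
by move=> X EX; apply/ctr/ext_addrP.
Qed.

End ClusterTilting.

(** * The triangular idempotent of Gamma *)

Section Idempotent.
Variables (k : fieldType) (G : falgType k).
Implicit Types (X Y Z W P I M K J : rmod G).

Lemma dualE (phi : dual_regular G) a x : (ract phi a) x = phi (a * x).
Proof. exact: dual_actE. Qed.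

(** By induction the syzygy [K] is projective, so Ext^1(X, K) = 0 and the cover of [X] splits. *)
Lemma proj_of_ext_vanish d X : pd_le d X -> (forall j, (j < d)%N ->
  ext_vanish j X (regular_rmod G)) ->
  projective X.
Proof.
elim: d X => // d IHd X dX EX; have [P [K [i [p [pP sip]]]]] := proj_ses X.
have pK : projective K.
  by apply: IHd => [|j jd]; [apply: dX sip | apply: (EX j.+1 jd) sip].
have /projP[m Km] := pK.
have EK : ext_vanish 0 X K by apply/(ext_vanish_retractr Km)/ext_vanish_copiesr/EX.
have [s sE] := ses_split sip EK.
by apply: (@proj_retract _ _ X P) => //; exists s, p.
Qed.

(* Morphisms into the J's kill the kernel of p, so a lift of f p factors
   through p. *)
Lemma ext_vanish_quo (JJ : rmod G -> Prop) j X B Z (p : rmor X B) : surje p ->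
  (forall J, JJ J -> injective_rmod J) ->
  (forall J (h : rmor X J), JJ J -> forall x, p x = 0 -> h x = 0) ->
  cores JJ j.+1 Z -> ext_vanish j X Z -> ext_vanish j B Z.
Proof.
move=> ps JI kill; elim: j Z => [|j IHj] Z [J [Z' [a [b [jJ sab cZ]]]]] EX.
  apply: (ext1_vanish_of_lift sab); first exact/inj_ext1_vanish/JI.
  move=> f; have [g gE] := ext1_vanish_lift (mcomp f p) sab EX.
  have [h hE] : exists h : rmor B J, forall x, h (p x) = g x.
    by apply: mor_factor_surj => // x; apply: kill.
  by exists h => y; have [x <-] := ps y; rewrite hE gE mcompE.
apply: (ext_vanish_shift_sub (JI J jJ) sab); apply: IHj => //.
exact: ext_vanish_shift_quo (JI J jJ) sab EX.
Qed.

(** For the idempotent constructed below these are exactly the submodules of projective-injective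
    modules. *)
Definition torsionfree (e : G) X : Prop :=
  forall x : X, (forall g, ract x (g * e) = 0) -> x = 0.

Lemma proj_inj_copies J m : proj_inj J -> proj_inj (copies J m).
Proof. by case=> pJ iJ; split; [apply: proj_copies | apply: inj_copies]. Qed.

Lemma cores_mono JJ m l Z : (l <= m)%N -> cores JJ m Z -> @cores _ G JJ l Z.
Proof.
elim: l m Z => // l IHl [|m] // Z lm [J [Z' [a [b [jJ sab cZ]]]]].
by exists J, Z', a, b; split=> //; apply: IHl cZ.
Qed.

Fact eval_linear (a : G) :
  linear (fun phi : dual_regular G => (phi : 'Hom(G, k^o)) a : k^o).
Proof. by move=> c f g; rewrite add_lfunE scale_lfunE. Qed.

Definition rmul_dual (a : G) : rmor (dual_regular G) (dual_regular G) :=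
  dual_mor (lfun_of (eval_linear a)).

Lemma rmul_dualE a (phi : dual_regular G) x : rmul_dual a phi x = phi (x * a).
Proof. by rewrite dual_morE lfun_ofE dualE. Qed.

(** By reflexivity, the functional [phi |-> f phi 1] on [D Gamma] is evaluation at some [a]. *)
Lemma dual_end (f : rmor (dual_regular G) (dual_regular G)) :
  exists a, forall phi x, f phi x = phi (x * a).
Proof.
have [a aE] := functional_rep (eval1 G \o f)%VF.
exists a => phi x; rewrite mor_dualE.
by have := aE (ract phi x); rewrite comp_lfunE eval1E dualE => ->.
Qed.

Lemma triangular_idempotent n :
  (forall X, pd_le n.+1 X) -> cores proj_inj n.+1 (regular_rmod G) ->
  (forall j, (j < n)%N -> ext_vanish j (dual_regular G) (regular_rmod G)) ->
  exists e : G, [/\ e * e = e, forall g, e * g * e = e * g,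
    forall J, proj_inj J -> torsionfree e J &
    forall X, torsionfree e X -> exists J (f : rmor X J), proj_inj J /\ inje f].
Proof.
move=> gl cG Ed.
have [J0 [Z0 [a0 [b0 [jJ0 sab0 _]]]]] := cG.
pose D := dual_regular G.
have [m [f fE]] := left_approx J0 D.
(* [J] embeds in copies of [Gamma], hence of [J0], and morphisms to [J0] factor through [f]; so the
   kernel of [f] is the submodule t of the overview. *)
have kill J (h : rmor D J) : proj_inj J -> forall phi, f phi = 0 -> h phi = 0.
  move=> [pJ _] phi fphi; have /projP[l [s [r rs]]] := pJ.
  suff sh : s (h phi) = 0 by rewrite -[LHS]rs sh mor0.
  apply/ffunP=> i; rewrite [RHS]ffunE.
  apply: (ses_inj sab0).
  have [g gE] := fE (mcomp a0 (mcomp (cproj _ i) (mcomp s h))).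
  by have := gE phi; rewrite fphi mor0 !mcompE cprojE => <-.
pose B := submod (mor_limg f); pose c : rmor B _ := sincl (mor_limg f).
have c_inj : inje c := @sincl_inj _ _ _ _ (mor_limg f).
have [p pE] : exists p : rmor D B, forall x, c (p x) = f x.
  by apply: mor_factor_inj => // x; apply/(sinclP (mor_limg f))/limgP; exists x.
have ps : surje p.
  move=> b; have /(sinclP (mor_limg f))/limgP[x xE] : exists b', c b' = c b by exists b.
  by exists x; apply: (inje_inj c_inj); rewrite pE.
have p0 phi : p phi = 0 <-> f phi = 0.
  by split=> [E | E]; [rewrite -pE E mor0 | apply: c_inj; rewrite pE].
(* [B] embeds in copies of the projective [J0], so it is a syzygy and has projective dimension at
   most [n]. *)
have pB : projective B.
  apply: (@proj_of_ext_vanish n).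
    have [C [q scq]] := ses_of_inj c_inj.
    exact: gl C _ _ c q (proj_inj_copies m jJ0).1 scq.
  move=> j jn; apply: (ext_vanish_quo (JJ := proj_inj) ps) (Ed j jn).
  - by move=> J [].
  - by move=> J h jJ x /p0; apply: kill.
  by apply: (cores_mono _ cG); apply: leqW.
have [s sE] := proj_lift pB (mid B) ps.
(* The idempotent endomorphism [s p], with the same kernel as [f], is dual to right multiplication
   by [e]. *)
have [e eE] := dual_end (mcomp s p).
pose pi := mcomp s p.
have pi0 phi : pi phi = 0 <-> f phi = 0.
  rewrite -p0 mcompE; split=> [E | ->]; last by rewrite mor0.
  by rewrite -[LHS]midE -sE E mor0.
have ee : e * e = e.
  apply/eqP; rewrite -subr_eq0; apply/eqP/functional_sep => phi.
  rewrite linearB /= -[e in X in _ - X]mul1r -[e * e]mul1r mulrA -!eE.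
  by rewrite !mcompE sE midE subrr.
have pi_stable a phi : f phi = 0 -> pi (rmul_dual a phi) = 0.
  move=> f0; apply/pi0.
  by have := kill _ (mcomp f (rmul_dual a)) (proj_inj_copies m jJ0) _ f0;
    rewrite mcompE.
have f_pi phi : f (phi - pi phi) = 0.
  by apply/p0; rewrite morB !mcompE sE midE subrr.
have tri g : e * g * e = e * g.
  apply/esym/eqP; rewrite -subr_eq0; apply/eqP/functional_sep => phi.
  (* [a = e g (1 - e)]. As [e a = a], [phi(- a)] is in the image of [pi]; as [a e = 0], it depends
     only on [phi - pi phi], and so lies in the kernel of [pi], which is stable under [rmul_dual a].
     Hence it is zero. *)
  set a := _ - _.
  have ea : e * a = a by rewrite mulrBr !mulrA ee.
  have ae : a * e = 0 by rewrite mulrBl -[_ * e * e]mulrA ee subrr.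
  have h1 : rmul_dual a phi = pi (rmul_dual a phi).
    by apply/lfunP=> x; rewrite eE !rmul_dualE -mulrA ea.
  have h2 : rmul_dual a (pi phi) = 0.
    apply/lfunP=> x; rewrite rmul_dualE eE -mulrA ae mulr0.
    by rewrite linear0 zero_lfunE.
  have h3 : pi (rmul_dual a phi) = 0.
    have := pi_stable a _ (f_pi phi).
    by rewrite morB h2 subr0.
  have := rmul_dualE a phi 1; rewrite mul1r h1 h3 => <-.
  by rewrite zero_lfunE.
(* [J] is a retract of copies of [D Gamma]; the components of an [x] killed by [Gamma e] lie in the
   kernel of [pi], hence die under every morphism to [J]. *)
exists e; split=> // [J jJ x xe|X Xt].
  have [_ iJ] := jJ; have /injP[l [u [r ru]]] := iJ.
  rewrite -[LHS]ru (copies_sum (u x)) mor_sum big1 // => i _.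
  rewrite -mcompE; apply: (kill J) => //; apply/pi0.
  apply/lfunP=> y; rewrite eE.
  have -> : u x i (y * e) = (ract (u x i) (y * e) : dual_regular G) 1.
    by rewrite dualE mulr1.
  have -> : ract (u x i) (y * e) = u (ract x (y * e)) i by rewrite morA ffunE.
  by rewrite xe mor0 ffunE !zero_lfunE.
(* Conversely, [f] is applied to each component of an embedding into copies of [D Gamma]. If it
   kills [u x i], this functional vanishes on [Gamma e], hence by [tri] on [Gamma e Gamma], so [x]
   is torsion. *)
have [l [u ui]] := cofree_embed X.
exists (copies (copies J0 m) l), (cpair (fun i => mcomp f (mcomp (cproj D i) u))).
split; first by do 2!apply: proj_inj_copies.
move=> x x0; apply: Xt => g; apply: ui; apply/ffunP=> i; rewrite [RHS]ffunE.
have fi0 : f (u x i) = 0.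
  by have := congr1 (cproj _ i) x0; rewrite cprojE cpairE !mcompE cprojE mor0.
have {}fi0 y : (u x i : dual_regular G) (y * e) = 0.
  by rewrite -eE; have /pi0-> := fi0; apply: zero_lfunE.
apply/lfunP=> y; rewrite morA ffunE dualE zero_lfunE.
by rewrite -mulrA -tri mulrA fi0.
Qed.

End Idempotent.

(** * The corner algebra e Gamma e *)

(** The subspace [e G e] is closed under products and has the unit [e], nonzero as the unit of an
    algebra has to be. *)
Lemma corner_algebra (k : fieldType) (G : falgType k) (e : G) : e * e = e -> e != 0 ->
  exists (L : falgType k) (i : 'Hom(L, G)) (r : 'Hom(G, L)),
    [/\ forall a b, i (a * b) = i a * i b, i 1 = e,
        forall a, r (i a) = a & forall x, i (r x) = e * x * e].
Proof.
move=> ee e0.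
have V0 : e * 0 * e = 0 by rewrite mulr0 mul0r.
have VP (c : k) x y : e * x * e = x -> e * y * e = y ->
  e * (c *: x + y) * e = c *: x + y.
  by move=> xe ye; rewrite mulrDr mulrDl -scalerAr -scalerAl xe ye.
pose V := vset V0 VP.
have VE x : x \in V <-> e * x * e = x by apply: vsetP.
have inV x : e * x * e \in V by apply/VE; rewrite !mulrA ee -mulrA ee.
have eV : e \in V by rewrite -ee -{1}ee; apply: inV.
have idV u : u \in V -> e * u = u /\ u * e = u.
  by move=> /VE ue; split; rewrite -{1}ue; [rewrite !mulrA ee | rewrite -mulrA ee].
have Vasp : is_aspace V.
  apply/andP; split; first by apply/has_algidP; exists e.
  apply/prodvP=> u v /idV[eu _] /idV[_ ve]; apply/VE.
  by rewrite mulrA -mulrA eu ve.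
pose L := subvs_of (ASpace Vasp) : falgType k.
have val_lin : linear (fun u : L => vsval u : G) by move=> c u v; rewrite linearP.
have proj_lin : linear (fun x => vsproj (ASpace Vasp) (e * x * e) : L).
  by move=> c x y; rewrite mulrDr mulrDl -scalerAr -scalerAl linearP.
exists L, (lfun_of val_lin), (lfun_of proj_lin).
split=> [a b||a|x].
- by rewrite !lfun_ofE.
- rewrite lfun_ofE /= -[LHS](idV _ (memv_algid (ASpace Vasp))).1.
  exact: (algidr (A := ASpace Vasp) eV).
- by rewrite !lfun_ofE; have /VE-> := subvsP a; rewrite vsvalK.
by rewrite !lfun_ofE vsprojK.
Qed.

Section Corner.
Variables (k : fieldType) (G L : falgType k) (e : G).
Variables (i : 'Hom(L, G)) (r : 'Hom(G, L)).
Hypothesis iM : forall a b, i (a * b) = i a * i b.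
Hypothesis i1 : i 1 = e.
Hypothesis iK : forall a, r (i a) = a.
Hypothesis rK : forall x, i (r x) = e * x * e.
Hypothesis tri : forall x, e * x * e = e * x.

Fact corner_ee : e * e = e. Proof. by rewrite -i1 -iM mulr1. Qed.
Fact corner_ie a : i a * e = i a. Proof. by rewrite -i1 -iM mulr1. Qed.
Fact corner_i_inj : injective i. Proof. exact: can_inj iK. Qed.
Fact corner_rM x y : r (x * y) = r x * r y.
Proof. by apply: corner_i_inj; rewrite iM !rK !tri !mulrA tri. Qed.
Fact corner_r1 : r 1 = 1.
Proof. by apply: corner_i_inj; rewrite rK i1 mulr1 corner_ee. Qed.
Fact corner_re : r e = 1.
Proof. by rewrite -[X in r X]i1 iK. Qed.

(** * The exact functor [X |-> X e] *)

Section Cut.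
Variable X : rmod G.

Fact cut0 : ract (0 : X) e = 0. Proof. exact: ract0l. Qed.
Fact cutP (c : k) (x y : X) : ract x e = x -> ract y e = y ->
  ract (c *: x + y) e = c *: x + y.
Proof. by move=> xe ye; rewrite ractDl ractZl xe ye. Qed.

Definition cut_space : {vspace X} := vset cut0 cutP.

Fact cut_actP (u : subvs_of cut_space) a : ract (vsval u) (i a) \in cut_space.
Proof. by apply/vsetP; rewrite -ractM corner_ie. Qed.

Definition cut_act (u : subvs_of cut_space) (a : L) : subvs_of cut_space :=
  vsproj cut_space (ract (vsval u) (i a)).

Fact cut_actE u a : vsval (cut_act u a) = ract (vsval u) (i a).
Proof. by rewrite /cut_act vsprojK // cut_actP. Qed.

Fact cut_linl a : linear (cut_act^~ a).
Proof.
by move=> c u v; apply: subvs_inj; rewrite cut_actE !linearP /= !cut_actE ract_linl.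
Qed.

Fact cut_linr u : linear (cut_act u).
Proof.
by move=> c a b; apply: subvs_inj;
  rewrite cut_actE linearP linearP /= !cut_actE ract_linr.
Qed.

Fact cut_act1 u : cut_act u 1 = u.
Proof. by apply: subvs_inj; rewrite cut_actE i1; have /vsetP := subvsP u. Qed.

Fact cut_actM u a b : cut_act u (a * b) = cut_act (cut_act u a) b.
Proof. by apply: subvs_inj; rewrite !cut_actE iM ractM. Qed.

(* X e as a module over e G e. *)
Definition cutmod : rmod L :=
  @RMod k L (subvs_of cut_space) cut_act cut_linl cut_linr cut_act1 cut_actM.

Definition cval (u : cutmod) : X := vsval u.
Definition cutmk (x : X) : cutmod := vsproj cut_space (ract x e).

Lemma cutmkE x : cval (cutmk x) = ract x e.
Proof. by rewrite /cval vsprojK //; apply/vsetP; rewrite -ractM corner_ee. Qed.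
Lemma cval_inj : injective cval. Proof. exact: subvs_inj. Qed.
Lemma cval_lin : linear cval. Proof. by move=> c u v; rewrite /cval linearP. Qed.
Lemma cval_e u : ract (cval u) e = cval u. Proof. by have /vsetP := subvsP u. Qed.
Lemma cval_act u a : cval (ract u a) = ract (cval u) (i a). Proof. exact: cut_actE. Qed.
Lemma cval0 : cval 0 = 0. Proof. exact: linear0. Qed.
Lemma cutmk_cval u : cutmk (cval u) = u. Proof. by apply: cval_inj;
  rewrite cutmkE cval_e. Qed.

End Cut.

(** By [tri], [X e] is even a [G]-submodule of [X], on which [G] acts through [r]. *)
Lemma cval_ract X (u : cutmod X) x : ract (cval u) x = ract (cval u) (i (r x)).
Proof. by rewrite rK tri -[in LHS](cval_e u) -ractM. Qed.

Lemma cut_mor (X : rmod L) (Y : rmod G) (f : X -> Y) : linear f ->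
    (forall x, ract (f x) e = f x) -> (forall x a, f (ract x a) = ract (f x) (i a)) ->
  exists g : rmor X (cutmod Y), forall x, cval (g x) = f x.
Proof.
move=> fL fe fA; have gE x : cval (cutmk (f x)) = f x by rewrite cutmkE fe.
have gL : linear (fun x => cutmk (f x)).
  by move=> c x y; apply: cval_inj; rewrite cval_lin !gE fL.
have gA x a : cutmk (f (ract x a)) = ract (cutmk (f x)) a.
  by apply: cval_inj; rewrite cval_act !gE fA.
by exists (mor_of gL gA) => x; rewrite mor_ofE.
Qed.

Lemma cut_map_ex X Y (f : rmor X Y) : exists g : rmor (cutmod X) (cutmod Y),
  forall u, cval (g u) = f (cval u).
Proof.
apply: cut_mor => [c u v|u|u a].
- by rewrite cval_lin linearP.
- by rewrite -morA cval_e.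
by rewrite cval_act morA.
Qed.

Definition cut_map X Y (f : rmor X Y) : rmor (cutmod X) (cutmod Y) :=
  sval (constructive_indefinite_description _ (cut_map_ex f)).

Lemma cut_mapE X Y (f : rmor X Y) u : cval (cut_map f u) = f (cval u).
Proof. by rewrite /cut_map; case: constructive_indefinite_description. Qed.

Lemma ses_cut X Y Z (a : rmor X Y) (b : rmor Y Z) : ses a b ->
  ses (cut_map a) (cut_map b).
Proof.
move=> sab; split=> [u u0|z|u|u u0].
- apply: cval_inj; rewrite cval0; apply: (ses_inj sab).
  by rewrite -cut_mapE u0 cval0.
- have [y yz] := ses_surj sab (cval z); exists (cutmk y); apply: cval_inj.
  by rewrite cut_mapE cutmkE morA yz cval_e.
- by apply: cval_inj; rewrite !cut_mapE (ses_comp sab) cval0.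
have [x xu] : exists x, a x = cval u.
  by apply: (ses_ker sab); rewrite -cut_mapE u0 cval0.
by exists (cutmk x); apply: cval_inj; rewrite cut_mapE cutmkE morA xu cval_e.
Qed.

(** * Inflation along [r] and its adjunction with [X |-> X e] *)

Section Inflation.
Variable X : rmod L.

Definition inf_act (x : X) (g : G) : X := ract x (r g).
Fact inf_linl g : linear (inf_act^~ g).
Proof. by move=> c x y; rewrite /inf_act ract_linl. Qed.
Fact inf_linr x : linear (inf_act x).
Proof. by move=> c a b; rewrite /inf_act linearP ract_linr. Qed.
Fact inf_act1 x : inf_act x 1 = x.
Proof. by rewrite /inf_act corner_r1 ract1. Qed.
Fact inf_actM x a b : inf_act x (a * b) = inf_act (inf_act x a) b.
Proof. by rewrite /inf_act corner_rM ractM. Qed.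

(* Since e is left triangular, x -> e x is a ring morphism from G onto e G e. *)
Definition inflate : rmod G := @RMod k G X inf_act inf_linl inf_linr inf_act1 inf_actM.

End Inflation.

Lemma inf_actE X (x : inflate X) g : ract x g = ract (x : X) (r g). Proof. by []. Qed.

Definition inf_map X Y (f : rmor X Y) : rmor (inflate X) (inflate Y) :=
  @RMor k G (inflate X) (inflate Y) (mfun f) (fun x g => morA f x (r g)).

(** With [mor_inf], the adjunction [Hom_G(inflate X, Y) = Hom_L(X, Y e)]. Both functors are exact,
    so inflation preserves projectives and [Y |-> Y e] preserves injectives. *)
Lemma inf_mor X (Y : rmod G) (f : rmor X (cutmod Y)) :
  exists g : rmor (inflate X) Y, forall x, g x = cval (f x).
Proof.
have gL : linear (fun x : inflate X => cval (f x)).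
  by move=> c x y; rewrite [f _]linearP cval_lin.
have gA (x : inflate X) g : cval (f (ract x g)) = ract (cval (f x)) g.
  by rewrite inf_actE morA cval_act -cval_ract.
by exists (mor_of gL gA) => x; rewrite mor_ofE.
Qed.

Lemma mor_inf X (Y : rmod G) (f : rmor (inflate X) Y) :
  exists g : rmor X (cutmod Y), forall x, cval (g x) = f x.
Proof.
apply: cut_mor => [c x y|x|x a]; first exact: (linearP f).
  by rewrite -morA inf_actE corner_re ract1.
by rewrite -morA inf_actE iK.
Qed.

Lemma uninf X Y (f : rmor (inflate X) (inflate Y)) : exists g : rmor X Y,
    forall x, g x = f x.
Proof.
have gA (x : X) a : f (ract x a) = ract (f x : Y) a.
  by rewrite -{1}(iK a) -(inf_actE x) morA inf_actE iK.
by exists (@RMor k L X Y (mfun f) gA).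
Qed.

Lemma ses_inf X Y Z (a : rmor X Y) (b : rmor Y Z) : ses a b ->
  ses (inf_map a) (inf_map b).
Proof. by case=> a0 bs ab ke; split. Qed.

Lemma inf_proj P : projective P -> projective (inflate P).
Proof.
move=> pP; apply: projI => X Y g f gs.
have [f' f'E] := mor_inf f.
have gs' : surje (cut_map g).
  move=> y; have [x xy] := gs (cval y); exists (cutmk x); apply: cval_inj.
  by rewrite cut_mapE cutmkE morA xy cval_e.
have [h hE] := proj_lift pP f' gs'; have [h' h'E] := inf_mor h.
by exists h' => x; rewrite h'E -cut_mapE hE f'E.
Qed.

Lemma proj_inf P : projective (inflate P) -> projective P.
Proof.
move=> pP; apply: projI => X Y g f gs.
have gs' : surje (inf_map g) by [].
have [h hE] := proj_lift pP (inf_map f) gs'; have [h' h'E] := uninf h.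
by exists h' => x; rewrite h'E; apply: hE.
Qed.

Lemma pd_le_inf d X : pd_le d (inflate X) -> pd_le d X.
Proof.
elim: d X => [|d IHd] X dX; first exact: proj_inf.
move=> K P a b pP sab; apply: IHd.
exact: dX (inf_proj pP) (ses_inf sab).
Qed.

Lemma cut_inj J : injective_rmod J -> injective_rmod (cutmod J).
Proof.
move=> iJ; apply: injI => X Y g f gi.
have [f' f'E] := inf_mor f.
have gi' : inje (inf_map g) by [].
have [h hE] := inj_ext iJ f' gi'; have [h' h'E] := mor_inf h.
by exists h' => x; apply: cval_inj; rewrite h'E -f'E; apply: hE.
Qed.

Notation M := (cutmod (regular_rmod G)).

Lemma act_mor (J : rmod G) (y : J) : exists g : rmor M (cutmod J),
    forall m, cval (g m) = ract y (cval m).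
Proof. by exists (cut_map (elt_mor y)) => m; rewrite cut_mapE elt_morE. Qed.

(* Gamma e is a right ideal, so injectivity of J applies as in Baer's criterion. *)
Lemma cut_baer J (f : rmor M (cutmod J)) : injective_rmod J ->
  exists x : J, forall m, cval (f m) = ract x (cval m).
Proof.
move=> iJ; have Q0 : 0 * e = 0 by rewrite mul0r.
have QP (c : k) (x y : G) : x * e = x -> y * e = y -> (c *: x + y) * e = c *: x + y.
  by move=> xe ye; rewrite mulrDl -scalerAl xe ye.
have QA (x a : G) : x * e = x -> (x * a) * e = x * a.
  by move=> xe; rewrite -xe -!mulrA [e * (a * e)]mulrA tri.
have [I [Z [a [b [sab QE]]]]] :=
  @ses_of_pred k G (regular_rmod G) (fun x => x * e = x) Q0 QP QA.
have ae w : @ract k G (regular_rmod G) (a w) e = a w by apply/QE;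
  rewrite (ses_comp sab).
(* [M] and the right ideal [G e] have the same elements; read on the ideal, [f] is a [G]-morphism to
   [J], and [x] is the value at 1 of an extension to [G]. *)
have F_lin : linear (fun w => cval (f (cutmk (a w)))).
  move=> c u v; rewrite -cval_lin -linearP; congr (cval (f _)).
  by apply: cval_inj; rewrite cval_lin !cutmkE linearP ractDl ractZl.
have F_act w g : cval (f (cutmk (a (ract w g)))) = ract (cval (f (cutmk (a w)))) g.
  rewrite cval_ract -cval_act -morA; congr (cval (f _)); apply: cval_inj.
  by rewrite cval_act -cval_ract !cutmkE !ae morA.
have [h hE] := inj_ext iJ (mor_of F_lin F_act) (ses_inj sab).
exists (h 1) => m; have [w wm] : exists w, a w = cval m.
  by apply: (ses_ker sab); apply/QE; apply: (cval_e m).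
by rewrite -[RHS]regular_morE -wm hE mor_ofE wm cutmk_cval.
Qed.

Lemma torsionfree_sub (X Y : rmod G) (f : rmor X Y) : inje f -> torsionfree e Y ->
  torsionfree e X.
Proof.
by move=> fi Yt x x0; apply: fi; apply: Yt => g; rewrite -morA x0 mor0.
Qed.

Lemma torsionfreeP (X : rmod G) (x : X) : torsionfree e X ->
  (forall m : M, ract x (cval m) = 0) -> x = 0.
Proof. by move=> Xt xm; apply: Xt => g; have :=
  xm (cutmk (g : regular_rmod G)); rewrite cutmkE. Qed.

(** The [x] in [J] given by [cut_baer] has an image in [Z'] killed by [G e], hence zero, so [x]
    comes from [Z]. *)
Lemma cut_rep J Z Z' (a : rmor Z J) (b : rmor J Z') (f : rmor M (cutmod Z)) :
  injective_rmod J -> ses a b -> torsionfree e Z' ->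
  exists z : Z, forall m, cval (f m) = ract z (cval m).
Proof.
move=> iJ sab Z't; have [x xE] := cut_baer (mcomp (cut_map a) f) iJ.
have axE m : a (cval (f m)) = ract x (cval m) by rewrite -xE mcompE cut_mapE.
have [z zx] : exists z, a z = x.
  apply: (ses_ker sab); apply: (torsionfreeP Z't) => m.
  by rewrite -morA -axE (ses_comp sab).
by exists z => m; apply: (inje_inj (ses_inj sab)); rewrite axE morA zx.
Qed.

Lemma inf_torsionfree (X : rmod L) : torsionfree e (inflate X).
Proof.
move=> x /(_ 1); rewrite mul1r inf_actE corner_re ract1.
by [].
Qed.

(** * Global dimension of [e G e], cluster tilting and endomorphisms of [G e] *)

Hypothesis proj_inj_torsionfree : forall J, proj_inj J -> torsionfree e J.
Hypothesis torsionfree_embed : forall X, torsionfree e X ->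
  exists J (f : rmor X J), proj_inj J /\ inje f.

Lemma cut_gldim n : (forall X : rmod G, pd_le n.+1 X) -> forall X : rmod L, pd_le n X.
Proof.
move=> gl X; apply: pd_le_inf.
have [J [f [[pJ _] fi]]] := torsionfree_embed (@inf_torsionfree X).
have [C [q sfq]] := ses_of_inj fi.
exact: gl C _ _ f q pJ sfq.
Qed.

(** [e G e] is a retract of [G e]: the inclusion is split by left multiplication by [e]. *)
Lemma cut_gen : in_add M (regular_rmod L).
Proof.
have [s sE] : exists s : rmor (regular_rmod L) M, forall a, cval (s a) = i a.
  apply: cut_mor => [|a|a b]; first by move=> c a b; rewrite linearP.
    exact: corner_ie.
  exact: iM.
have t_lin : linear (fun m : M => r (cval m) : regular_rmod L).
  by move=> c u v; rewrite cval_lin linearP.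
have t_act (m : M) a : r (cval (ract m a)) = ract (r (cval m) : regular_rmod L) a.
  by rewrite cval_act [LHS]corner_rM iK.
apply: in_add_retract (in_add_refl _).
by exists s, (mor_of t_lin t_act) => a; rewrite mor_ofE sE iK.
Qed.

Lemma cores_torsionfree m Z : cores proj_inj m.+1 Z -> torsionfree e Z.
Proof.
case=> J [Z' [a [b [jJ sab _]]]].
exact: torsionfree_sub (ses_inj sab) (proj_inj_torsionfree jJ).
Qed.

(** For Ext^1, a morphism from [M] to [Z1 e] is given by an element of [Z1], which lifts to [J]. The
    second and third terms of the coresolution are what [cut_rep] needs for [Z1]. *)
Lemma cut_rigid j (Z : rmod G) : cores proj_inj j.+3 Z -> ext_vanish j M (cutmod Z).
Proof.
elim: j Z => [|j IHj] Z [J [Z1 [a [b [[_ iJ] sab cZ1]]]]].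
  have [J1 [Z2 [a1 [b1 [[_ iJ1] sab1 cZ2]]]]] := cZ1.
  apply: (ext1_vanish_of_lift (ses_cut sab)); first exact/inj_ext1_vanish/cut_inj.
  move=> f; have [z zE] := cut_rep f iJ1 sab1 (cores_torsionfree (m := 0) cZ2).
  have [y yz] := ses_surj sab z; have [g gE] := act_mor y.
  by exists g => m; apply: cval_inj; rewrite cut_mapE gE morA yz zE.
exact: ext_vanish_shift_sub (cut_inj iJ) (ses_cut sab) (IHj _ cZ1).
Qed.

(** Torsion-freeness of [W'] yields two terms; each vanishing of Ext(M, W e) makes one more cosyzygy
    torsion-free and so embeddable in a projective-injective module. *)
Lemma cores_of_ext_vanish j W J W' (a : rmor W J) (b : rmor J W') :
  proj_inj J -> ses a b -> torsionfree e W' ->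
  (forall l, (l < j)%N -> ext_vanish l M (cutmod W)) -> cores proj_inj j.+2 W.
Proof.
elim: j W J W' a b => [|j IHj] W J W' a b jJ sab W't EW.
  have [J' [a' [jJ' a'i]]] := torsionfree_embed W't.
  have [W'' [b' sab']] := ses_of_inj a'i.
  by exists J, W', a, b; split=> //; exists J', W'', a', b'.
have [J' [a' [jJ' a'i]]] := torsionfree_embed W't.
have [W'' [b' sab']] := ses_of_inj a'i.
exists J, W', a, b; split=> //; apply: (IHj _ _ _ _ _ jJ' sab') => [w'' w0|l lj].
  (* For [w''] killed by [G e], its preimage [y] maps [M] into [W' e]; a lift to [J e] is given by
     some [x] in [J], and [y] agrees with the image of [x] on [G e]. Hence [y] comes from [W'] and
     [w''] is zero. *)
  have [y yw] := ses_surj sab' w''.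
  have [g gE] := act_mor y.
  have [f fE] : exists f : rmor M (cutmod W'), forall m, cut_map a' (f m) = g m.
    apply: (ses_factor_l (ses_cut sab')) => m; apply: cval_inj.
    rewrite cval0 cut_mapE gE morA yw -[m]cutmk_cval cutmkE; exact: w0.
  have [h hE] := ext1_vanish_lift f (ses_cut sab) (EW 0%N (ltn0Sn _)).
  have [x xE] := cut_baer h jJ.2.
  suff -> : w'' = b' (a' (b x)) by rewrite (ses_comp sab').
  rewrite -yw; congr (b' _); apply/eqP; rewrite -subr_eq0; apply/eqP.
  apply: (torsionfreeP (proj_inj_torsionfree jJ')) => m.
  rewrite ractBl -!morA -xE -cut_mapE hE -cut_mapE fE gE.
  exact: subrr.
apply: ext_vanish_shift_quo (cut_inj jJ.2) (ses_cut sab) _.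
exact: EW.
Qed.

(** Every term is projective, so each step of the coresolution lowers the bound on the projective
    dimension by one. *)
Lemma proj_of_cores m d (Z : rmod G) : (forall C : rmod G, pd_le (m + d) C) ->
  cores proj_inj m Z -> pd_le d Z.
Proof.
elim: m d Z => [|m IHm] d Z gl; first by move=> _; apply: gl.
move=> [J [Z' [a [b [[pJ _] sab cZ']]]]].
have dZ' : pd_le d.+1 Z' by apply: IHm cZ' => C; rewrite addnS -addSn.
exact: dZ' pJ sab.
Qed.

Lemma cut_copies_retract (X : rmod G) l :
  retract (cutmod (copies X l)) (copies (cutmod X) l).
Proof.
pose s := cpair (fun j : 'I_l => cut_map (cproj X j)).
have sE u j : cval (s u j) = cval u j by rewrite cpairE cut_mapE cprojE.
have [t tE] : exists t : rmor (copies (cutmod X) l) (cutmod (copies X l)),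
    forall v j, cval (t v) j = cval (v j).
  have [|v|v a|t tE] := @cut_mor (copies (cutmod X) l) (copies X l)
    (fun v => [ffun j => cval (v j)]).
  - by move=> c u v; apply/ffunP=> j; rewrite !ffunE cval_lin.
  - by apply/ffunP=> j; rewrite !ffunE cval_e.
  - by apply/ffunP=> j; rewrite !ffunE cval_act.
  by exists t => v j; rewrite tE ffunE.
exists s, t => u; apply: cval_inj; apply/ffunP=> j.
by rewrite tE sE.
Qed.

(** [W] consists of the [y] in [J] with [y G e] inside [X]: then [W e = X] and [J / W] is
    torsion-free. The Ext conditions make [W] an iterated syzygy, hence projective, so [X = W e] is
    in add of [G e]. *)
Lemma cut_ct n (X : rmod L) : (0 < n)%N -> (forall X : rmod G, pd_le n.+1 X) ->
  (forall j, (j.+1 < n)%N -> ext_vanish j M X) -> in_add M X.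
Proof.
move=> n0 gl EX.
have [J [f [jJ fi]]] := torsionfree_embed (@inf_torsionfree X).
pose Q (y : J) := forall g, exists x, f x = ract y (g * e).
have Q0 : Q 0 by move=> g; exists 0; rewrite mor0 ract0l.
have QP (c : k) x y : Q x -> Q y -> Q (c *: x + y).
  move=> Qx Qy g; have [u uE] := Qx g; have [v vE] := Qy g.
  by exists (c *: u + v); rewrite morD morZ uE vE ractDl ractZl.
have QA x a : Q x -> Q (ract x a).
  by move=> Qx g; have [u uE] := Qx (a * g); exists u; rewrite uE -ractM mulrA.
have [W [W' [a [b [sab QE]]]]] := ses_of_pred Q0 QP QA.
have W't : torsionfree e W'.
  move=> w w0; have [y yw] := ses_surj sab w; rewrite -yw; apply/QE => g.
  have /QE/(_ 1)[x xE] : b (ract y (g * e)) = 0 by rewrite morA yw w0.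
  by exists x; rewrite xE -ractM mul1r -mulrA corner_ee.
have fQ x : Q (f x) by move=> g; exists (ract x (g * e)); rewrite morA.
have [f1 f1E] : exists f1 : rmor (inflate X) W, forall x, a (f1 x) = f x.
  by apply: mor_factor_inj (ses_inj sab) _ => x; apply: (ses_ker sab); apply/QE.
have [h hE] := mor_inf f1.
have XW : retract X (cutmod W).
  apply: (@bij_retractV _ _ _ _ h) => [x x0|u].
    by apply: fi; rewrite -f1E -hE x0 cval0 mor0.
  have /QE/(_ 1)[x xE] : b (a (cval u)) = 0 by apply: ses_comp.
  exists x; apply: cval_inj; apply: (inje_inj (ses_inj sab)).
  by rewrite hE f1E xE mul1r -morA cval_e.
have WX : retract (cutmod W) X.
  apply: (@bij_retract _ _ _ _ h) => [x x0|u].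
    by apply: fi; rewrite -f1E -hE x0 cval0 mor0.
  have /QE/(_ 1)[x xE] : b (a (cval u)) = 0 by apply: ses_comp.
  exists x; apply: cval_inj; apply: (inje_inj (ses_inj sab)).
  by rewrite hE f1E xE mul1r -morA cval_e.
have cW : cores proj_inj n.+1 W.
  (* Two terms are free and the [n - 1] vanishing degrees give the others, [n + 1] in all. *)
  rewrite -(prednK n0); apply: (cores_of_ext_vanish jJ sab W't) => l ln.
  by apply: (ext_vanish_retractr WX); apply: EX; lia.
have pW : projective W.
  by apply: (@proj_of_cores n.+1 0) cW => C; rewrite addn0.
have /projP[l [s [t ts]]] := pW.
apply: in_add_retract XW _; apply/in_addP; exists l.
apply: retract_trans (cut_copies_retract _ _).
by exists (cut_map s), (cut_map t) => u; apply: cval_inj; rewrite !cut_mapE ts.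
Qed.

(** [G] acts on [G e] by left multiplication: faithfully since [G] is torsion-free, and fully by
    [cut_rep], for which two terms of the coresolution suffice. *)
Lemma cut_end n : (0 < n)%N -> cores proj_inj n.+1 (regular_rmod G) -> iso_to_End G M.
Proof.
case: n => // n _ cG.
have lmul_ex (x : G) : exists g : rmor M M, forall m, cval (g m) = x * cval m.
  exact: (@act_mor (regular_rmod G) x).
pose lm x := sval (constructive_indefinite_description _ (lmul_ex x)).
have lmE x m : cval (lm x m) = x * cval m.
  by rewrite /lm; case: constructive_indefinite_description.
exists (fun x => mfun (lm x)); split.
- move=> c x y; apply/lfunP=> m; rewrite add_lfunE scale_lfunE; apply: cval_inj.
  by rewrite cval_lin !lmE mulrDl -scalerAl.
- by apply/lfunP=> m; apply: cval_inj; rewrite lmE id_lfunE mul1r.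
- by move=> x y; apply/lfunP=> m; apply: cval_inj; rewrite comp_lfunE !lmE mulrA.
- move=> x y /lfunP xy; apply/eqP; rewrite -subr_eq0; apply/eqP.
  apply: (torsionfreeP (cores_torsionfree cG)) => m.
  by rewrite /= mulrBl -!lmE xy subrr.
move=> f; split=> [fA | [x <-]]; last exact: mact.
have [J [Z [a [b [[_ iJ] sab cZ]]]]] := cG.
have [x xE] := cut_rep (RMor fA) iJ sab (cores_torsionfree (m := n) cZ).
by exists x; apply/lfunP=> m; apply: cval_inj; rewrite lmE; apply/esym/xE.
Qed.

End Corner.

Lemma cluster_tilting_of_domdim (k : fieldType) (n : nat) (G : falgType k) :
  (0 < n)%N -> gldim_le G n.+1 -> domdim_ge G n.+1 ->
  (forall i, (0 < i <= n)%N -> ext_zero i (dual_regular G) (regular_rmod G)) ->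
  exists (L : falgType k) (M : rmod L),
    [/\ gldim_le L n, cluster_tilting n M & iso_to_End G M].
Proof.
move=> n0 gl dd ext.
have {}gl (X : rmod G) : pd_le n.+1 X by apply/pdim_leP/gl.
have {dd}cG : cores proj_inj n.+1 (regular_rmod G) by apply/domdim_geP.
have {}ext j : (j < n)%N -> ext_vanish j (dual_regular G) (regular_rmod G).
  by move=> jn; apply/ext_zeroP/ext.
have [e [ee tri pit tfe]] := triangular_idempotent gl cG ext.
have Gt : torsionfree e (regular_rmod G).
  have [J [Z [a [b [jJ sab _]]]]] := cG.
  by move=> x x0; apply: (ses_inj sab); apply: (pit J jJ) => g; rewrite -morA x0 mor0.
(* If [e] were zero, everything in the torsion-free [G] would be killed by [G e], making [G]
   zero. *)
have e0 : e != 0.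
  apply/eqP=> e0; have := oner_neq0 G; rewrite [X in X != _](Gt 1) ?eqxx // => g.
  by rewrite e0 mulr0 ract0r.
have [L [i [r [iM i1 iK rK]]]] := corner_algebra ee e0.
exists L, (cutmod iM i1 (regular_rmod G)); split.
- by move=> X; apply/pdim_leP; apply: (cut_gldim iM i1 iK rK tri tfe gl).
- apply: cluster_tilting_intro.
  + exact: cut_gen iM i1 iK rK tri.
  + move=> j jn; apply: (cut_rigid iM i1 iK rK tri pit).
    by apply: cores_mono cG; lia.
  by move=> X EX; apply: (@cut_ct _ _ _ _ _ _ iM i1 iK rK tri pit tfe n).

exact: (@cut_end _ _ _ _ _ _ iM i1 rK tri pit n n0 cG).
Qed.

(** * The functor Hom(M, -) *)

Section HomFunctor.
Variables (k : fieldType) (G L : falgType k) (N : rmod L).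
Variable phi : G -> 'End(N).
Hypothesis phi_lin : linear phi.
Hypothesis phi1 : phi 1 = \1%VF.
Hypothesis phiM : forall a b, phi (a * b) = (phi a \o phi b)%VF.
Hypothesis phi_inj : injective phi.
Hypothesis phi_img : forall f : 'End(N), rhom f <-> exists a, phi a = f.

Lemma phi_act a x b : phi a (ract x b) = ract (phi a x) b.
Proof. by have /phi_img : exists a', phi a' = phi a by exists a. Qed.

Lemma phiME a b x : phi (a * b) x = phi a (phi b x).
Proof. by rewrite phiM comp_lfunE. Qed.

Lemma phi1E x : phi 1 x = x.
Proof. by rewrite phi1 id_lfunE. Qed.

Lemma phiPE (c : k) a b x : phi (c *: a + b) x = c *: phi a x + phi b x.
Proof. by rewrite phi_lin add_lfunE scale_lfunE. Qed.

Lemma phi0E x : phi 0 x = 0.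
Proof.
have := phiPE 1 0 0 x; rewrite scaler0 addr0 scale1r -{1}[phi 0 x]addr0.
by move/addrI.
Qed.

Lemma phi_ext a b : (forall x, phi a x = phi b x) -> a = b.
Proof. by move=> ab; apply/phi_inj/lfunP. Qed.

Lemma psi_subproof (f : rmor N N) : exists a, phi a = f.
Proof. exact/phi_img/mact. Qed.

Definition psi (f : rmor N N) : G :=
  sval (constructive_indefinite_description _ (psi_subproof f)).

Lemma psiE f x : phi (psi f) x = f x.
Proof. by rewrite /psi; case: constructive_indefinite_description => a /= ->. Qed.

Section Obj.
Variable X : rmod L.

Fact hom_actP (u : subvs_of (homs N X)) a : (vsval u \o phi a)%VF \in homs N X.
Proof.
apply/homsP=> x b; have /homsP uA := subvsP u.
by rewrite !comp_lfunE phi_act uA.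
Qed.

Definition hom_act (u : subvs_of (homs N X)) (a : G) : subvs_of (homs N X) :=
  vsproj (homs N X) (vsval u \o phi a)%VF.

Fact hom_actE u a x : vsval (hom_act u a) x = vsval u (phi a x).
Proof. by rewrite /hom_act vsprojK ?hom_actP // comp_lfunE. Qed.

Fact hom_ext (u v : subvs_of (homs N X)) : (forall x, vsval u x = vsval v x) -> u = v.
Proof. by move=> uv; apply/subvs_inj/lfunP. Qed.

Fact hom_valP (c : k) (u v : subvs_of (homs N X)) x :
  vsval (c *: u + v) x = c *: vsval u x + vsval v x.
Proof. by rewrite linearP add_lfunE scale_lfunE. Qed.

Fact hom_linl a : linear (hom_act^~ a).
Proof. by move=> c u v; apply: hom_ext => x; rewrite hom_actE !hom_valP !hom_actE. Qed.

Fact hom_linr u : linear (hom_act u).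
Proof.
move=> c a b; apply: hom_ext => x.
by rewrite hom_actE hom_valP !hom_actE phiPE linearP.
Qed.

Fact hom_act1 u : hom_act u 1 = u.
Proof. by apply: hom_ext => x; rewrite hom_actE phi1E. Qed.

Fact hom_actM u a b : hom_act u (a * b) = hom_act (hom_act u a) b.
Proof. by apply: hom_ext => x; rewrite !hom_actE phiME. Qed.

(* Hom_L(N, X) *)
Definition homF : rmod G :=
  @RMod k G (subvs_of (homs N X)) hom_act hom_linl hom_linr hom_act1 hom_actM.

Definition happ (u : homF) (x : N) : X := vsval u x.

Lemma happ_ext (u v : homF) : (forall x, happ u x = happ v x) -> u = v.
Proof. exact: hom_ext. Qed.
Lemma happ_lin (c : k) (u v : homF) x : happ (c *: u + v) x = c *: happ u x + happ v x.
Proof. exact: hom_valP. Qed.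
Lemma happ_act (u : homF) a x : happ (ract u a) x = happ u (phi a x).
Proof. exact: hom_actE. Qed.
Lemma happ0 x : happ 0 x = 0.
Proof. by rewrite /happ linear0 zero_lfunE. Qed.
Lemma happ_sum T (s : seq T) (Q : pred T) (E : T -> homF) x :
  happ (\sum_(i <- s | Q i) E i) x = \sum_(i <- s | Q i) happ (E i) x.
Proof. by rewrite /happ linear_sum sum_lfunE. Qed.

Lemma Fmor_act (u : homF) : rhom (vsval u : 'Hom(N, X)).
Proof. exact/homsP/subvsP. Qed.
Definition Fmor (u : homF) : rmor N X := RMor (Fmor_act u).
Lemma FmorE u x : Fmor u x = happ u x. Proof. by []. Qed.

Definition Fmk (f : rmor N X) : homF := vsproj (homs N X) (mfun f).
Lemma FmkE f x : happ (Fmk f) x = f x.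
Proof. by rewrite /happ vsprojK // homs_mor. Qed.

End Obj.

Lemma Fmor_of (Z : rmod G) (X : rmod L) (f : Z -> rmor N X) :
  (forall (c : k) y z x, f (c *: y + z) x = c *: f y x + f z x) ->
  (forall z a x, f (ract z a) x = f z (phi a x)) ->
  exists g : rmor Z (homF X), forall z x, happ (g z) x = f z x.
Proof.
move=> fL fA.
have gL : linear (fun z => Fmk (f z)).
  by move=> c y z; apply: happ_ext => x; rewrite happ_lin !FmkE fL.
have gA z a : Fmk (f (ract z a)) = ract (Fmk (f z)) a.
  by apply: happ_ext => x; rewrite happ_act !FmkE fA.
by exists (mor_of gL gA) => z x; rewrite mor_ofE FmkE.
Qed.

Lemma Fmap_ex X Y (f : rmor X Y) : exists g : rmor (homF X) (homF Y),
  forall u x, happ (g u) x = f (happ u x).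
Proof.
have [c y z x|z a x|g gE] := @Fmor_of (homF X) Y (fun u => mcomp f (Fmor u)).
- by rewrite !mcompE !FmorE happ_lin linearP.
- by rewrite !mcompE !FmorE happ_act.
by exists g => u x; rewrite gE mcompE.
Qed.

Definition Fmap X Y (f : rmor X Y) : rmor (homF X) (homF Y) :=
  sval (constructive_indefinite_description _ (Fmap_ex f)).

Lemma FmapE X Y (f : rmor X Y) u x : happ (Fmap f u) x = f (happ u x).
Proof. by rewrite /Fmap; case: constructive_indefinite_description. Qed.

Lemma Fmap_inj X Y (f : rmor X Y) : inje f -> inje (Fmap f).
Proof.
by move=> fi u u0; apply: happ_ext => x; rewrite happ0; apply: fi;
  rewrite -FmapE u0 happ0.
Qed.

Lemma Fmap_ker X Y Z (i : rmor X Y) (p : rmor Y Z) u : ses i p ->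
  Fmap p u = 0 -> exists v, Fmap i v = u.
Proof.
move=> sip pu0; have [v vE] : exists v : rmor N X, forall x, i (v x) = Fmor u x.
  by apply: (ses_factor_l sip) => x; rewrite -FmapE pu0 happ0.
by exists (Fmk v); apply: happ_ext => x; rewrite FmapE FmkE vE.
Qed.

Lemma Fmap_comp0 X Y Z (i : rmor X Y) (p : rmor Y Z) u : ses i p ->
  Fmap p (Fmap i u) = 0.
Proof. by move=> sip; apply: happ_ext => x; rewrite !FmapE (ses_comp sip) happ0. Qed.

Lemma ses_F X Y Z (i : rmor X Y) (p : rmor Y Z) : ses i p ->
  (forall g : rmor N Z, exists h : rmor N Y, forall x, p (h x) = g x) ->
  ses (Fmap i) (Fmap p).
Proof.
move=> sip lft; split=> [|v|u|u]; [exact: Fmap_inj (ses_inj sip) | | |].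
- have [h hE] := lft (Fmor v); exists (Fmk h); apply: happ_ext => x.
  by rewrite FmapE FmkE hE.
- exact: Fmap_comp0.
exact: Fmap_ker.
Qed.

Lemma F_retract X Y : retract X Y -> retract (homF X) (homF Y).
Proof.
move=> [s [r rs]]; exists (Fmap s), (Fmap r) => u; apply: happ_ext => x.
by rewrite !FmapE rs.
Qed.

Lemma F_copies X m : retract (homF (copies X m)) (copies (homF X) m).
Proof.
have [c y z x|z a x|t tE] := @Fmor_of (copies (homF X) m) (copies X m)
   (fun v => cpair (fun j => Fmor (v j))).
- by apply/ffunP=> j; rewrite !ffunE !cpairE !FmorE !ffunE happ_lin.
- by apply/ffunP=> j; rewrite !cpairE !FmorE ffunE happ_act.
exists (cpair (fun j => Fmap (cproj X j))), t => u; apply: happ_ext => x.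
by rewrite tE; apply/ffunP=> j; rewrite cpairE FmorE cpairE FmapE cprojE.
Qed.

Fact psi_mor_ex : exists g : rmor (homF N) (regular_rmod G),
  forall u x, phi (g u) x = happ u x.
Proof.
have gL : linear (fun u : homF N => psi (Fmor u) : regular_rmod G).
  by move=> c u v; apply: phi_ext => x; rewrite phiPE !psiE !FmorE happ_lin.
have gA (u : homF N) a : psi (Fmor (ract u a)) = ract (psi (Fmor u) : regular_rmod G) a.
  by apply: phi_ext => x; rewrite phiME !psiE !FmorE happ_act.
by exists (mor_of gL gA) => u x; rewrite mor_ofE psiE.
Qed.

Definition psi_mor : rmor (homF N) (regular_rmod G) :=
  sval (constructive_indefinite_description _ psi_mor_ex).

Lemma psi_morE u x : phi (psi_mor u) x = happ u x.
Proof. by rewrite /psi_mor; case: constructive_indefinite_description. Qed.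

(** A basis of the free [G]-module [F(N^m)], with coordinates [Fco]. *)
Definition Fbas m i : homF (copies N m) := Fmk (cinj N i).
Definition Fco m i : rmor (homF (copies N m)) (regular_rmod G) :=
  mcomp psi_mor (Fmap (cproj N i)).

Lemma FcoE m i u x : phi (@Fco m i u) x = happ u x i.
Proof. by rewrite mcompE psi_morE FmapE cprojE. Qed.

Lemma Fco_bas m (i j : 'I_m) : Fco j (Fbas i) = if i == j then 1 else 0.
Proof.
apply: phi_ext => x; rewrite FcoE FmkE cinjE eq_sym.
by case: ifP => _; rewrite ?phi1E ?phi0E.
Qed.

Lemma Fbas_sum m (u : homF (copies N m)) : u = \sum_i ract (Fbas i) (Fco i u).
Proof.
apply: happ_ext => x; rewrite happ_sum [LHS](copies_sum (happ u x)).
by apply: eq_bigr => i _; rewrite happ_act FmkE FcoE.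
Qed.

Lemma F_proj m : projective (homF (copies N m)).
Proof.
apply/projP; exists m; exists (cpair (@Fco m)), (csum (fun i => elt_mor (Fbas i))) => u.
rewrite csumE [RHS]Fbas_sum; apply: eq_bigr => i _.
by rewrite elt_morE cpairE.
Qed.

Lemma F_cover (X : rmod G) : exists m (p : rmor (homF (copies N m)) X), surje p.
Proof.
have [m [p ps]] := free_cover X; exists m, (mcomp p (cpair (@Fco m))) => x.
have [v <-] := ps x; exists (\sum_i ract (Fbas i) (v i)); rewrite mcompE; congr (p _).
apply/ffunP=> j; rewrite cpairE mor_sum.
rewrite (eq_bigr (fun i => if i == j then v j else 0)) => [|i _].
  by rewrite -big_mkcond big_pred1_eq.
rewrite morA Fco_bas; case: eqP => [->|_]; [exact: mul1r | exact: mul0r].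
Qed.

(** Yoneda: [d] is determined by the images of the basis, which are morphisms from [N] to [X]. *)
Lemma F_full m X (d : rmor (homF (copies N m)) (homF X)) :
  exists f : rmor (copies N m) X, forall u, d u = Fmap f u.
Proof.
exists (csum (fun i => Fmor (d (Fbas i)))) => u; apply: happ_ext => x.
rewrite FmapE csumE {1}(Fbas_sum u) mor_sum happ_sum; apply: eq_bigr => i _.
by rewrite morA happ_act FcoE.
Qed.

Lemma F_in_add X : in_add N X -> projective (homF X).
Proof. by case/in_addP=> m /F_retract Xm; apply: (proj_retract Xm); apply: F_proj. Qed.

Hypothesis gen : in_add N (regular_rmod L).

(* N is projective over G: x = sum_i gam_i(x) u_i. *)
Lemma dual_basis : exists l (u : 'I_l -> N) (rho : 'I_l -> rmor N (regular_rmod L))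
    (gam : 'I_l -> N -> G),
  [/\ forall i x y, phi (gam i x) y = ract x (rho i y),
      forall i, linear (gam i), forall i a x, gam i (phi a x) = a * gam i x
    & forall x, x = \sum_i phi (gam i x) (u i)].
Proof.
have /in_addP[l [s [r rs]]] := gen.
pose rho i := mcomp r (cinj N i).
pose gam i x := psi (mcomp (elt_mor x) (rho i)).
have gamE i x y : phi (gam i x) y = ract x (rho i y) by rewrite psiE mcompE elt_morE.
exists l, (fun i => s 1 i), rho, gam; split=> // [i c x y|i a x|x].
- by apply: phi_ext => z; rewrite phiPE !gamE ract_linl.
- by apply: phi_ext => z; rewrite phiME !gamE phi_act.
under eq_bigr => i _ do rewrite gamE.
rewrite -ract_sumr; have -> : \sum_i rho i (s 1 i) = 1.
  rewrite -[RHS]rs [in RHS](copies_sum (s 1)) mor_sum.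
  by apply: eq_bigr => i _; rewrite mcompE.
by rewrite ract1.
Qed.

(** [F(D L)] is the dual of the left [G]-module [N], a summand of [G^l] by [dual_basis]; so it is a
    summand of [(D G)^l]. *)
Lemma F_dual_inj : injective_rmod (homF (dual_regular L)).
Proof.
have [l [u [rho [gam [gamE gamL gamM uE]]]]] := dual_basis.
apply/injP; exists l.
pose D := dual_regular L.
have xi_lin i : linear (fun f : homF D => (happ f (u i) : 'Hom(L, k^o)) 1 : k^o).
  by move=> c f g; rewrite happ_lin add_lfunE scale_lfunE.
pose s := cpair (fun i => dual_mor (lfun_of (xi_lin i))).
have sE (f : homF D) i a : (s f i : 'Hom(G, k^o)) a = (happ f (phi a (u i)) :
  'Hom(L, k^o)) 1.
  by rewrite cpairE dual_morE lfun_ofE happ_act.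
have eta_lin (th : copies (dual_regular G) l) :
    linear (fun m : N => \sum_i (th i : 'Hom(G, k^o)) (gam i m) : k^o).
  move=> c x y; rewrite scaler_sumr -big_split; apply: eq_bigr => i _.
  by rewrite gamL linearP.
have [c y z x|th a x|r rE] := @Fmor_of (copies (dual_regular G) l) D
    (fun th => dual_mor (lfun_of (eta_lin th))).
- apply/lfunP=> b; rewrite add_lfunE scale_lfunE !dual_morE !lfun_ofE.
  rewrite scaler_sumr -big_split; apply: eq_bigr => i _.
  by rewrite !ffunE add_lfunE scale_lfunE.
- apply/lfunP=> b; rewrite !dual_morE !lfun_ofE; apply: eq_bigr => i _.
  by rewrite ffunE dualE -gamM phi_act.
exists s, r => f; apply: happ_ext => x; apply/lfunP=> b.
rewrite rE dual_morE lfun_ofE.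
under eq_bigr => i _ do rewrite sE -FmorE.
have -> : happ f x b = (Fmor f (ract x b) : 'Hom(L, k^o)) 1 by rewrite -mor_dualE.
rewrite [in RHS](uE (ract x b)) mor_sum sum_lfunE.
by [].
Qed.

Lemma F_cofree_inj m : injective_rmod (homF (copies (dual_regular L) m)).
Proof. by apply: (inj_retract (F_copies _ _)); apply/inj_copies/F_dual_inj. Qed.

Variable n : nat.
Hypothesis rigid : forall j, (j.+1 < n)%N -> ext_vanish j N N.
Hypothesis ct : forall X, (forall j, (j.+1 < n)%N -> ext_vanish j N X) -> in_add N X.

(** [l] approximations resolve [K] by add N, and [F] turns this into a projective resolution. *)
Lemma F_pd_le l K : (forall j, (j + l.+1 < n)%N -> ext_vanish j N K) ->
  pd_le l (homF K).
Proof.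
elim: l K => [|l IHl] K EK.
  by apply: F_in_add; apply: ct => j jn; apply: EK; lia.
have [m [K' [i [p [sip happ]]]]] := add_approx K gen.
apply: (on_syzygy_syzygy (@proj_sretract _ _) (@F_proj m) (ses_F sip happ)).
by apply: IHl => j jn; apply: (approx_ext_vanish rigid sip happ EK); lia.
Qed.

(** By fullness a free presentation of [X] comes from some [f : N^b -> N^a]; by left exactness the
    second syzygy is [F(ker f)]. *)
Lemma hom_gldim (X : rmod G) : (0 < n)%N -> pd_le n.+1 X.
Proof.
move=> n0; have [a [p ps]] := F_cover X; have [K [i sip]] := ses_of_surj ps.
have [b [q qs]] := F_cover K.
have [f fE] := F_full (mcomp i q).
have [K2 [Y [j [c [sjc cE]]]]] : exists K2 Y (j : rmor K2 (copies N b))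
    (c : rmor (copies N b) Y), ses j c /\ (forall x, f x = 0 <-> c x = 0).
  apply: ses_of_pred => [|c x y fx fy|x a' fx]; first exact: mor0.
    by rewrite morD morZ fx fy scaler0 addr0.
  by rewrite morA fx ract0l.
have sjq : ses (Fmap j) q.
  split=> [||u|v qv]; [exact: Fmap_inj (ses_inj sjc) | exact: qs | |].
    apply: (ses_inj sip); rewrite -mcompE fE; apply: happ_ext => x.
    by rewrite !FmapE happ0; apply/cE; rewrite (ses_comp sjc).
  apply: (Fmap_ker sjc); apply: happ_ext => x; rewrite FmapE happ0; apply/cE.
  by rewrite -FmapE -fE mcompE qv mor0 happ0.
apply: (on_syzygy_syzygy (@proj_sretract _ _) (@F_proj a) sip).
(* Two steps are spent; for [l = n - 1] the hypothesis of [F_pd_le] is empty. *)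
rewrite -(prednK n0).
apply: (on_syzygy_syzygy (@proj_sretract _ _) (@F_proj b) sjq).
by apply: F_pd_le => j' j'n; exfalso; lia.
Qed.

Section Cores.
Variable JJ : rmod G -> Prop.
Hypothesis JF : forall m, JJ (homF (copies (dual_regular L) m)).

(** [F] keeps an injective coresolution exact as long as Ext(N, Y) vanishes, and left exactness
    gives two more terms. [JJ] stays abstract: it is taken once as the projective-injective modules,
    once as modules receiving no morphism from [T]. *)
Lemma F_cores l Y : (forall j, (j < l)%N -> ext_vanish j N Y) -> cores JJ l.+2 (homF Y).
Proof.
elim: l Y => [|l IHl] Y EY; have [m [i ii]] := cofree_embed Y;
    have [Y1 [p sip]] := ses_of_inj ii.
  have [W [q siq]] := ses_of_inj (Fmap_inj ii).
  exists (homF (copies (dual_regular L) m)), W, (Fmap i), q; split=> //.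
  have [w wE] : exists w : rmor W (homF Y1), forall u, w (q u) = Fmap p u.
    by apply: (ses_factor_r siq) => u; apply: Fmap_comp0.
  have wi : inje w.
    move=> z; have [u <-] := ses_surj siq z; rewrite wE.
    by move=> /(Fmap_ker sip)[v <-]; apply: (ses_comp siq).
  have [m1 [i1 i1i]] := cofree_embed Y1.
  have i2i : inje (mcomp (Fmap i1) w).
    by move=> z; rewrite mcompE => /(Fmap_inj i1i)/wi.
  have [W1 [q1 sq1]] := ses_of_inj i2i.
  by exists (homF (copies (dual_regular L) m1)), W1, (mcomp (Fmap i1) w), q1.
have happ := ext1_vanish_lift _ sip (EY 0%N (ltn0Sn _)).
exists (homF (copies (dual_regular L) m)), (homF Y1), (Fmap i), (Fmap p); split=> //.
  by apply: ses_F sip _ => g; apply: happ.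
apply: IHl => j jl; apply: (ext_vanish_shift_quo _ sip); first exact: cofree_inj.
exact: EY.
Qed.

End Cores.

Lemma psi_mor_inj : inje psi_mor.
Proof. by move=> u u0; apply: happ_ext => x; rewrite -psi_morE u0 phi0E happ0. Qed.

Lemma psi_mor_surj : surje psi_mor.
Proof.
move=> a; have aA : rhom (phi a) by move=> x b; apply: phi_act.
by exists (Fmk (RMor aA)); apply: phi_ext => x; rewrite psi_morE FmkE.
Qed.

Lemma regular_cores JJ : (0 < n)%N ->
  (forall m, JJ (homF (copies (dual_regular L) m))) ->
  cores JJ n.+1 (regular_rmod G).
Proof.
move=> n0 JF; have [g [gK pK]] := bij_inv psi_mor_inj psi_mor_surj.
have gi : inje g by move=> x gx; rewrite -(pK x) gx mor0.
have gs : surje g by move=> u; exists (psi_mor u).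
apply: (cores_iso gi gs); rewrite -(prednK n0).
by apply: F_cores => // j jn; apply: rigid; lia.
Qed.

End HomFunctor.

(** * The Nakayama functor *)

Section Nakayama.
Variables (k : fieldType) (L : falgType k).
Implicit Types (X Y Z P K : rmod L).
Let R := regular_rmod L.

Definition dhom X := subvs_of (homs X R).
Definition dap X (f : dhom X) (x : X) : L := vsval f x.

Lemma dap_ext X (f g : dhom X) : (forall x, dap f x = dap g x) -> f = g.
Proof. by move=> fg; apply/subvs_inj/lfunP. Qed.
Lemma dapP X (c : k) (f g : dhom X) x : dap (c *: f + g) x = c *: dap f x + dap g x.
Proof. by rewrite /dap linearP add_lfunE scale_lfunE. Qed.
Lemma dap_sum X T (s : seq T) (Q : pred T) (E : T -> dhom X) x :
  dap (\sum_(i <- s | Q i) E i) x = \sum_(i <- s | Q i) dap (E i) x.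
Proof. by rewrite /dap linear_sum sum_lfunE. Qed.
Lemma dmor_act X (f : dhom X) : rhom (vsval f : 'Hom(X, R)).
Proof. exact/homsP/subvsP. Qed.
Definition dmor X (f : dhom X) : rmor X R := RMor (dmor_act f).
Lemma dmorE X (f : dhom X) x : dmor f x = dap f x. Proof. by []. Qed.
Lemma dap_act X (f : dhom X) x a : dap f (ract x a) = dap f x * a.
Proof. exact: (dmor_act f). Qed.
Definition dmk X (f : rmor X R) : dhom X := vsproj (homs X R) (mfun f).
Lemma dmkE X (f : rmor X R) x : dap (dmk f) x = f x.
Proof. by rewrite /dap vsprojK // homs_mor. Qed.

Lemma dact_ex X a (f : dhom X) : exists g : dhom X, forall x, dap g x = a * dap f x.
Proof.
have gL : linear (fun x => a * dap f x : R).
  by move=> c x y; rewrite /dap linearP mulrDr scalerAr.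
have gA x b : a * dap f (ract x b) = ract (a * dap f x : R) b.
  by rewrite dap_act mulrA.
by exists (dmk (mor_of gL gA)) => x; rewrite dmkE mor_ofE.
Qed.

Definition dact X a (f : dhom X) : dhom X :=
  sval (constructive_indefinite_description _ (dact_ex a f)).
Lemma dactE X a (f : dhom X) x : dap (dact a f) x = a * dap f x.
Proof. by rewrite /dact; case: constructive_indefinite_description. Qed.

Fact dact_linear X a : linear (@dact X a).
Proof.
by move=> c f g; apply: dap_ext => x; rewrite dactE !dapP !dactE mulrDr scalerAr.
Qed.

Section Obj.
Variable X : rmod L.

Definition nu_act (xi : 'Hom(dhom X, k^o)) (a : L) : 'Hom(dhom X, k^o) :=
  (xi \o lfun_of (@dact_linear X a))%VF.
Fact nu_actE xi a f : nu_act xi a f = xi (dact a f).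
Proof. by rewrite /nu_act comp_lfunE lfun_ofE. Qed.
Fact nu_linl a : linear (nu_act^~ a).
Proof.
by move=> c f g; apply/lfunP=> x; rewrite nu_actE !add_lfunE !scale_lfunE !nu_actE.
Qed.
Fact nu_linr xi : linear (nu_act xi).
Proof.
move=> c a b; apply/lfunP=> f; rewrite add_lfunE scale_lfunE !nu_actE -linearP.
congr (xi _); apply: dap_ext => x.
by rewrite dapP !dactE mulrDl scalerAl.
Qed.
Fact nu_act1 xi : nu_act xi 1 = xi.
Proof.
apply/lfunP=> f; rewrite nu_actE; congr (xi _); apply: dap_ext => x.
by rewrite dactE mul1r.
Qed.
Fact nu_actM xi a b : nu_act xi (a * b) = nu_act (nu_act xi a) b.
Proof.
apply/lfunP=> f; rewrite !nu_actE; congr (xi _); apply: dap_ext => x.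
by rewrite !dactE mulrA.
Qed.

(* The Nakayama functor D Hom_L(-, L). *)
Definition nakayama : rmod L :=
  @RMod k L 'Hom(dhom X, k^o) nu_act nu_linl nu_linr nu_act1 nu_actM.

Definition nap (xi : nakayama) (f : dhom X) : k^o := (xi : 'Hom(dhom X, k^o)) f.

Lemma nap_ext (xi eta : nakayama) : (forall f, nap xi f = nap eta f) -> xi = eta.
Proof. by move=> E; apply/lfunP. Qed.
Lemma napP (c : k) (xi eta : nakayama) f :
  nap (c *: xi + eta) f = c *: nap xi f + nap eta f.
Proof. by rewrite /nap add_lfunE scale_lfunE. Qed.
Lemma nap_act (xi : nakayama) a f : nap (ract xi a) f = nap xi (dact a f).
Proof. exact: nu_actE. Qed.
Lemma nap0 f : nap 0 f = 0.
Proof. exact: zero_lfunE. Qed.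
Lemma nap_sum (xi : nakayama) T (s : seq T) (Q : pred T) (E : T -> dhom X) :
  nap xi (\sum_(i <- s | Q i) E i) = \sum_(i <- s | Q i) nap xi (E i).
Proof. exact: linear_sum. Qed.

End Obj.

Fact pull_linear X Y (g : rmor X Y) :
  linear (fun f : dhom Y => dmk (mcomp (dmor f) g)).
Proof.
by move=> c u v; apply: dap_ext => x; rewrite dapP !dmkE !mcompE !dmorE dapP.
Qed.
Definition pull X Y (g : rmor X Y) : 'Hom(dhom Y, dhom X) := lfun_of (pull_linear g).
Lemma pullE X Y (g : rmor X Y) f x : dap (pull g f) x = dap f (g x).
Proof. by rewrite lfun_ofE dmkE mcompE. Qed.

Fact nu_map_ex X Y (g : rmor X Y) : exists h : rmor (nakayama X) (nakayama Y),
  forall xi f, nap (h xi) f = nap xi (pull g f).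
Proof.
pose h (xi : nakayama X) : nakayama Y := ((xi : 'Hom(dhom X, k^o)) \o pull g)%VF.
have hE xi f : nap (h xi) f = nap xi (pull g f) by exact: comp_lfunE.
have hL : linear h by move=> c u v; apply: nap_ext => f; rewrite napP !hE napP.
have hA xi a : h (ract xi a) = ract (h xi) a.
  apply: nap_ext => f; rewrite nap_act !hE nap_act; congr nap.
  by apply: dap_ext => x; rewrite !(pullE, dactE).
by exists (mor_of hL hA) => xi f; rewrite mor_ofE hE.
Qed.
Definition nu_map X Y (g : rmor X Y) : rmor (nakayama X) (nakayama Y) :=
  sval (constructive_indefinite_description _ (nu_map_ex g)).
Lemma nu_mapE X Y (g : rmor X Y) xi f : nap (nu_map g xi) f = nap xi (pull g f).
Proof. by rewrite /nu_map; case: constructive_indefinite_description. Qed.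

(** With [nu_comp0] and [nu_ker]: nu is right exact, as [Hom(-, L)] is left exact and [D] is
    exact. *)
Lemma nu_surj X Y (g : rmor X Y) : surje g -> surje (nu_map g).
Proof.
move=> gs eta; exists ((eta : 'Hom(dhom Y, k^o)) \o (pull g)^-1)%VF.
apply: nap_ext => f; rewrite nu_mapE; apply: lfun_descend => {}f f0.
rewrite (_ : f = 0) ?linear0 //; apply: dap_ext => y.
by have [x <-] := gs y; rewrite -pullE f0 /dap linear0 !zero_lfunE.
Qed.

Lemma nu_comp0 X Y Z (i : rmor X Y) (p : rmor Y Z) xi : ses i p ->
  nu_map p (nu_map i xi) = 0.
Proof.
move=> sip; apply: nap_ext => f; rewrite !nu_mapE nap0.
rewrite (_ : pull i _ = 0); first exact: linear0.
apply: dap_ext => x; rewrite !pullE (ses_comp sip) /dap !linear0.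
by rewrite zero_lfunE.
Qed.

Lemma nu_ker X Y Z (i : rmor X Y) (p : rmor Y Z) eta : ses i p ->
  nu_map p eta = 0 -> exists zeta, nu_map i zeta = eta.
Proof.
move=> sip p0; exists ((eta : 'Hom(dhom Y, k^o)) \o (pull i)^-1)%VF.
apply: nap_ext => f; rewrite nu_mapE; apply: lfun_descend => {}f f0.
have [g gE] : exists g : rmor Z R, forall y, g (p y) = dmor f y.
  apply: (ses_factor_r sip) => x; rewrite dmorE -pullE f0.
  by rewrite /dap linear0 zero_lfunE.
have -> : f = pull p (dmk g) by apply: dap_ext => y; rewrite pullE dmkE gE.
by rewrite -[LHS]nu_mapE p0 nap0.
Qed.

(** Ext^1(Z, L) = 0 makes [Hom(Y, L) -> Hom(X, L)] surjective. *)
Lemma nu_inj X Y Z (i : rmor X Y) (p : rmor Y Z) : projective Y -> ses i p ->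
  ext_vanish 0 Z R -> inje (nu_map i).
Proof.
move=> pY sip EZ xi xi0; apply: nap_ext => f; rewrite nap0.
have [g gE] := EZ _ _ _ _ pY sip (dmor f).
have -> : f = pull i (dmk g) by apply: dap_ext => x; rewrite pullE dmkE gE.
by rewrite -nu_mapE xi0 nap0.
Qed.

(** The dual basis [u], [rho] makes [Hom(P, L)] a summand of a free left module, so its dual is a
    summand of copies of [D L]. *)
Lemma nu_proj_inj P : projective P -> injective_rmod (nakayama P).
Proof.
move=> /projP[l [s [r rs]]].
pose u i := r (cinj R i 1); pose rho i := mcomp (cproj R i) s.
have uE x : x = \sum_i ract (u i) (rho i x).
  rewrite -{1}(rs x) {1}(copies_sum (s x)) mor_sum; apply: eq_bigr => i _.
  rewrite -morA -morA mcompE cprojE; congr (r (cinj _ _ _)).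
  by rewrite /= mul1r.
have fE (f : dhom P) : f = \sum_i dact (dap f (u i)) (dmk (rho i)).
  apply: dap_ext => x; rewrite {1}(uE x) dap_sum -dmorE mor_sum.
  by apply: eq_bigr => i _; rewrite dactE dmkE dmorE dap_act.
apply/injP; exists l.
have xi_lin i : linear (fun xi : nakayama P => nap xi (dmk (rho i))).
  by move=> c f g; rewrite napP.
pose a := cpair (fun i => dual_mor (lfun_of (xi_lin i))).
have aE (xi : nakayama P) i b : (a xi i :
  'Hom(L, k^o)) b = nap xi (dact b (dmk (rho i))).
  by rewrite cpairE dual_morE lfun_ofE nap_act.
have th_lin (th : copies (dual_regular L) l) :
    linear (fun f : dhom P => \sum_i (th i : 'Hom(L, k^o)) (dap f (u i)) : k^o).
  move=> c f g; rewrite scaler_sumr -big_split; apply: eq_bigr => i _.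
  by rewrite dapP linearP.
pose b (th : copies (dual_regular L) l) : nakayama P := lfun_of (th_lin th).
have bE th f : nap (b th) f = \sum_i (th i : 'Hom(L, k^o)) (dap f (u i)).
  exact: lfun_ofE.
have bL : linear b.
  move=> c x y; apply: nap_ext => f; rewrite napP !bE scaler_sumr -big_split.
  by apply: eq_bigr => i _; rewrite !ffunE add_lfunE scale_lfunE.
have bA th g : b (ract th g) = ract (b th) g.
  apply: nap_ext => f; rewrite nap_act !bE; apply: eq_bigr => i _.
  by rewrite ffunE dualE dactE.
exists a, (mor_of bL bA) => xi; rewrite mor_ofE; apply: nap_ext => f.
by rewrite bE [in RHS](fE f) nap_sum; apply: eq_bigr => i _; rewrite aE.
Qed.

(** * Splitting off the projective part in global dimension at most [n] *)

Section Split.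
Variable n : nat.
Hypothesis gl : forall X, pd_le n X.

(** The conclusion is Ext^{n-j}(X, Kd) = 0. For [j = 0], [Kd] is a quotient of the injective
    [nu K'], and Ext^{n+1} vanishes. For larger [j], Ext^1(K, L) = 0 gives [Kd = nu K'], a cosyzygy
    of the kernel one step further. *)
Lemma nu_kernel_ext_vanish j K K' P (i : rmor K' P) (p : rmor P K) :
  projective P -> ses i p -> pd_le j.+1 K -> (forall l, (l < j)%N ->
    ext_vanish l K R) ->
  (j < n)%N -> forall X Kd (io : rmor Kd (nakayama P)), ses io (nu_map p) ->
  ext_vanish (n - j.+1) X Kd.
Proof.
elim: j K K' P i p => [|j IHj] K K' P i p pP sip dK EK jn X Kd io sio.
all: have [c cE] : exists c : rmor (nakayama K') Kd, forall xi, io (c xi) = nu_map i xi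
  by apply: (ses_factor_l sio) => xi; apply: nu_comp0.
all: have cs : surje c.
1,3: move=> y; have [z zE] := nu_ker sip (ses_comp sio y);
  by exists z; apply: (inje_inj (ses_inj sio)); rewrite cE.
  have pK' : projective K' := dK _ _ _ _ pP sip.
  have [Z [a sac]] := ses_of_surj cs.
  apply: (ext_vanish_les_quo sac); first by apply/ext_vanish_inj/nu_proj_inj.
  by apply: pd_le_ext_vanish; rewrite subn1 prednK.
have ci : inje c.
  move=> x x0; apply: (nu_inj pP sip (EK 0%N (ltn0Sn _))).
  by rewrite -cE x0 mor0.
apply: (ext_vanish_retractr (bij_retract ci cs)).
have [P' [K'' [i' [p' [pP' sip']]]]] := proj_ses K'.
have [Kd' [io' sio']] := ses_of_surj (nu_surj (ses_surj sip')).
apply: (ext_vanish_shift_quo (nu_proj_inj pP') sio').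
have -> : (n - j.+2).+1 = (n - j.+1)%N by lia.
apply: (IHj _ _ _ _ _ pP' sip' (dK _ _ _ _ pP sip) _ (ltnW jn) _ _ _ sio').
by move=> l lj; apply: (EK l.+1 lj) sip.
Qed.

(* That is, N = P + N' with P projective and Hom(N', L) = 0, and p s is the
   projection onto P. *)
Lemma torsionless_split N : (0 < n)%N -> (forall l, (l.+1 < n)%N -> ext_vanish l N R) ->
  exists q (s : rmor N (copies R q)) (p : rmor (copies R q) N),
    forall (f : rmor N R) x, f (p (s x)) = f x.
Proof.
move=> n0 EN; have [q [p ps]] := free_cover N.
have [K [i sip]] := ses_of_surj ps.
have [Kd [io sio]] := ses_of_surj (nu_surj ps).
have pP : projective (copies R q) by apply: proj_copies; apply: regular_proj.
(* The case [j = n - 1], which is Ext^1; so [nu (L^q) -> nu N] splits. *)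
have EKd X : ext_vanish 0 X Kd.
  have := @nu_kernel_ext_vanish n.-1 N K _ i p pP sip.
  rewrite prednK // subnn => H; apply: (H (gl N) _ (leqnn n) X _ io sio).
  by move=> l ln; apply: EN; lia.
have [sg sgE] := ses_split sio (EKd (nakayama N)).
pose g j := dmk (cproj R j).
have ev_lin j : linear (fun xi : nakayama N => nap (sg xi) (@g q j)).
  by move=> c u v; rewrite linearP napP.
(* The splitting is dualised: [xi |-> sg xi (g j)] is a functional on [D Hom(N, L)], hence
   evaluation at some [h j]; these are the coordinates of [s]. *)
have hE j : exists h : dhom N, forall xi, nap (sg xi) (@g q j) = nap xi h.
  have [h hE] := functional_rep (lfun_of (ev_lin j)).
  by exists h => xi; have := hE xi; rewrite lfun_ofE.
have {hE} /fin_all_exists[h hE] := hE.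
exists q, (cpair (fun j => dmor (h j))), p => f x.
pose a j := dap (pull p (dmk f)) (cinj R j 1).
have fE : pull p (dmk f) = \sum_j dact (a j) (@g q j).
  apply: dap_ext => v; rewrite dap_sum {1}(copies_sum v) -dmorE mor_sum.
  apply: eq_bigr => j _; rewrite dactE dmkE cprojE dmorE /a -dap_act -morA.
  by rewrite /= mul1r.
have ->: f (p (cpair (fun j => dmor (h j)) x)) = dap (\sum_j dact (a j) (h j)) x.
  rewrite -(dmkE f) -pullE fE !dap_sum; apply: eq_bigr => j _.
  by rewrite !dactE dmkE cprojE cpairE.
rewrite -[RHS](dmkE f); congr (dap _ x); apply/eqP; rewrite -subr_eq0; apply/eqP.
apply: functional_sep => xi; rewrite linearB; apply/eqP; rewrite subr_eq0; apply/eqP.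
rewrite -[LHS]/(nap (xi : nakayama N) _) -[RHS]/(nap (xi : nakayama N) _).
rewrite -[in RHS](sgE xi) nu_mapE fE !nap_sum; apply: eq_bigr => j _.
by rewrite -!nap_act -hE morA.
Qed.

End Split.
End Nakayama.

(** * The self-extensions of D Gamma by Gamma *)

(** In degree 1, morphisms from [T] to the first cosyzygy vanish because it embeds in the next term;
    higher degrees follow by shifting. *)
Lemma ext_vanish_orthogonal (k : fieldType) (G : falgType k) (JJ : rmod G ->
  Prop) (T : rmod G) :
  (forall J, JJ J -> injective_rmod J /\ forall (h : rmor T J) t, h t = 0) ->
  forall j Z, cores JJ j.+2 Z -> ext_vanish j T Z.
Proof.
move=> JT; elim=> [|j IHj] Z [J [Z' [a [b [/JT[iJ _] sab cZ]]]]].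
  apply: (ext1_vanish_of_lift sab (inj_ext1_vanish iJ)) => f; exists (mzero T J) => t.
  have [J' [Z'' [a' [b' [/JT[_ T0] sab' _]]]]] := cZ.
  by rewrite mzeroE mor0; apply/esym/(ses_inj sab'); rewrite -mcompE T0.
exact: ext_vanish_shift_sub iJ sab (IHj _ cZ).
Qed.

Section EndDual.
Variables (k : fieldType) (G L : falgType k) (N : rmod L).
Variable phi : G -> 'End(N).
Hypothesis phi_lin : linear phi.
Hypothesis phi1 : phi 1 = \1%VF.
Hypothesis phiM : forall a b, phi (a * b) = (phi a \o phi b)%VF.
Hypothesis phi_inj : injective phi.
Hypothesis phi_img : forall f : 'End(N), rhom f <-> exists a, phi a = f.
Hypothesis gen : in_add N (regular_rmod L).
Hypothesis cogen : in_add N (dual_regular L).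

Let FN := homF phi_lin phi1 phiM phi_img.
Let psiN := psi phi_img.
Let R := regular_rmod L.
Let DL := dual_regular L.
Let DG := dual_regular G.
Let phiME := phiME phiM.

Variables (q : nat) (s : rmor N (copies R q)) (p : rmor (copies R q) N).
Hypothesis psK : forall (f : rmor N R) x, f (p (s x)) = f x.

Let eps := psiN (mcomp p s).

Lemma epsE x : phi eps x = p (s x).
Proof. by rewrite psiE mcompE. Qed.

(** [psK], applied to the coordinates of [s], gives [s p s = s]. *)
Lemma eps_idem : eps * eps = eps.
Proof.
apply: (phi_ext phi_inj) => x; rewrite phiME !epsE; congr (p _).
apply/ffunP=> i; have := psK (mcomp (cproj R i) s) x.
by rewrite !mcompE !cprojE.
Qed.

(* phi -> phi(- eps) factors through the projective module D Hom(L^q, N). *)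
Lemma rmul_dual_eps_factor : exists (a : rmor DG (copies (FN DL) q))
    (b : rmor (copies (FN DL) q) DG), forall th, rmul_dual eps th = b (a th).
Proof.
pose si i := mcomp (cproj R i) s; pose pi i := p (cinj R i 1).
pose ga i m := psiN (mcomp (elt_mor m) (si i)).
have gaE i m x : phi (ga i m) x = ract m (si i x) by rewrite psiE mcompE elt_morE.
have ga_lin i : linear (ga i).
  move=> c x y; apply: (phi_ext phi_inj) => z.
  by rewrite (phiPE phi_lin) !gaE ract_linl.
have gaM i a m : ga i (phi a m) = a * ga i m.
  by apply: (phi_ext phi_inj) => z; rewrite phiME !gaE (phi_act phi_img).
have th_lin i (th : DG) : linear (fun m => (th : 'Hom(G, k^o)) (ga i m) : k^o).
  by move=> c x y; rewrite ga_lin linearP.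
have aE i : exists a : rmor DG (FN DL), forall th m l,
    (happ (a th) m : 'Hom(L, k^o)) l = (th : 'Hom(G, k^o)) (ga i (ract m l)).
  have [c y z x|th a x|a aE] := @Fmor_of _ _ _ _ _ phi_lin phi1 phiM phi_img DG DL
      (fun th => dual_mor (lfun_of (th_lin i th))).
  - apply/lfunP=> b; rewrite add_lfunE scale_lfunE !dual_morE !lfun_ofE.
    by rewrite add_lfunE scale_lfunE.
  - by apply/lfunP=> b; rewrite !dual_morE !lfun_ofE dualE -gaM (phi_act phi_img).
  by exists a => th m l; rewrite aE dual_morE lfun_ofE.
have {aE} /fin_all_exists[a aE] := aE.
have xi_lin i : linear (fun h : FN DL => (happ h (pi i) : 'Hom(L, k^o)) 1 : k^o).
  by move=> c f g; rewrite happ_lin add_lfunE scale_lfunE.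
exists (cpair a), (csum (fun i => dual_mor (lfun_of (xi_lin i)))) => th.
apply/lfunP=> g; rewrite csumE sum_lfunE rmul_dualE.
have -> : g * eps = \sum_i ga i (phi g (pi i)).
  apply: (phi_ext phi_inj) => x; rewrite phiME epsE.
  have phi_sum (E : 'I_q -> G) : phi (\sum_i E i) x = \sum_i phi (E i) x.
    apply: (big_morph (fun a => phi a x)) => [a1 b1|]; last exact: phi0E.
    by have := phiPE phi_lin 1 a1 b1 x; rewrite !scale1r.
  rewrite phi_sum (copies_sum (s x)) mor_sum linear_sum; apply: eq_bigr => i _.
  rewrite /= gaE mcompE cprojE -(phi_act phi_img) -!morA.
  by congr (phi g (p (cinj _ _ _))); rewrite /= mul1r.
rewrite linear_sum; apply: eq_bigr => i _.
by rewrite dual_morE lfun_ofE cpairE happ_act aE ract1.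
Qed.

(** [H] is dual to a map [m |-> sum_i gam_i(m) c_i] from [N] to [G], whose values factor through [L]
    and so absorb [eps]. Hence [H] vanishes on the part of [D G] complementary to [eps]. *)
Lemma mor_to_F_eps (H : rmor DG (FN DL)) th : H (rmul_dual eps th) = H th.
Proof.
have [l [u [rho [gam [gamE gamL gamM uE]]]]] :=
  dual_basis phi_lin phiM phi_inj phi_img gen.
have ev_lin i : linear (fun th : DG => (happ (H th) (u i) : 'Hom(L, k^o)) 1 : k^o).
  by move=> c f g; rewrite linearP happ_lin add_lfunE scale_lfunE.
have cE i : exists c, forall th : DG, (happ (H th) (u i) : 'Hom(L, k^o)) 1 = th c.
  have [c cE] := functional_rep (lfun_of (ev_lin i)).
  by exists c => th'; rewrite -cE lfun_ofE.
have {cE} /fin_all_exists[c cE] := cE.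
have HE th' m : (happ (H th') m : 'Hom(L, k^o)) 1 =
    \sum_i (th' : 'Hom(G, k^o)) (gam i m * c i).
  rewrite {1}(uE m) -FmorE mor_sum sum_lfunE; apply: eq_bigr => i _.
  by rewrite FmorE -happ_act -morA cE dualE.
apply: happ_ext => m; apply/lfunP=> b.
rewrite -!FmorE mor_dualE [RHS]mor_dualE !FmorE !HE.
apply: eq_bigr => i _; rewrite rmul_dualE; congr (th _).
(* [gam i m * c i] acts through the morphism [rho i (c i -)] from [N] to [L], which [p s] does not
   change. *)
apply: (phi_ext phi_inj) => x; rewrite -mulrA !phiME !gamE epsE; congr ract.
have cA : rhom (phi (c i)) by move=> y d; apply: (phi_act phi_img).
by have := psK (mcomp (rho i) (RMor cA)) x; rewrite !mcompE.
Qed.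

Lemma dual_ext_vanish n : (0 < n)%N -> (forall j, (j.+1 < n)%N -> ext_vanish j N N) ->
  forall j, (j < n)%N -> ext_vanish j DG (regular_rmod G).
Proof.
move=> n0 rig j jn; pose th := rmul_dual eps.
pose d := madd (mid DG) (mopp th).
have dE f : d f = f - th f by rewrite !morE.
have thth f : th (th f) = th f.
  by apply/lfunP=> x; rewrite !rmul_dualE -mulrA eps_idem.
pose T := submod (mor_limg d); pose r0 : rmor T DG := sincl (mor_limg d).
have r0i : inje r0 by apply: sincl_inj.
have [s0 s0E] : exists s0 : rmor DG T, forall f, r0 (s0 f) = d f.
  by apply: mor_factor_inj => // f; apply/sinclP/limgP; exists f.
have s0s t : exists f, s0 f = t.
  have /(sinclP (mor_limg d))/limgP[f fE] : exists t', r0 t' = r0 t by exists t.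
  by exists f; apply: (inje_inj r0i); rewrite s0E.
have [a [b abE]] := rmul_dual_eps_factor.
(* The part [th] of the identity factors through copies of [F(D L)], projective because [D L] is in
   add N; only [T] contributes to Ext. *)
have DT : sretract DG T.
  exists s0, r0, (copies (FN DL) q), a, b; split; last first.
    by move=> f; rewrite s0E dE -abE subrK.
  by apply: proj_copies; apply: F_in_add.
apply: (ext_vanish_sretractl DT).
pose JJ J := injective_rmod J /\ forall (h : rmor T J) t, h t = 0.
apply: (@ext_vanish_orthogonal _ _ JJ) => //.
have JF m : JJ (FN (copies DL m)).
  split; first exact: F_cofree_inj.
  move=> h t; have [f <-] := s0s t.
  have -> : s0 f = s0 (d f).
    by apply: (inje_inj r0i); rewrite !s0E !dE morB thth subrr subr0.
  apply: happ_ext => x; rewrite happ0; apply/ffunP=> i; rewrite ffunE.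
  have := mor_to_F_eps (mcomp (Fmap phi_lin phi1 phiM phi_img (cproj DL i)) (mcomp h s0)) f.
  move/eqP; rewrite eq_sym -subr_eq0 -morB -[rmul_dual _ _]/(th f) -dE => /eqP.
  rewrite !mcompE => E; have := congr1 (fun u => happ u x) E.
  by rewrite FmapE cprojE happ0.
apply: (cores_mono (m := n.+1)) => //.
apply: (@regular_cores _ _ _ _ _ phi_lin phi1 phiM phi_inj phi_img n rig JJ n0 JF).
Qed.

End EndDual.

Lemma domdim_of_cluster_tilting (k : fieldType) (n : nat) (G L : falgType k) (N :
  rmod L) :
  (0 < n)%N -> gldim_le L n -> cluster_tilting n N -> iso_to_End G N ->
  [/\ gldim_le G n.+1, domdim_ge G n.+1
    & forall i, (0 < i <= n)%N -> ext_zero i (dual_regular G) (regular_rmod G)].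
Proof.
move=> n0 gl /cluster_tilting_elim[gen injN rig ct] [phi [phiL phi1 phiM phiI phiH]].
have {}gl (X : rmod L) : pd_le n X by apply/pdim_leP/gl.
split.
- by move=> X; apply/pdim_leP; apply: (hom_gldim phiL phi1 phiM phiI phiH gen rig ct).
- apply/domdim_geP; apply: (@regular_cores _ _ _ _ _ phiL phi1 phiM phiI phiH n rig proj_inj n0) => m; split.
    by apply: F_in_add => //; apply: injN; apply: cofree_inj.
  exact: F_cofree_inj.
have ENR l : (l.+1 < n)%N -> ext_vanish l N (regular_rmod L).
  have /in_addP[m Rm] := gen.
  by move=> ln; apply/(ext_vanish_retractr Rm)/ext_vanish_copiesr/rig.
have [q [s [p psK]]] := torsionless_split gl n0 ENR.
move=> [//|i] ilt; apply/ext_zeroP.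
apply: (dual_ext_vanish phiL phi1 phiM phiI phiH gen _ psK n0 rig) ilt.
by apply: injN; apply: dual_inj.
Qed.

Theorem theorem1p20 (k : fieldType) (n : nat) (hn : (1 <= n)%N)
    (Gamma : falgType k) :
  (exists (Lambda : falgType k) (M : rmod Lambda),
      [/\ gldim_le Lambda n, cluster_tilting n M & iso_to_End Gamma M])
  <->
  [/\ gldim_le Gamma n.+1, domdim_ge Gamma n.+1
    & forall i : nat, (0 < i <= n)%N ->
        ext_zero i (dual_regular Gamma) (regular_rmod Gamma)].
Proof.
split=> [[Lambda [M [gl ct isoM]]] | [gl dd ext]].
  exact: domdim_of_cluster_tilting gl ct isoM.
exact: cluster_tilting_of_domdim.
Qed.
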